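(* Let $\{X_n\}_{n=-\infty}^{\infty}$ be a real-valued stationary time series with $E(|X_0|^2)<\infty$, and let $\lambda_n$, $m_n$, $\tilde X^0_{-\infty}$ and $e(\cdot)$ be the stopping times, estimates, limiting sequence and conditional mean function associated with it as defined in the context. (1) Almost surely $$\lim_{n\to\infty} m_n=\lim_{n\to\infty}E\big(X_{\lambda_n+1}\,\big|\,[X_0^{\lambda_n}]^n\big)=e(\tilde X^0_{-\infty}),$$ and almost surely $$\lim_{n\to\infty}\Big|m_n-E\big(X_{\lambda_n+1}\,\big|\,[X_0^{\lambda_n}]^n\big)\Big|=0.$$ (2) If in addition the conditional expectation $E(X_1|X_{-\infty}^0)$ is almost surely continuous (in the sense defined in the context), then almost surely $$\lim_{n\to\infty}\Big|m_n-E\big(X_{\lambda_n+1}\,\big|\,X_0^{\lambda_n}\big)\Big|=0.$$ (3) There exists a stationary and ergodic Markov chain $\{X_n\}$ taking values in a countable subset of the unit interval such that $$P\Big(\limsup_{n\to\infty}\Big|m_n-E\big(X_{\lambda_n+1}\,\big|\,X_0^{\lambda_n}\big)\Big|>0\Big)>0.$$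
   Context: Time series are regarded as two-sided processes $\{X_n\}_{n=-\infty}^{\infty}$ (a one-sided stationary process $\{X_n\}_{n\ge 0}$ can always be extended to a two-sided stationary one). For $m\le n$ write $X_m^n=(X_m,\dots,X_n)$, and $X_{-\infty}^0=(\dots,X_{-1},X_0)$; similarly for other sequences. **Quantization.** For $k\ge 0$ let $\mathcal P_k=\{[i2^{-k},(i+1)2^{-k}) : i\in\mathbb Z\}$, a nested sequence of partitions of $\mathbb R$. For $x\in\mathbb R$, $[x]^k$ denotes the unique interval of $\mathcal P_k$ containing $x$, and $[X_m^n]^k=([X_m]^k,\dots,[X_n]^k)$. For each $k$, $f_k:\mathcal P_k\to\mathbb R$ is a fixed (arbitrary) function with $f_k(A)\in A$ for every $A\in\mathcal P_k$. **Stopping times.** $\lambda_0=0$ and for $n\ge 1$ $$\lambda_n=\lambda_{n-1}+\min\{t>0 : [X_t^{\lambda_{n-1}+t}]^n=[X_0^{\lambda_{n-1}}]^n\}.$$ (These are almost surely finite for stationary processes; $\lambda_n\ge n$, and $\lambda_n$ is a stopping time with respect to the quantized sequence $[X_0]^n,[X_1]^n,\dots$.) **Estimates.** For $n\ge 1$, $$m_n=\frac1n\sum_{j=0}^{n-1}f_j\big([X_{\lambda_j+1}]^j\big).$$ **Conditioning.** $E(\,\cdot\,|[X_0^{\lambda_n}]^n)$ and $E(\,\cdot\,|X_0^{\lambda_n})$ denote conditional expectation given the $\sigma$-algebra generated by the random-length vector $[X_0^{\lambda_n}]^n=([X_0]^n,\dots,[X_{\lambda_n}]^n)$, respectively $X_0^{\lambda_n}=(X_0,\dots,X_{\lambda_n})$.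 **Limiting sequence.** $\tilde X_{-n}=\lim_{j\to\infty}X_{\lambda_j-n}$ for $n\ge 0$; the limit exists almost surely because the intervals $[X_{\lambda_j-n}]^j$, $j\ge n$, are nested with lengths tending to $0$. Put $\tilde X^0_{-\infty}=(\dots,\tilde X_{-1},\tilde X_0)$. **Conditional mean function.** Let $\mathbb R^{*-}=\{(\dots,x_{-1},x_0): x_i\in\mathbb R \text{ for all } i\le 0\}$ and define $e:\mathbb R^{*-}\to\mathbb R$ by $e(x_{-\infty}^0)=E(X_1|X_{-\infty}^0=x_{-\infty}^0)$ (a fixed version of the regression function of $X_1$ on the past $X_{-\infty}^0$). **Almost sure continuity.** Equip $\mathbb R^{*-}$ with the metric $$d^*\big((\dots,x_{-1},x_0),(\dots,y_{-1},y_0)\big)=\sum_{i=0}^\infty 2^{-i-1}\frac{|x_{-i}-y_{-i}|}{1+|x_{-i}-y_{-i}|}.$$ The conditional expectation $E(X_1|X_{-\infty}^0)$ is called almost surely continuous if there is a set $B\subseteq\mathbb R^{*-}$ of probability one, i.e. $P(X_{-\infty}^0\in B)=1$, such that (a version of) $e$ restricted to $B$ is continuous with respect to $d^*$. *)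

(* Defs.v *)
From HB Require Import structures.
From mathcomp Require Import all_boot all_order all_algebra.
From mathcomp Require Import all_classical all_reals all_analysis.
Import Order.TTheory GRing.Theory Num.Theory.
Import numFieldNormedType.Exports.

Set Implicit Arguments.
Unset Strict Implicit.
Unset Printing Implicit Defensive.

Local Open Scope classical_set_scope.
Local Open Scope ring_scope.

Section quantization.
Context {R : realType}.

(* The partition P_k is {cell k i | i : int}, and [quant k x] is [x]^k. *)
Definition cell (k : nat) (i : int) : set R :=
  [set x | i%:~R * 2 ^- k <= x < (i + 1)%:~R * 2 ^- k].

Definition quant (k : nat) (x : R) : set R := cell k (Num.floor (x * 2 ^+ k)).

(* f_k is a function on P_k; [f k] is unconstrained outside of P_k, where it is
   never evaluated. *)
Definition is_selector (f : nat -> set R -> R) :=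
  forall k i, cell k i (f k (cell k i)).

End quantization.

(* Least element of A; 0 by convention if A is empty. *)
Definition nat_min (A : set nat) : nat :=
  xget 0%N [set t | A t /\ forall s, A s -> (t <= s)%N].

Section sample_path.
Context {R : realType}.
Implicit Types (x : int -> R) (f : nat -> set R -> R).

(* lambda_n along the sample path x. Because of the convention for [nat_min], a
   step whose defining set is empty has length 0; for a stationary process this
   happens with probability 0. *)
Fixpoint lambda x (n : nat) : nat :=
  if n is n'.+1 then
    (lambda x n' +
     nat_min [set t : nat | (0 < t)%N /\
       forall i : nat, (i <= lambda x n')%N ->
         quant n (x (t + i)%N) = quant n (x i)])%N
  else 0%N.

(* x_{lambda_n + 1} *)
Definition next_value x (n : nat) : R := x (lambda x n).+1.

Definition estimate f x (n : nat) : R :=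
  n%:R^-1 * \sum_(0 <= j < n) f j (quant j (next_value x j)).

(* An element (..., x_{-1}, x_0) of R^{*-} is encoded as the sequence
   i |-> x_{-i}. *)
Definition past x : nat -> R := fun i => x (- i%:Z).

Definition limit_past x : nat -> R :=
  fun i => limn (fun j => x ((lambda x j)%:Z - i%:Z)).

Definition dstar (x y : nat -> R) : R :=
  limn (series (fun i : nat =>
    2 ^- i.+1 * (`|x i - y i| / (1 + `|x i - y i|)))).

Definition dstar_continuous_on (B : set (nat -> R)) (e : (nat -> R) -> R) :=
  forall x, B x -> forall eps : R, 0 < eps ->
    exists2 delta : R, 0 < delta &
      forall y, B y -> dstar x y < delta -> `|e x - e y| < eps.

(* Product sigma-algebra on R^I *)
Definition product_sigma (I : Type) : set (set (I -> R)) :=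
  <<s [set A | exists (i : I) (B : set R),
         measurable B /\ A = [set x | B (x i)]] >>.

End sample_path.

Section conditional_expectation.
Context d (T : measurableType d) (R : realType) (P : probability T R).

(* Y is a version of E(X | G), for a sub-sigma-algebra G of T *)
Definition is_cond_exp (G : set (set T)) (X Y : T -> R) :=
  [/\ P.-integrable setT (EFin \o Y),
      forall B : set R, measurable B -> G (Y @^-1` B) &
      forall A, G A ->
        (\int[P]_(w in A) (Y w)%:E = \int[P]_(w in A) (X w)%:E)%E].

(* A chosen version of E(X | G); versions agree almost surely, and they exist
   whenever X is integrable. *)
Definition cond_exp (G : set (set T)) (X : T -> R) : T -> R :=
  xget (cst 0) [set Y | is_cond_exp G X Y].

(* sigma-algebra generated by the random-length vector (Z_0, ..., Z_L), whose
   entries take values in a space V with sigma-algebra E. The vector lives in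
   the disjoint union of the V^{l+1}, which is generated by the sets "the
   length is l+1 and the i-th entry is in B", i <= l, E B. *)
Definition vector_sigma (V : Type) (E : set (set V)) (L : T -> nat)
    (Z : nat -> T -> V) : set (set T) :=
  <<s [set A | exists (l i : nat) (B : set V),
         [/\ (i <= l)%N, E B & A = [set w | L w = l /\ B (Z i w)]] ] >>.

End conditional_expectation.

Section process.
Context d (T : measurableType d) (R : realType) (P : probability T R).
Variable X : int -> {RV P >-> R}.

Definition sample_path (w : T) : int -> R := fun i => X i w.

Definition stationary :=
  forall (h : int) (A : set (int -> R)), product_sigma A ->
    P [set w | A (fun i => X (i + h) w)] = P [set w | A (sample_path w)].

Definition ergodic :=
  forall A : set (int -> R), product_sigma A ->
    (forall x, A (fun i => x (i + 1)) <-> A x) ->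
    P [set w | A (sample_path w)] = 0%E \/ P [set w | A (sample_path w)] = 1%E.

Definition cond_prob (A B : set T) : R := fine (P (A `&` B)) / fine (P B).

(* P(X_{n+1} = t | X_n = s_0, ..., X_{n-k} = s_k) = P(X_{n+1} = t | X_n = s_0)
   whenever the left-hand side is defined *)
Definition markov_chain :=
  forall (n : int) (k : nat) (s : nat -> R) (t : R),
    let H := [set w | forall i : nat, (i <= k)%N -> X (n - i%:Z) w = s i] in
    (0 < P H)%E ->
    cond_prob [set w | X (n + 1) w = t] H =
    cond_prob [set w | X (n + 1) w = t] [set w | X n w = s 0%N].

(* e is a version of the regression function of X_1 on the past *)
Definition is_cond_mean (e : (nat -> R) -> R) :=
  (forall B : set R, measurable B -> product_sigma (e @^-1` B)) /\
  is_cond_exp P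
    (preimage_set_system setT (past \o sample_path) (@product_sigma R nat))
    (X 1) (e \o past \o sample_path).

Definition almost_surely_continuous :=
  exists (e : (nat -> R) -> R) (B : set (nat -> R)),
    [/\ is_cond_mean e, product_sigma B,
        P [set w | B (past (sample_path w))] = 1%E & dstar_continuous_on B e].

(* E(X_{lambda_n + 1} | [X_0^{lambda_n}]^n); a quantized value ranges over the
   countable set P_n, which carries its discrete sigma-algebra. *)
Definition cond_exp_quantized (n : nat) : T -> R :=
  cond_exp P
    (vector_sigma setT (fun w => lambda (sample_path w) n)
                  (fun i w => quant n (X i w)))
    (fun w => next_value (sample_path w) n).

(* E(X_{lambda_n + 1} | X_0^{lambda_n}) *)
Definition cond_exp_full (n : nat) : T -> R :=
  cond_exp P
    (vector_sigma measurable (fun w => lambda (sample_path w) n)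
                  (fun i w => X i w))
    (fun w => next_value (sample_path w) n).

End process.

(* Main.v *)
(** Reversing time turns lambda_n = l into an event about the past seen from
    time l, so by stationarity the process seen from time lambda_n has the law of
    the process itself. Hence the limiting sequence has the law of the past, and
    the quantized block [X_0^{lambda_n}]^n is the n-th quantized code of that
    sequence. The conditional expectations given these codes form a martingale,
    which converges to e(limiting sequence); the errors of the summands of m_n
    are orthogonal in L2, so they average out by a strong law. This is (1). For
    (2), almost sure continuity makes e nearly constant on an atom of a fine code,
    and the exact block only refines the code.

    For (3), let Z_n be i.i.d. with geometric law on the naturals and
    X_n = 1[Z_{n-1} <> 0]/2 + s(Z_n), where s(0) = 0 and s(k) = 2^-(2^(k+1)) for
    k > 0. Then e(y) = 1[y_0 notin {0, 1/2}]/2 + E s(Z_0). At level n the states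
    with 2^(k+1) > n are quantized like the one with k = 0, and the total mass of
    those with k <> 0 is of order 1/n, which is not summable. So
    Z_{lambda_n} <> 0 infinitely often, while with probability 1/2 the limiting
    sequence has its last entry in {0, 1/2}. *)

Require Import Defs.
From mathcomp Require Import all_boot all_order all_algebra.
From mathcomp Require Import all_classical all_reals all_analysis.
Import Order.TTheory GRing.Theory Num.Theory.
Import numFieldNormedType.Exports.
From mathcomp Require Import measurable_realfun.
From mathcomp Require Import zify ring lra.

Set Implicit Arguments.
Unset Strict Implicit.
Unset Printing Implicit Defensive.

Local Open Scope classical_set_scope.
Local Open Scope ring_scope.

(** * Recurrence times of a sequence *)

Section quantization_lemmas.
Context {R : realType}.
Implicit Types (x y : R) (k : nat) (i : int).

(** The sigma-algebras of the quantized blocks come from countable partitions, so conditional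
    expectations are ratios over atoms, and L2 martingales along such partitions suffice. The
    limiting sequence has the same recurrence times as the path, and the cell of the value following
    time lambda_j can be read in it lambda_{j+1} - lambda_j - 1 steps back. So the estimates are
    functions of the limiting sequence, and the convergence in (1) is proved under one fixed law on
    one-sided sequences and then carried over. Two obstacles shape the rest. Cells are half open, so
    a limit of values in a cell may be its right endpoint and get another code; such paths are shown
    to be null. The exact blocks are only close to the limiting sequence and are not functions of
    it, so (2) has no martingale behind it: averaging e over an atom, with e almost constant there,
    takes its place. In (3), the doubly exponential jumps turn the resolution 2^-n of level n into a
    probability of order 1/n, just large enough for a divergent series. *)

Definition qindex k x : int := Num.floor (x * 2 ^+ k).

Lemma cellP k i x : cell k i x <-> qindex k x = i.
Proof.
rewrite /cell /qindex /= ler_pdivrMr// ltr_pdivlMr//; split.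
  exact: floor_def.
by move=> <-; exact: floor_itv.
Qed.

Lemma quantP k x y : quant k x = quant k y <-> qindex k x = qindex k y.
Proof.
rewrite /quant -!/(qindex _ _); split => [xy|->//].
have : cell k (qindex k x) x by apply/cellP.
by rewrite xy => /cellP.
Qed.

Lemma mem_quant k x : quant k x x.
Proof. exact/cellP. Qed.

Lemma qindexS k x : qindex k x = (qindex k.+1 x %/ 2)%Z.
Proof.
have /andP[h1 h2] := floor_itv (x * 2 ^+ k.+1).
rewrite -/(qindex k.+1 x) in h1 h2 *.
set i := qindex _ x in h1 h2 *.
have r0 := modz_ge0 i (isT : 2 != 0 :> int).
have r2 := ltz_pmod i (isT : 0 < 2 :> int).
have iE : i%:~R = 2 * (i %/ 2)%Z%:~R + (i %% 2)%Z%:~R :> R.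
  by rewrite {1}(divz_eq i 2) intrD intrM mulrC.
apply: floor_def; move: h1 h2; rewrite exprS mulrCA !intrD iE.
have : (0 <= (i %% 2)%Z%:~R :> R) by rewrite ler0z.
have : ((i %% 2)%Z%:~R <= 1 :> R) by rewrite lerz1 -ltzD1.
by move: ((i %/ 2)%Z%:~R) ((i %% 2)%Z%:~R) => a b; lra.
Qed.

Lemma qindex_le k k' x y : (k <= k')%N ->
  qindex k' x = qindex k' y -> qindex k x = qindex k y.
Proof.
move=> /subnK <-; elim: (k' - k)%N => // n IH; rewrite addSn => h.
by apply: IH; rewrite (qindexS _ x) (qindexS _ y) h.
Qed.

Lemma qindex_dist k x y : qindex k x = qindex k y -> `|x - y| < 2 ^- k.
Proof.
move=> xy; have := mem_quant k x; have := mem_quant k y.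
rewrite /quant -!/(qindex _ _) xy /cell/= !intrD !mulrDl !mul1r.
move=> /andP[? ?] /andP[? ?]; rewrite ltr_norml; apply/andP; split; lra.
Qed.

Lemma selector_dist (f : nat -> set R -> R) k x : is_selector f ->
  `|f k (quant k x) - x| < 2 ^- k.
Proof. by move=> hf; apply: qindex_dist; apply/cellP; exact: hf. Qed.

End quantization_lemmas.

Lemma nat_minP (A : set nat) : (exists t, A t) ->
  A (nat_min A) /\ forall s, A s -> (nat_min A <= s)%N.
Proof.
move=> [t At]; rewrite /nat_min; case: xgetP => [m -> //|].
have eA : exists n, `[< A n >] by exists t; apply/asboolP.
move=> /(_ (ex_minn eA)); case: ex_minnP => m /asboolP Am min_m []; split=> //.
by move=> s As; apply: min_m; apply/asboolP.
Qed.

Lemma nat_min_eq (A : set nat) t :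
  A t -> (forall s, A s -> (t <= s)%N) -> nat_min A = t.
Proof.
move=> At tmin; have [|m1 m2] := @nat_minP A; first by exists t.
by apply/eqP; rewrite eqn_leq tmin// m2.
Qed.

Lemma nat_min_set0 (A : set nat) : (forall t, ~ A t) -> nat_min A = 0%N.
Proof. by move=> A0; rewrite /nat_min; case: xgetP => // m -> [/A0]. Qed.

Section recurrence_times.
Context {R : realType}.
Implicit Types (u v : nat -> R) (n l t : nat) (x : int -> R).

(** [lambda] reads only coordinates of nonnegative index, so the extension through the absolute
    value is immaterial. The one-sided form applies equally to futures, to pasts read backwards and
    to limiting sequences. *)
Definition lam u n := lambda (fun z : int => u `|z|%N) n.

Definition matches n u l : set nat :=
  [set t | (0 < t)%N /\
    forall i, (i <= l)%N -> qindex n (u (t + i)%N) = qindex n (u i)].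

(** Rules out the default value 0 of [nat_min], so that the first [n] increments are genuine first
    returns. *)
Definition good n u := forall k, (k < n)%N -> exists t, matches k.+1 u (lam u k) t.

Definition qagree n l u v :=
  forall i, (i <= l)%N -> qindex n (u i) = qindex n (v i).

Lemma lambdaE x n : lambda x n = lam (fun i => x i%:Z) n.
Proof. by rewrite /lam; elim: n => //= n ->. Qed.

Lemma lamS u n : lam u n.+1 = (lam u n + nat_min (matches n.+1 u (lam u n)))%N.
Proof.
rewrite /lam/= -/(lam u n); congr (_ + nat_min _)%N.
apply/seteqP; split=> t /= [t0 h]; split=> // i il.
- by apply/quantP; exact: h.
- by apply/quantP; exact: h.
Qed.

Lemma lam_step n u : good n.+1 u ->
  matches n.+1 u (lam u n) (lam u n.+1 - lam u n)%N /\
  forall s, matches n.+1 u (lam u n) s -> (lam u n.+1 - lam u n <= s)%N.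
Proof. by move=> g; rewrite lamS addKn; apply/nat_minP/g. Qed.

Lemma lam_le u n m : (n <= m)%N -> (lam u n <= lam u m)%N.
Proof.
move=> /subnK <-; elim: (m - n)%N => // k; rewrite addSn => h.
by apply: (leq_trans h); rewrite lamS leq_addr.
Qed.

Lemma goodW n m u : (n <= m)%N -> good m u -> good n u.
Proof. by move=> nm g k kn; apply: g; exact: leq_trans nm. Qed.

Lemma lam_ltS n u : good n.+1 u -> (lam u n < lam u n.+1)%N.
Proof. by move=> /lam_step [[+ _] _]; rewrite subn_gt0. Qed.

Lemma lam_ge n u : good n u -> (n <= lam u n)%N.
Proof.
elim: n => // n IH g; apply: leq_ltn_trans (lam_ltS g).
by apply: IH; exact: goodW g.
Qed.

Lemma qagree_le n n' l l' u v : (n <= n')%N -> (l <= l')%N ->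
  qagree n' l' u v -> qagree n l u v.
Proof. by move=> nn ll h i il; apply: qindex_le nn _; apply: h; exact: leq_trans ll. Qed.

Lemma qagree_sym n l u v : qagree n l u v -> qagree n l v u.
Proof. by move=> h i il; rewrite h. Qed.

(** The stopping time property: deciding the first [n] returns takes only the cells up to the end of
    the last one. It lets recurrence times pass from a sequence to any other with the same quantized
    block. *)
Lemma good_local n u v : good n u -> qagree n (lam u n) u v ->
  good n v /\ forall k, (k <= n)%N -> lam v k = lam u k.
Proof.
elim: n u v => [|n IH] u v gu uv.
  by split=> [k //|k]; rewrite leqn0 => /eqP ->.
have gun : good n u by apply: goodW gu.
have ll := lam_le u (leqnSn n).
have [|gvn lvn] := IH u v gun; first exact: qagree_le uv.
have [] := lam_step gu; set t := (_ - _)%N => -[t0 tu] tmin.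
have lE : lam u n.+1 = (lam u n + t)%N by rewrite subnKC.
(* For a shift [s <= t] both compared blocks end by index [lam u n.+1], within the range where [u]
   and [v] agree. Hence [v] has the return [t] and no earlier one. *)
have uvm s : (s <= t)%N -> matches n.+1 u (lam u n) s <-> matches n.+1 v (lam v n) s.
  move=> st; rewrite lvn// /matches/=; split=> -[s0 h]; split=> // i il.
    by rewrite -!uv ?h// lE; lia.
  by rewrite !uv ?h// lE; lia.
have tv : matches n.+1 v (lam v n) t by apply/uvm.
split.
  move=> k; rewrite ltnS leq_eqVlt => /orP[/eqP ->|/gvn//].
  by exists t.
move=> k; rewrite leq_eqVlt => /orP[/eqP ->|/lvn//].
rewrite lamS lvn// lE; congr (_ + _)%N; rewrite -lvn//.
apply: nat_min_eq => // s vs; rewrite leqNgt; apply/negP => st.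
have /tmin : matches n.+1 u (lam u n) s by apply/uvm => //; exact: ltnW.
by rewrite leqNgt st.
Qed.

(* Reversing a block carries first returns of its initial segment to first
   returns of its final segment, so the forward and the backward recurrence
   times of a block have the same length. *)
Lemma good_reverse n u v : good n u ->
  (forall i, (i <= lam u n)%N -> v i = u (lam u n - i)%N) ->
  good n v /\ lam v n = lam u n.
Proof.
elim: n u v => [|n IH] u v gu uv; first by split.
have gun : good n u by apply: goodW gu.
have ll := lam_le u (leqnSn n).
have [] := lam_step gu; set t := (_ - _)%N => -[t0 tu] tmin.
have lE : lam u n.+1 = (lam u n + t)%N by rewrite subnKC.
set l' := lam u n in ll tu tmin lE.
pose w i := u (l' - i)%N.
have [gw lw] := IH u w gun (fun i _ => erefl).
(* The block ends with a copy, at level [n.+1], of its first [l'.+1] entries, so its reversal [v]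
   begins like the reversal [w] of that initial segment. *)
have wv : qagree n.+1 l' w v.
  move=> i il; rewrite uv; last by rewrite lE; lia.
  rewrite lE /w -tu; last by lia.
  by congr (qindex _ (u _)); lia.
have [gv lv] : good n v /\ forall k, (k <= n)%N -> lam v k = lam w k.
  by apply: good_local => //; rewrite lw; exact: qagree_le wv.
have lvn : lam v n = l' by rewrite lv.
have tv : matches n.+1 v l' t.
  split=> // i il; rewrite uv; last by rewrite lE; lia.
  rewrite -wv// /w lE; congr (qindex _ (u _)); lia.
split.
  move=> k; rewrite ltnS leq_eqVlt => /orP[/eqP ->|/gv//].
  by rewrite lvn; exists t.
rewrite lamS lvn lE; congr (_ + _)%N.
apply: nat_min_eq => // s [s0 vs]; rewrite leqNgt; apply/negP => st.
(* A return of [v] after [s] steps, read backwards, is a return of [u] after [t - s] steps, against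
   the minimality of [t]. *)
suff /tmin : matches n.+1 u l' (t - s)%N by rewrite leqNgt; lia.
split=> [|j jl]; first by rewrite subn_gt0.
have := vs (l' - j)%N (leq_subr _ _); rewrite -(wv (l' - j)%N) ?leq_subr// /w subKn//.
rewrite uv; last by rewrite lE; lia.
by rewrite lE => <-; congr (qindex _ (u _)); lia.
Qed.

End recurrence_times.

(** * Measurability and path spaces *)

Section measurable_events.
Context d (T : measurableType d).

Lemma measurable_prop (Q : Prop) : measurable [set _ : T | Q].
Proof.
have [q|q] := pselect Q.
  by rewrite (_ : [set _ | _] = setT)//; apply/seteqP; split.
by rewrite (_ : [set _ | _] = set0)//; apply/seteqP; split.
Qed.

Lemma measurable_not (Q : T -> Prop) :
  measurable [set w | Q w] -> measurable [set w | ~ Q w].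
Proof. by move=> mQ; exact: measurableC. Qed.

Lemma measurable_conj (Q Q' : T -> Prop) : measurable [set w | Q w] ->
  measurable [set w | Q' w] -> measurable [set w | Q w /\ Q' w].
Proof. by move=> mQ mQ'; exact: measurableI. Qed.

Lemma measurable_disj (Q Q' : T -> Prop) : measurable [set w | Q w] ->
  measurable [set w | Q' w] -> measurable [set w | Q w \/ Q' w].
Proof. by move=> mQ mQ'; exact: measurableU. Qed.

Lemma measurable_imp (Q Q' : T -> Prop) : measurable [set w | Q w] ->
  measurable [set w | Q' w] -> measurable [set w | Q w -> Q' w].
Proof.
move=> mQ mQ'; rewrite (_ : [set _ | _] = [set w | ~ Q w \/ Q' w]).
  by apply: measurable_disj => //; exact: measurable_not.
apply/seteqP; split=> w /=; last by case.
by move=> QQ'; have [/QQ'|] := pselect (Q w); [right|left].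
Qed.

Lemma measurable_exists (C : countType) (Q : C -> T -> Prop) :
  (forall c, measurable [set w | Q c w]) -> measurable [set w | exists c, Q c w].
Proof.
move=> mQ; rewrite (_ : [set _ | _] =
    \bigcup_n [set w | if unpickle n is Some c then Q c w else False]); last first.
  apply/seteqP; split=> w /= => [[c Qc]|[n _ /=]].
    by exists (pickle c) => //=; rewrite pickleK.
  by case: unpickle => // c Qc; exists c.
apply: bigcupT_measurable => n; case: unpickle => // ; exact: measurable_prop.
Qed.

Lemma measurable_forall (C : countType) (Q : C -> T -> Prop) :
  (forall c, measurable [set w | Q c w]) -> measurable [set w | forall c, Q c w].
Proof.
move=> mQ; rewrite (_ : [set _ | _] = [set w | ~ exists c, ~ Q c w]).
  by apply: measurable_not; apply: measurable_exists => c; exact: measurable_not.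
apply/seteqP; split=> w /= h; first by case=> c.
by move=> c; apply: contrapT => nQ; apply: h; exists c.
Qed.

(** Measurability into a countable type, stated by fibres so that times, cell indices and lists of
    them need no sigma-algebra of their own. *)
Definition discrete_fun (C : countType) (f : T -> C) :=
  forall c, measurable [set w | f w = c].

Lemma discrete_fun_dep (C : countType) (f : T -> C) (Q : C -> T -> Prop) :
  discrete_fun f -> (forall c, measurable [set w | Q c w]) ->
  measurable [set w | Q (f w) w].
Proof.
move=> mf mQ; rewrite (_ : [set _ | _] = [set w | exists c, f w = c /\ Q c w]).
  by apply: measurable_exists => c; exact: measurable_conj.
by apply/seteqP; split=> w /= => [h|[c [<-]]//]; exists (f w).
Qed.

Lemma discrete_fun_pred (C : countType) (f : T -> C) (Q : C -> Prop) :
  discrete_fun f -> measurable [set w | Q (f w)].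
Proof.
move=> mf; apply: (@discrete_fun_dep _ f (fun c _ => Q c)) => // c.
exact: measurable_prop.
Qed.

Lemma discrete_fun_bind (C C' : countType) (f : T -> C) (g : C -> T -> C') :
  discrete_fun f -> (forall c, discrete_fun (g c)) ->
  discrete_fun (fun w => g (f w) w).
Proof.
by move=> mf mg c'; apply: (@discrete_fun_dep _ f (fun c w => g c w = c')) => // c; exact: mg.
Qed.

Lemma discrete_fun_comp (C C' : countType) (f : T -> C) (g : C -> C') :
  discrete_fun f -> discrete_fun (fun w => g (f w)).
Proof.
move=> mf.
exact: (discrete_fun_bind mf (fun c c' => measurable_prop (g c = c'))).
Qed.

Lemma discrete_fun_pair (C C' : countType) (f : T -> C) (g : T -> C') :
  discrete_fun f -> discrete_fun g -> discrete_fun (fun w => (f w, g w)).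
Proof.
move=> mf mg [c c'].
rewrite (_ : [set _ | _] = [set w | f w = c /\ g w = c']).
  exact: measurable_conj.
by apply/seteqP; split=> w /= [-> ->].
Qed.

Lemma discrete_fun_map (I : Type) (C : countType) (f : I -> T -> C) (s : seq I) :
  (forall i, discrete_fun (f i)) -> discrete_fun (fun w => [seq f i w | i <- s]).
Proof.
move=> mf; elim: s => [|i s IH] /=; first by move=> c; exact: measurable_prop.
exact: (discrete_fun_comp (fun p => p.1 :: p.2) (discrete_fun_pair (mf i) IH)).
Qed.

Lemma discrete_fun_nat_min (A : T -> set nat) :
  (forall t, measurable [set w | A w t]) -> discrete_fun (fun w => nat_min (A w)).
Proof.
move=> mA t; rewrite (_ : [set _ | _] =
  [set w | (A w t /\ forall s, A w s -> (t <= s)%N) \/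
           (t = 0%N /\ forall s, ~ A w s)]).
  apply: measurable_disj; apply: measurable_conj => //.
  - apply: measurable_forall => s; apply: measurable_imp => //.
    exact: measurable_prop.
  - exact: measurable_prop.
  - by apply: measurable_forall => s; exact: measurable_not.
apply/seteqP; split=> w /=.
  move=> <-; have [/nat_minP|/forallNP h] := pselect (exists t, A w t); first by left.
  by right; rewrite nat_min_set0.
by case=> [[At tmin]|[-> /nat_min_set0 //]]; exact: nat_min_eq.
Qed.

Context {R : realType}.

Lemma discrete_fun_qindex k (U : T -> R) : measurable_fun setT U ->
  discrete_fun (fun w => qindex k (U w)).
Proof.
move=> mU i; rewrite (_ : [set _ | _] = setT `&` U @^-1` (cell k i)).
  apply: mU => //; rewrite /cell.
  rewrite (_ : [set _ | _] = [set` `[i%:~R * 2 ^- k, (i + 1)%:~R * 2 ^- k[ ]).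
    exact: measurable_itv.
  by apply/seteqP; split=> x /=; rewrite in_itv.
by rewrite setTI; apply/seteqP; split=> w /=; rewrite cellP.
Qed.

Lemma measurable_discrete_bind d' (S : measurableType d') (C : countType)
    (f : T -> C) (g : C -> T -> S) : discrete_fun f ->
  (forall c, measurable_fun setT (g c)) ->
  measurable_fun setT (fun w => g (f w) w).
Proof.
move=> mf mg _ B mB; rewrite setTI.
apply: (@discrete_fun_dep _ f (fun c w => B (g c w))) => // c.
by rewrite -[X in measurable X]setTI; exact: mg.
Qed.

Lemma measurable_discrete_comp d' (S : measurableType d') (C : countType)
    (f : T -> C) (g : C -> S) : discrete_fun f ->
  measurable_fun setT (fun w => g (f w)).
Proof. by move=> mf; apply: (@measurable_discrete_bind _ _ _ f (fun c _ => g c)). Qed.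

Variable U : nat -> T -> R.
Hypothesis mU : forall i, measurable_fun setT (U i).

Lemma measurable_matches n l t :
  measurable [set w | matches n (fun i => U i w) l t].
Proof.
apply: measurable_conj; first exact: measurable_prop.
apply: measurable_forall => i; apply: measurable_imp; first exact: measurable_prop.
apply: (@discrete_fun_dep _ _ (fun c w => c = qindex n (U i w))).
  exact: discrete_fun_qindex.
move=> c; rewrite (_ : [set _ | _] = [set w | qindex n (U i w) = c]).
  exact: discrete_fun_qindex.
by apply/seteqP; split=> w /=.
Qed.

Lemma discrete_fun_lam n : discrete_fun (fun w => lam (fun i => U i w) n).
Proof.
elim: n => [|n IH]; first by move=> c; exact: (measurable_prop (0%N = c)).
under [X in discrete_fun X]funext => w do rewrite lamS.
apply: (@discrete_fun_bind _ _ _ (fun l w =>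
  (l + nat_min (matches n.+1 (fun i => U i w) l))%N)) => // l.
apply: discrete_fun_comp; apply: discrete_fun_nat_min => t.
exact: measurable_matches.
Qed.

Lemma measurable_good n : measurable [set w | good n (fun i => U i w)].
Proof.
apply: measurable_forall => k; apply: measurable_imp; first exact: measurable_prop.
apply: measurable_exists => t.
apply: (@discrete_fun_dep _ _ (fun l w => matches k.+1 (fun i => U i w) l t)).
  exact: discrete_fun_lam.
by move=> l; exact: measurable_matches.
Qed.

End measurable_events.

(** * Codes of one-sided sequences *)

Section code.
Context {R : realType}.
Implicit Types u v : nat -> R.

(* What is known after n steps: the recurrence times so far and the quantized
   block they delimit. Taking the block at least n + 1 long only matters for
   sequences without genuine recurrence times. *)
Definition past_code n u : seq nat * seq int :=
  (mkseq (lam u) n.+1, mkseq (fun i => qindex n (u i)) (maxn (lam u n) n).+1).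

Lemma codeP n u v : past_code n u = past_code n v <->
  (forall k, (k <= n)%N -> lam u k = lam v k) /\ qagree n (maxn (lam u n) n) u v.
Proof.
rewrite /past_code; split=> [h|[h1 h2]].
  have h1 : mkseq (lam u) n.+1 = mkseq (lam v) n.+1 := congr1 fst h.
  have h2 : mkseq (fun i => qindex n (u i)) (maxn (lam u n) n).+1 =
    mkseq (fun i => qindex n (v i)) (maxn (lam v n) n).+1 := congr1 snd h.
  have hl k : (k <= n)%N -> lam u k = lam v k.
    move=> kn; have : nth 0%N (mkseq (lam u) n.+1) k = nth 0%N (mkseq (lam v) n.+1) k.
      by rewrite h1.
    by rewrite !nth_mkseq.
  split=> // i il; rewrite -hl// in h2.
  have : nth 0 (mkseq (fun i => qindex n (u i)) (maxn (lam u n) n).+1) i =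
         nth 0 (mkseq (fun i => qindex n (v i)) (maxn (lam u n) n).+1) i by rewrite h2.
  by rewrite !nth_mkseq.
congr pair.
  by apply/eq_in_map => k; rewrite mem_iota add0n ltnS => /andP[_]; exact: h1.
rewrite -h1//; apply/eq_in_map => k; rewrite mem_iota add0n ltnS => /andP[_].
exact: h2.
Qed.

Lemma code_refine n m u v : (n <= m)%N -> past_code m u = past_code m v -> past_code n u = past_code n v.
Proof.
move=> nm /codeP[h1 h2]; apply/codeP; split.
  by move=> k kn; apply: h1; exact: leq_trans nm.
apply: qagree_le h2 => //; rewrite geq_max !leq_max nm orbT andbT.
by rewrite lam_le.
Qed.

Lemma discrete_fun_past_code d (T : measurableType d) (U : nat -> T -> R) n :
  (forall i, measurable_fun setT (U i)) ->
  discrete_fun (fun w => past_code n (fun i => U i w)).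
Proof.
move=> mU; apply: discrete_fun_pair.
  by apply: discrete_fun_map => i; exact: discrete_fun_lam.
apply: (@discrete_fun_bind _ _ _ _ (fun w => lam (fun i => U i w) n)
  (fun l w => mkseq (fun i => qindex n (U i w)) (maxn l n).+1)).
  exact: discrete_fun_lam.
by move=> l; apply: discrete_fun_map => i; exact: discrete_fun_qindex.
Qed.

End code.

Section path_space.
Context {R : realType}.

Definition cylinders (I : Type) : set (set (I -> R)) :=
  [set A | exists (i : I) (B : set R), measurable B /\ A = [set x | B (x i)]].

(** By conversion the measurable sets of this type are those of [product_sigma], so stationarity and
    ergodicity apply to them directly. *)
Definition paths (I : Type) := g_sigma_algebraType (@cylinders I).

Lemma measurable_coord I (i : I) : measurable_fun setT (fun x : paths I => x i).
Proof.
move=> _ B mB; rewrite setTI; apply: sub_gen_smallest.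
by exists i, B.
Qed.

Lemma measurable_pathsP d (T : measurableType d) D I (F : T -> paths I) :
  measurable D ->
  (forall i, measurable_fun D (fun w => F w i)) -> measurable_fun D F.
Proof.
move=> mD mF; apply: (@measurability _ _ _ (paths I) D F (@cylinders I)) => //.
move=> _ [_ [i [B [mB ->]]] <-].
exact: (mF i mD B mB).
Qed.

Lemma measurable_fun_coord d (T : measurableType d) D I (F : T -> paths I) i :
  measurable_fun D F -> measurable_fun D (fun w => F w i).
Proof. by move=> mF; exact: measurableT_comp (measurable_coord i) mF. Qed.

End path_space.

(** * Square integrable functions, martingales and the strong law *)

Section real_sequences.
Context {R : realType}.

Lemma cauchy_cvgn (u : nat -> R) :
  (forall e : R, 0 < e -> exists m, forall k, (m <= k)%N -> `|u k - u m| <= e) ->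
  cvgn u.
Proof.
move=> h; apply/cauchy_cvgP/cauchy_exP => e e0.
have [m hm] := h (e / 2) (divr_gt0 e0 (ltr0n _ 2)).
exists (u m), m => // k /= mk; rewrite /ball/= distrC.
by rewrite (le_lt_trans (hm k mk))// ltr_pdivrMr// ltr_pMr// ltr1n.
Qed.

(** Kronecker's lemma: by Abel summation the average of the [x j] is a partial sum of the weighted
    series minus the Cesaro mean of its partial sums, and both have the same limit. *)
Lemma kronecker_cvg (x : nat -> R) :
  cvgn (fun n => \sum_(0 <= j < n) x j / j.+1%:R) ->
  (fun n => n%:R^-1 * \sum_(0 <= j < n) x j) @ \oo --> (0 : R).
Proof.
set s := fun n => \sum_(0 <= j < n) _ => sl; have [l {}sl] := (cvg_ex _).1 sl.
have sumE n : \sum_(0 <= j < n) x j = n%:R * s n - \sum_(0 <= j < n) s j.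
  elim: n => [|n IH]; first by rewrite !big_geq// mul0r subr0.
  have sS : s n.+1 = s n + x n / n.+1%:R by rewrite /s big_nat_recr.
  rewrite !big_nat_recr//= IH sS.
  rewrite mulrDr [n.+1%:R * (x n / _)]mulrC divfK// -natr1; ring.
rewrite -(cvg_shiftS _).
have -> : (fun n => n.+1%:R^-1 * \sum_(0 <= j < n.+1) x j) =
  (fun n => s n.+1 - arithmetic_mean s n).
  by apply/funext => n; rewrite sumE mulrBr mulKf ?pnatr_eq0//.
have h1 : (fun n => s n.+1) @ \oo --> l by rewrite (cvg_shiftS s).
have h := cvgB h1 (cesaro sl); rewrite subrr in h.
exact: h.
Qed.

End real_sequences.

Section square_integrable.
Context d (T : measurableType d) (R : realType) (P : probability T R).
Implicit Types (f g h : T -> R) (A : set T).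

Lemma dominated_integrable f g : measurable_fun setT f ->
  (forall x, `|f x| <= g x) -> P.-integrable setT (EFin \o g) ->
  P.-integrable setT (EFin \o f).
Proof.
move=> mf fg; apply: le_integrable => //; first exact/measurable_EFinP.
by move=> x _ /=; rewrite lee_fin (le_trans (fg x))// ler_norm.
Qed.

Lemma EFin_integrableD f g : P.-integrable setT (EFin \o f) ->
  P.-integrable setT (EFin \o g) ->
  P.-integrable setT (EFin \o (fun x => f x + g x)).
Proof. by move=> fi gi; have := integrableD measurableT fi gi; exact: eq_integrable. Qed.

Lemma EFin_integrableZ a f : P.-integrable setT (EFin \o f) ->
  P.-integrable setT (EFin \o (fun x => a * f x)).
Proof. by move=> fi; have := integrableZl measurableT a fi; exact: eq_integrable. Qed.

Lemma EFin_integrableB f g : P.-integrable setT (EFin \o f) ->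
  P.-integrable setT (EFin \o g) ->
  P.-integrable setT (EFin \o (fun x => f x - g x)).
Proof. by move=> fi gi; have := integrableB measurableT fi gi; exact: eq_integrable. Qed.

Lemma EFin_integrableS A f : measurable A -> P.-integrable setT (EFin \o f) ->
  P.-integrable A (EFin \o f).
Proof. by move=> mA; exact: integrableS. Qed.

Lemma EFin_Rintegral A f : measurable A -> P.-integrable setT (EFin \o f) ->
  (\int[P]_(x in A) (f x)%:E)%E = (\int[P]_(x in A) f x)%:E.
Proof.
move=> mA fi; rewrite /Rintegral fineK//; apply: integrable_fin_num => //.
exact: EFin_integrableS.
Qed.

Lemma Rintegral_probability_cst (c : R) : \int[P]_x c = c.
Proof. by rewrite /Rintegral integral_cst//= probability_setT mule1. Qed.

Definition square_integrable f :=
  measurable_fun setT f /\ P.-integrable setT (EFin \o (fun x => f x ^+ 2)).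

Lemma square_integrable_mul f g : square_integrable f -> square_integrable g ->
  P.-integrable setT (EFin \o (fun x => f x * g x)).
Proof.
move=> [mf f2] [mg g2].
apply: (@dominated_integrable _ (fun x => f x ^+ 2 + g x ^+ 2)).
- exact: measurable_funM.
- move=> x; rewrite ler_norml; apply/andP; split.
    by have := sqr_ge0 (f x + g x); have := sqr_ge0 (f x); have := sqr_ge0 (g x);
       nra.
  by have := sqr_ge0 (f x - g x); have := sqr_ge0 (f x); have := sqr_ge0 (g x);
     nra.
- exact: EFin_integrableD.
Qed.

Lemma square_integrable_cst c : square_integrable (cst c).
Proof.
split=> //; have := @finite_measure_integrable_cst _ _ _ P setT (c ^+ 2) measurableT.
exact: eq_integrable.
Qed.

Lemma square_integrable_integrable f : square_integrable f ->
  P.-integrable setT (EFin \o f).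
Proof.
move=> f2; have := square_integrable_mul f2 (square_integrable_cst 1).
by apply: eq_integrable => // x _ /=; rewrite mulr1.
Qed.

Lemma square_integrableD f g : square_integrable f -> square_integrable g ->
  square_integrable (fun x => f x + g x).
Proof.
move=> f2 g2; split; first exact: (measurable_funD f2.1 g2.1).
apply: (@dominated_integrable _ (fun x => 2 * f x ^+ 2 + 2 * g x ^+ 2)).
- by apply: measurable_funX; exact: (measurable_funD f2.1 g2.1).
- move=> x; rewrite ger0_norm ?sqr_ge0//.
  by have := sqr_ge0 (f x - g x); nra.
- by apply: EFin_integrableD; apply: EFin_integrableZ; [case: f2|case: g2].
Qed.

Lemma square_integrableZ a f : square_integrable f ->
  square_integrable (fun x => a * f x).
Proof.
move=> [mf f2]; split; first exact: measurable_funM.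
under [X in _ \o X]eq_fun do rewrite exprMn.
exact: EFin_integrableZ.
Qed.

Lemma square_integrableB f g : square_integrable f -> square_integrable g ->
  square_integrable (fun x => f x - g x).
Proof.
move=> f2 g2; have := square_integrableD f2 (square_integrableZ (-1) g2).
by under eq_fun do rewrite mulN1r.
Qed.

Lemma indic01 A (x : T) : 0 <= (\1_A x : R) <= 1.
Proof. by rewrite indicE; case: (x \in A); rewrite /= ?ler01 lexx. Qed.

Lemma square_integrable_indic A f : measurable A -> square_integrable f ->
  square_integrable (fun x => \1_A x * f x).
Proof.
move=> mA [mf f2].
have m1 : measurable_fun setT (fun x => \1_A x * f x).
  by apply: measurable_funM => //; exact: measurable_indic.
split=> //; apply: dominated_integrable f2; first exact: measurable_funX.
by move=> x; rewrite ger0_norm ?sqr_ge0// exprMn ler_piMl ?sqr_ge0//.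
Qed.

Lemma Rintegral_indic A f :
  \int[P]_(x in A) f x = \int[P]_x (\1_A x * f x).
Proof.
rewrite Rintegral_mkcond; apply: eq_Rintegral => x _.
by rewrite patchE indicE; case: (x \in A); rewrite ?mul1r ?mul0r.
Qed.

Lemma ge0_Rintegral_le f g : P.-integrable setT (EFin \o f) ->
  P.-integrable setT (EFin \o g) -> (forall x, f x <= g x) ->
  \int[P]_x f x <= \int[P]_x g x.
Proof. by move=> fi gi fg; apply: le_Rintegral. Qed.

Lemma Rintegral_fibers (pi : T -> nat) h : discrete_fun pi ->
  P.-integrable setT (EFin \o h) ->
  (forall c, \int[P]_(x in [set x | pi x = c]) h x = 0) -> \int[P]_x h x = 0.
Proof.
move=> mpi hi h0; pose F c := [set x | pi x = c].
have UF : \bigcup_c F c = setT by apply/seteqP; split=> // x _; exists (pi x).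
rewrite /Rintegral -UF integral_bigcup ?UF//.
- rewrite eseries0// => c _ _; have := h0 c; rewrite /Rintegral => h0c.
  rewrite -[LHS]fineK ?h0c//; apply: integrable_fin_num; first exact: mpi.
  exact: integrableS measurableT (mpi c) (@subsetT _ _) hi.
- by apply/trivIsetP => i j _ _ ij; apply/seteqP; split=> // x [/= xi xj];
    by rewrite -xi -xj eqxx in ij.
Qed.

(** On each atom [h] is a constant factor in front of an integral that vanishes. Every orthogonality
    relation below is an instance. *)
Lemma Rintegral_orth (pi : T -> nat) h f : discrete_fun pi ->
  (forall x y, pi x = pi y -> h x = h y) ->
  P.-integrable setT (EFin \o f) ->
  P.-integrable setT (EFin \o (fun x => h x * f x)) ->
  (forall c, \int[P]_(x in [set x | pi x = c]) f x = 0) ->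
  \int[P]_x (h x * f x) = 0.
Proof.
move=> mpi hc fi hfi f0; apply: (Rintegral_fibers mpi) => // c.
have [[x0 xc]|/forallNP nx] := pselect (exists x, pi x = c).
  rewrite (@eq_Rintegral _ _ _ _ _ (fun x => h x0 * f x)).
    have fci := integrableS measurableT (mpi c) (@subsetT _ _) fi.
    by rewrite (RintegralZl _ (mpi c) fci) f0 mulr0.
  by move=> x; rewrite inE/= => xE; rewrite (hc x x0)// xE.
rewrite (_ : [set _ | _] = set0) ?Rintegral_set0//.
by apply/seteqP; split=> // x /= /nx.
Qed.

Lemma measurable_fiberwise (pi : T -> nat) h : discrete_fun pi ->
  (forall x y, pi x = pi y -> h x = h y) -> measurable_fun setT h.
Proof.
move=> mpi hc.
pose g n := h (xget point [set x | pi x = n]).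
rewrite (_ : h = g \o pi).
  exact: (measurable_discrete_comp g mpi).
apply/funext => x /=; apply: hc; apply/esym.
by apply: (@xgetPex _ point [set y | pi y = pi x]); exists x.
Qed.

End square_integrable.

Lemma measure_bigcup_le d (T : measurableType d) (R : realType)
    (mu : {measure set T -> \bar R}) (F : nat -> set T) (b : \bar R) :
  (forall n, measurable (F n)) -> {homo F : n m / (n <= m)%N >-> n `<=` m} ->
  (forall n, (mu (F n) <= b)%E) -> (mu (\bigcup_n F n) <= b)%E.
Proof.
move=> mF ndF Fb.
have cF : mu \o F @ \oo --> mu (\bigcup_n F n).
  apply: nondecreasing_cvg_mu => //; first exact: bigcupT_measurable.
  by move=> n m nm; apply/subsetPset; exact: ndF.
rewrite -(cvg_lim _ cF)//; apply: lime_le; first by apply/cvg_ex; eexists; exact: cF.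
exact: nearW.
Qed.

Lemma nonneg_small_eq0 (R : realType) (x : \bar R) :
  (0 <= x)%E -> (forall e : R, 0 < e -> (x <= e%:E)%E) -> x = 0%E.
Proof.
move=> x0 xe; apply/eqP; rewrite eq_le x0 andbT.
by apply/lee_addgt0Pr => e e0; rewrite add0e; exact: xe.
Qed.

(** * L2 martingales along countable partitions *)

Section martingale.
Context d (T : measurableType d) (R : realType) (P : probability T R).
Variables (pi : nat -> T -> nat) (M : nat -> T -> R) (K : R).
Hypothesis mpi : forall n, discrete_fun (pi n).
Hypothesis pi_refine : forall n x y, pi n.+1 x = pi n.+1 y -> pi n x = pi n y.
Hypothesis M_fiber : forall n x y, pi n x = pi n y -> M n x = M n y.
Hypothesis M2 : forall n, square_integrable P (M n).
Hypothesis MK : forall n, \int[P]_x (M n x ^+ 2) <= K.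
Hypothesis M_mart : forall n c, \int[P]_(x in [set x | pi n x = c]) M n.+1 x =
  \int[P]_(x in [set x | pi n x = c]) M n x.

Lemma refine_le n m x y : (n <= m)%N -> pi m x = pi m y -> pi n x = pi n y.
Proof.
move=> /subnK <-; elim: (m - n)%N => // k IH; rewrite addSn => h.
exact/IH/pi_refine.
Qed.

(** Telescoping: each increment between consecutive levels has mean 0 on the atoms of the lower
    level, where [h] is constant. *)
Lemma martingale_orth n m h : (n <= m)%N ->
  (forall x y, pi n x = pi n y -> h x = h y) -> square_integrable P h ->
  \int[P]_x (h x * (M m x - M n x)) = 0.
Proof.
move=> nm + h2; move: nm => /subnK <-; elim: (m - n)%N => [|k IH] hc.
  by under eq_Rintegral do rewrite add0n subrr mulr0; rewrite Rintegral_cst// mul0r.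
have i1 a b := square_integrable_mul h2 (square_integrableB (M2 a) (M2 b)).
under eq_Rintegral => x _.
  rewrite (_ : _ * _ = h x * (M (k + n).+1 x - M (k + n)%N x) +
    h x * (M (k + n)%N x - M n x)); last by rewrite -mulrDr addrA subrK addSn.
  over.
rewrite RintegralD// IH// addr0.
apply: (Rintegral_orth (mpi (k + n))) => //.
- by move=> x y xy; apply: hc; apply: refine_le xy; exact: leq_addl.
- by apply: square_integrable_integrable; exact: square_integrableB.
move=> c; have iM a := integrableS measurableT (mpi (k + n) c) (@subsetT _ _)
  (square_integrable_integrable (M2 a)).
by rewrite (RintegralB (mpi (k + n) c) (iM _) (iM _)) M_mart subrr.
Qed.

Lemma martingale_increment n m : (n <= m)%N ->
  \int[P]_x ((M m x - M n x) ^+ 2) =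
  \int[P]_x (M m x ^+ 2) - \int[P]_x (M n x ^+ 2).
Proof.
move=> nm; have := martingale_orth nm (@M_fiber n) (M2 n).
move=> /(congr1 ( *%R 2)); rewrite mulr0 => h.
rewrite -[RHS]subr0 -h -RintegralZl//; last first.
  exact: (square_integrable_mul (M2 n) (square_integrableB (M2 m) (M2 n))).
rewrite -RintegralB//; [|exact: (M2 m).2|exact: (M2 n).2].
rewrite -RintegralB//; [|exact: (EFin_integrableB (M2 m).2 (M2 n).2)|].
  by apply: eq_Rintegral => x _; ring.
apply: EFin_integrableZ.
exact: (square_integrable_mul (M2 n) (square_integrableB (M2 m) (M2 n))).
Qed.

Let L := limn (fun n => \int[P]_x (M n x ^+ 2)).

Let nd2 : nondecreasing_seq (fun n => \int[P]_x (M n x ^+ 2)).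
Proof.
move=> n m nm; rewrite -subr_ge0 -martingale_increment//.
by apply: Rintegral_ge0 => x _; exact: sqr_ge0.
Qed.

Let cvg2 : cvgn (fun n => \int[P]_x (M n x ^+ 2)).
Proof.
by apply: nondecreasing_is_cvgn nd2 _; exists K => _ [n _ <-].
Qed.

Lemma martingale_L2_tail n m : (n <= m)%N ->
  \int[P]_x ((M m x - M n x) ^+ 2) <= L - \int[P]_x (M n x ^+ 2).
Proof.
by move=> nm; rewrite martingale_increment// lerB// (nondecreasing_cvgn_le nd2).
Qed.

Lemma martingale_L2_small (e : R) : 0 < e ->
  exists n, L - \int[P]_x (M n x ^+ 2) < e.
Proof.
move=> e0; have /cvgrPdist_lt/(_ _ e0)[N _ /(_ N (leqnn N))/= h] := cvg2.
by exists N; rewrite (le_lt_trans _ h)// ler_norm.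
Qed.

Definition deviates n (a : R) N : set T :=
  [set x | exists2 k, (n <= k <= n + N)%N & a < `|M k x - M n x|].

Lemma measurable_deviates n a N : measurable (deviates n a N).
Proof.
rewrite (_ : deviates _ _ _ =
  [set x | exists k, (n <= k <= n + N)%N /\ a < `|M k x - M n x|]); last first.
  by apply/seteqP; split=> x [k]; [move=> ? ?|case=> ? ?]; exists k.
apply: measurable_exists => k; apply: measurable_conj; first exact: measurable_prop.
rewrite -[X in measurable X]setTI.
apply: measurable_fun_ltr => //; apply: measurableT_comp => //.
by apply: measurable_funB; [exact: (M2 k).1|exact: (M2 n).1].
Qed.

(** Doob's maximal inequality, by induction on [N] in place of a stopping time: points that deviated
    earlier keep their contribution because increments are orthogonal, and points deviating for the
    first time contribute at least [a ^+ 2] each. *)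
Lemma martingale_maximal n (a : R) N : 0 < a ->
  a ^+ 2 * fine (P (deviates n a N)) <=
  \int[P]_x (\1_(deviates n a N) x * (M (n + N)%N x - M n x) ^+ 2).
Proof.
move=> a0; have i2 m A : measurable A ->
    square_integrable P (fun x => \1_A x * (M m x - M n x)).
  by move=> mA; apply: square_integrable_indic => //; exact: square_integrableB.
have ii m A : measurable A ->
    P.-integrable setT (EFin \o (fun x => \1_A x * (M m x - M n x) ^+ 2)).
  move=> mA; have := square_integrable_mul (i2 m A mA) (square_integrableB (M2 m) (M2 n)).
  by under eq_fun do rewrite -mulrA -expr2.
elim: N => [|N IH].
  rewrite (_ : deviates n a 0 = set0) ?measure0 ?mulr0.
    by apply: Rintegral_ge0 => x _; rewrite addn0 subrr expr0n mulr0.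
  apply/seteqP; split=> // x [k]; rewrite addn0 -eqn_leq => /eqP <-.
  by rewrite subrr normr0 ltNge (ltW a0).
set B := deviates n a N in IH *; set B' := deviates n a N.+1.
have mB : measurable B := measurable_deviates n a N.
have mB' : measurable B' := measurable_deviates n a N.+1.
have BB' : B `<=` B'.
  move=> x [k /andP[nk kN] h]; exists k => //; rewrite nk/=.
  by rewrite (leq_trans kN)// leq_add2l.
have mD : measurable (B' `\` B) by exact: measurableD.
have -> : fine (P B') = fine (P B) + fine (P (B' `\` B)).
  rewrite -fineD ?fin_num_measure// -measureU//; first by rewrite setDUK.
  by apply/seteqP; split=> // x [? []].
rewrite mulrDr.
pose m := (n + N)%N.
(* On [B] the square is expanded around [M m]. The factor [\1_B x * (M m x - M n x)] of the cross
   term is constant on the atoms of [pi m], so this term integrates to 0. *)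
have -> : \int[P]_x (\1_B' x * (M (n + N.+1)%N x - M n x) ^+ 2) =
   \int[P]_x (\1_B x * (M m x - M n x) ^+ 2) +
   (\int[P]_x (2 * ((\1_B x * (M m x - M n x)) * (M m.+1 x - M m x))) +
    (\int[P]_x (\1_B x * (M m.+1 x - M m x) ^+ 2) +
     \int[P]_x (\1_(B' `\` B) x * (M m.+1 x - M n x) ^+ 2))).
  have j1 : P.-integrable setT (EFin \o
      (fun x => 2 * (\1_B x * (M m x - M n x) * (M m.+1 x - M m x)))).
    apply: EFin_integrableZ; apply: square_integrable_mul; first exact: i2.
    exact: square_integrableB.
  have j2 : P.-integrable setT (EFin \o
      (fun x => \1_B x * (M m.+1 x - M m x) ^+ 2)).
    have := square_integrable_mul (square_integrable_indic mB
      (square_integrableB (M2 m.+1) (M2 m))) (square_integrableB (M2 m.+1) (M2 m)).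
    by under eq_fun do rewrite -mulrA -expr2.
  rewrite -RintegralD//; last exact: ii.
  rewrite -RintegralD//; [|exact: (EFin_integrableD j2 (ii _ _ mD))].
  rewrite -RintegralD//; [|exact: ii|]; last first.
    exact: (EFin_integrableD j1 (EFin_integrableD j2 (ii _ _ mD))).
  apply: eq_Rintegral => x _; rewrite addnS -/m.
  have -> : \1_B' x = \1_B x + \1_(B' `\` B) x :> R.
    rewrite !indicE in_setD; case: (boolP (x \in B)) => xB /=.
      by rewrite (mem_set (BB' _ (set_mem xB))) addr0.
    by rewrite add0r andbT.
  ring.
apply: lerD => //.
rewrite RintegralZl//; last first.
  apply: square_integrable_mul; first exact: i2.
  exact: square_integrableB.
rewrite martingale_orth//; last first.
- exact: i2.
- move=> x y xy; rewrite (M_fiber xy) (M_fiber (refine_le (leq_addr N n) xy)).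
  congr (_ * _); rewrite !indicE; congr (nat_of_bool _)%:R.
  apply/idP/idP; rewrite !inE => -[k /andP[nk kN] h]; exists k; rewrite ?nk//.
    by rewrite -(M_fiber (refine_le kN xy)) -(M_fiber (refine_le (leq_addr N n) xy)).
  by rewrite (M_fiber (refine_le kN xy)) (M_fiber (refine_le (leq_addr N n) xy)).
rewrite mulr0 add0r -[leLHS]add0r; apply: lerD.
  by apply: Rintegral_ge0 => x _; rewrite mulr_ge0 ?sqr_ge0//; case/andP: (indic01 R B x).
rewrite [leLHS](_ : _ = \int[P]_(x in B' `\` B) (a ^+ 2)); last first.
  by rewrite Rintegral_cst.
rewrite Rintegral_indic.
have mc : P.-integrable setT (EFin \o (fun x => \1_(B' `\` B) x * a ^+ 2)).
  have := square_integrable_mul (square_integrable_indic mD (square_integrable_cst P 1))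
     (square_integrable_cst P (a ^+ 2)).
  by under eq_fun do rewrite /= mulr1.
apply: ge0_Rintegral_le => // [|x]; first exact: ii.
rewrite indicE; case: (boolP (x \in _)) => /=; rewrite ?mul0r// !mul1r.
move=> /set_mem [[k /andP[nk]]]; rewrite addnS leq_eqVlt => /orP[/eqP ->|kN] h nB.
  by rewrite -[leRHS]real_normK ?num_real// ler_sqr ?nnegrE// ltW.
by exfalso; apply: nB; exists k => //; rewrite nk.
Qed.

Lemma martingale_deviation n (a : R) : 0 < a ->
  (P [set x | exists2 k, (n <= k)%N & (a < `|M k x - M n x|)%R] <=
   ((L - \int[P]_x (M n x ^+ 2)) / a ^+ 2)%R%:E)%E.
Proof.
move=> a0; rewrite (_ : [set _ | _] = \bigcup_N deviates n a N); last first.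
  apply/seteqP; split=> x /= [k].
    by move=> nk h; exists (k - n)%N => //; exists k => //; rewrite subnKC// nk leqnn.
  by move=> _ [j /andP[nj _] h]; exists j.
apply: measure_bigcup_le => [N|N N' NN x [k /andP[nk kN] h]|N].
- exact: measurable_deviates.
- by exists k => //; rewrite nk/= (leq_trans kN)// leq_add2l.
rewrite -[leLHS]fineK ?fin_num_measure//; last exact: measurable_deviates.
rewrite lee_fin ler_pdivlMr ?exprn_gt0// mulrC.
apply: le_trans (martingale_maximal n N a0) _.
apply: le_trans (martingale_L2_tail (leq_addr N n)).
have B2 := square_integrableB (M2 (n + N)%N) (M2 n).
apply: ge0_Rintegral_le => [||x].
- have := square_integrable_mul (square_integrable_indic (measurable_deviates n a N) B2) B2.
  by under eq_fun do rewrite -mulrA -expr2.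
- exact: B2.2.
- by rewrite ler_piMl ?sqr_ge0//; case/andP: (indic01 R (deviates n a N) x).
Qed.

(** A divergent path deviates from [M n] by more than some 1/(r+1) after every [n]. For fixed [r]
    the maximal inequality bounds this probability by the L2 tail after [n], which becomes
    arbitrarily small. *)
Lemma martingale_cvg : {ae P, forall x, cvgn (M ^~ x)}.
Proof.
pose C n r := [set x | exists2 k, (n <= k)%N & r.+1%:R^-1 < `|M k x - M n x|].
have mC n r : measurable (C n r).
  rewrite (_ : C _ _ = \bigcup_N deviates n r.+1%:R^-1 N).
    by apply: bigcupT_measurable => N; exact: measurable_deviates.
  apply/seteqP; split=> x /= [k].
    by move=> nk h; exists (k - n)%N => //; exists k => //; rewrite subnKC// nk leqnn.
  by move=> _ [j /andP[nj _] h]; exists j.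
have null r : P (\bigcap_n C n r) = 0%E.
  apply: nonneg_small_eq0 => // e e0.
  have a0 : 0 < (r.+1%:R^-1 : R) by rewrite invr_gt0.
  have e1 : 0 < e * r.+1%:R^-1 ^+ 2 by rewrite mulr_gt0// exprn_gt0.
  have [n hn] := martingale_L2_small e1.
  have mI : measurable (\bigcap_n C n r) by exact: bigcapT_measurable.
  apply: (@le_trans _ _ (P (C n r))).
    by apply: le_measure; rewrite ?inE//; exact: bigcap_inf.
  apply: (le_trans (martingale_deviation n a0)).
  by rewrite lee_fin ler_pdivrMr ?exprn_gt0// ltW.
suff h : P.-negligible (~` [set x | cvgn (M ^~ x)]) by exact: h.
apply: (@negligibleS _ _ _ _ (\bigcup_r \bigcap_n C n r)); last first.
  apply: negligible_bigcup => r; apply/negligibleP; last exact: null.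
  exact: bigcapT_measurable.
move=> x /= ncv; apply: contrapT => nU; apply: ncv; apply: cauchy_cvgn => e e0.
pose r := Num.truncn e^-1.
have re : r.+1%:R^-1 <= e.
  rewrite -[leRHS]invrK lef_pV2 ?posrE ?invr_gt0//.
  by rewrite ltW// truncnS_gt.
have : ~ (\bigcap_n C n r) x by move=> h; apply: nU; exists r.
move=> /existsNP[n /not_implyP[_ nC]]; exists n => k nk.
by rewrite (le_trans _ re)// leNgt; apply/negP => h; apply: nC; exists k.
Qed.

End martingale.

(** * Conditional expectation given a countable partition *)

Section partition_cond_exp.
Context d (T : measurableType d) (R : realType) (P : probability T R).
Variables (pi : T -> nat) (Z : T -> R).
Hypothesis mpi : discrete_fun pi.
Hypothesis iZ : P.-integrable setT (EFin \o Z).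

(* 0 on the atoms of probability 0, since x / 0 = 0. *)
Definition partition_exp (x : T) : R :=
  (\int[P]_(y in [set y | pi y = pi x]) Z y) / fine (P [set y | pi y = pi x]).

Lemma partition_exp_fiber x y : pi x = pi y -> partition_exp x = partition_exp y.
Proof. by rewrite /partition_exp => ->. Qed.

Lemma measurable_partition_exp : measurable_fun setT partition_exp.
Proof. exact: measurable_fiberwise mpi partition_exp_fiber. Qed.

Lemma partition_exp_mul x : partition_exp x * fine (P [set y | pi y = pi x]) =
  \int[P]_(y in [set y | pi y = pi x]) Z y.
Proof.
rewrite /partition_exp; have mF : measurable [set y | pi y = pi x] by exact: mpi.
have [p0|p0] := eqVneq (fine (P [set y | pi y = pi x])) 0; last by rewrite divfK.
have P0 : P [set y | pi y = pi x] = 0%E by rewrite -[LHS]fineK ?p0 ?fin_num_measure.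
rewrite p0 mulr0 /Rintegral null_set_integral//.
by apply: measurable_funTS; exact: measurable_int iZ.
Qed.

Lemma partition_exp_integral c :
  \int[P]_(x in [set x | pi x = c]) partition_exp x =
  \int[P]_(x in [set x | pi x = c]) Z x.
Proof.
have [[x0 xc]|/forallNP nx] := pselect (exists x, pi x = c); last first.
  rewrite (_ : [set _ | _] = set0) ?Rintegral_set0//.
  by apply/seteqP; split=> // x /= /nx.
rewrite -xc -partition_exp_mul.
rewrite (@eq_Rintegral _ _ _ _ _ (cst (partition_exp x0))).
  by rewrite Rintegral_cst//; exact: mpi.
by move=> x; rewrite inE/=; exact: partition_exp_fiber.
Qed.

(** The indicator of a union of atoms is constant on atoms, hence orthogonal to
    [partition_exp - Z]. *)
Lemma partition_exp_saturated (A : set T) : 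
  P.-integrable setT (EFin \o partition_exp) ->
  (forall x y, pi x = pi y -> A x -> A y) ->
  \int[P]_(x in A) partition_exp x = \int[P]_(x in A) Z x.
Proof.
move=> iE sA.
have hA x y : pi x = pi y -> \1_A x = \1_A y :> R.
  move=> xy; rewrite !indicE; congr (nat_of_bool _)%:R.
  by apply/idP/idP; rewrite !inE; apply: sA.
have mA : measurable A.
  rewrite (_ : A = [set x | exists c, pi x = c /\ (exists2 y, A y & pi y = c)]).
    apply: measurable_exists => c; apply: measurable_conj; first exact: mpi.
    exact: measurable_prop.
  apply/seteqP; split=> x /=; first by move=> Ax; exists (pi x); split=> //; exists x.
  by move=> [c [<- [y Ay]]] /sA; exact.
have iI f : P.-integrable setT (EFin \o f) ->
    P.-integrable setT (EFin \o (fun x => \1_A x * f x)).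
  move=> fi; apply: (@dominated_integrable _ _ _ _ _ (fun x => `|f x|)).
  - apply: measurable_funM; first exact: measurable_indic.
    exact/measurable_EFinP/(measurable_int _ fi).
  - move=> x; rewrite normrM ler_piMl//; have /andP[? ?] := indic01 R A x.
    by rewrite ger0_norm.
  - exact: integrable_abse fi.
apply/eqP; rewrite -subr_eq0 !(Rintegral_indic P A) -RintegralB//; [|exact: iI|exact: iI].
apply/eqP; under eq_Rintegral do rewrite -mulrBr.
apply: (Rintegral_orth mpi) => //.
- exact: EFin_integrableB.
- exact/iI/EFin_integrableB.
move=> c; have iF f (fi : P.-integrable setT (EFin \o f)) :=
  integrableS measurableT (mpi c) (@subsetT _ _) fi.
by rewrite (RintegralB (mpi c) (iF _ iE) (iF _ iZ)) partition_exp_integral subrr.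
Qed.

Hypothesis Z2 : square_integrable P Z.

(* Jensen's inequality on each atom: expand the integral of (Z - a)^2, a the
   mean of Z on the atom *)
Lemma partition_exp_jensen :
  (\int[P]_x (partition_exp x ^+ 2)%:E <= \int[P]_x (Z x ^+ 2)%:E)%E.
Proof.
pose F c := [set x | pi x = c].
have UF : \bigcup_c F c = setT by apply/seteqP; split=> // x _; exists (pi x).
have tF : trivIset setT F.
  apply/trivIsetP => i j _ _ ij; apply/seteqP; split=> // x [/= xi xj].
  by rewrite -xi -xj eqxx in ij.
have mZ := Z2.1; have mE := measurable_partition_exp.
rewrite -UF !ge0_integral_bigcup//; try by [
  rewrite UF; apply/measurable_EFinP; exact: measurable_funX |
  move=> x _; rewrite lee_fin sqr_ge0].
apply: lee_nneseries => [c _ _|c _].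
  by apply: integral_ge0 => x _; rewrite lee_fin sqr_ge0.
have mc : measurable (F c) by exact: mpi.
have iF f (fi : P.-integrable setT (EFin \o f)) :=
  integrableS measurableT mc (@subsetT _ _) fi.
have [[x0 xc]|/forallNP nx] := pselect (exists x, pi x = c); last first.
  rewrite (_ : F c = set0) ?integral_set0//.
  by apply/seteqP; split=> // x /= /nx.
pose a := partition_exp x0.
have aE x : F c x -> partition_exp x = a.
  by rewrite /F/= -xc => xx0; exact: partition_exp_fiber.
have aP : a * fine (P (F c)) = \int[P]_(y in F c) Z y.
  by rewrite /a /F -xc partition_exp_mul.
rewrite (eq_integral (fun _ => (a ^+ 2)%:E)); last first.
  by move=> x; rewrite inE => Fx; rewrite aE.
rewrite integral_cst// -[X in (_ * X)%E]fineK ?fin_num_measure// -EFinM.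
rewrite (EFin_Rintegral mc Z2.2) lee_fin.
have i1 : P.-integrable setT (EFin \o (fun x => 2 * a * Z x)) by exact: EFin_integrableZ.
have i2 : P.-integrable setT (EFin \o cst (a ^+ 2)).
  exact: finite_measure_integrable_cst.
have : 0 <= \int[P]_(x in F c) ((Z x ^+ 2 - 2 * a * Z x) + a ^+ 2).
  apply: Rintegral_ge0 => x _.
  by rewrite (_ : _ + _ = (Z x - a) ^+ 2) ?sqr_ge0//; ring.
rewrite (RintegralD mc (iF _ (EFin_integrableB Z2.2 i1)) (iF _ i2)).
rewrite (RintegralB mc (iF _ Z2.2) (iF _ i1)) (RintegralZl _ mc (iF _ iZ)).
rewrite Rintegral_cst// -aP; move: (fine _) => p; lra.
Qed.

Lemma square_integrable_partition_exp : square_integrable P partition_exp.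
Proof.
split; first exact: measurable_partition_exp.
apply/integrableP; split.
  by apply/measurable_EFinP; apply: measurable_funX; exact: measurable_partition_exp.
under eq_integral do rewrite /= ger0_norm ?sqr_ge0//.
apply: (le_lt_trans partition_exp_jensen).
by apply: integrable_lty => //; exact: Z2.2.
Qed.

Lemma partition_exp_L2 :
  \int[P]_x (partition_exp x ^+ 2) <= \int[P]_x (Z x ^+ 2).
Proof.
rewrite -lee_fin -!EFin_Rintegral//; [exact: partition_exp_jensen|exact: Z2.2|].
exact: square_integrable_partition_exp.2.
Qed.

End partition_cond_exp.

(** * Levy's upward theorem *)

Section levy.
Context d (T : measurableType d) (R : realType) (P : probability T R).
Variables (pi : nat -> T -> nat) (e : T -> R) (K : R) (G : set (set T)).
Hypothesis mpi : forall n, discrete_fun (pi n).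
Hypothesis pi_refine : forall n x y, pi n.+1 x = pi n.+1 y -> pi n x = pi n y.
Hypothesis ie : P.-integrable setT (EFin \o e).
Let M n := partition_exp P (pi n) e.
Hypothesis M2 : forall n, square_integrable P (M n).
Hypothesis MK : forall n, \int[P]_x (M n x ^+ 2) <= K.
Hypothesis GE : measurable = <<s G >>.
Hypothesis GI : setI_closed G.
Hypothesis GT : G setT.
Hypothesis Gpi : forall A, G A ->
  exists n, forall x y, pi n x = pi n y -> A x -> A y.

Let M_mart n c : \int[P]_(x in [set x | pi n x = c]) M n.+1 x =
  \int[P]_(x in [set x | pi n x = c]) M n x.
Proof.
rewrite partition_exp_integral// partition_exp_saturated//.
  exact: (square_integrable_integrable (M2 n.+1)).
by move=> x y /pi_refine /= ->.
Qed.

Let M_fiber n x y : pi n x = pi n y -> M n x = M n y.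
Proof. exact: partition_exp_fiber. Qed.

(* Fatou's lemma and the L2 bounds identify the limit. *)
Lemma levy_upward : {ae P, forall x, M ^~ x @ \oo --> e x}.
Proof.
have [N [mN PN hN]] := martingale_cvg mpi pi_refine M_fiber M2 MK M_mart.
pose D := ~` N; have mD : measurable D by exact: measurableC.
have Dcvg x : D x -> cvgn (M ^~ x).
  by move=> Dx; apply: contrapT => nc; apply: Dx; apply: hN.
pose Mi x := limn (fun n => \1_D x * M n x).
have MiP x : (fun n => \1_D x * M n x) @ \oo --> Mi x.
  rewrite /Mi indicE; case: (boolP (x \in D)) => xD /=.
    by under eq_fun do rewrite mul1r; apply: Dcvg; exact: set_mem.
  by under eq_fun do rewrite mul0r; exact: is_cvg_cst.
have mDM n : measurable_fun setT (fun x => \1_D x * M n x).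
  by apply: measurable_funM; [exact: measurable_indic|case: (M2 n)].
have mMi : measurable_fun setT Mi by apply: (measurable_fun_cvg mDM).
have PD : P.-negligible (~` D) by exists N; split=> //; rewrite setCK.
pose L := limn (fun n => \int[P]_x (M n x ^+ 2)).
pose b m := L - \int[P]_x (M m x ^+ 2).
pose f m x := Mi x - \1_D x * M m x.
have mf m : measurable_fun setT (f m) by exact: measurable_funB.
(* Fatou's lemma in [k] for the squares of [M (m + k) - M m], whose integrals are at most [b m]. As
   [b m] tends to 0, the pointwise limit is also the L2 limit. *)
have fatou_bound m : (\int[P]_x ((f m x) ^+ 2)%:E <= (b m)%:E)%E.
  pose g k x := ((\1_D x * (M (m + k)%N x - M m x)) ^+ 2)%:E.
  have g2 k := square_integrable_indic mD (square_integrableB (M2 (m + k)%N) (M2 m)).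
  have mg k : measurable_fun setT (g k).
    exact/measurable_EFinP/measurable_funX/(g2 k).1.
  have g0 k x : setT x -> (0 <= g k x)%E by rewrite lee_fin sqr_ge0.
  have gl x : limn_einf (g ^~ x) = ((f m x) ^+ 2)%:E.
    suff h : (g ^~ x) @ \oo --> ((f m x) ^+ 2)%:E by have [] := cvg_limn_einf_sup h.
    apply: cvg_EFin; first exact: nearW.
    rewrite /g /= /f; under eq_fun do rewrite mulrBr.
    apply: (@cvg_comp _ _ _ _ (fun y : R => y ^+ 2) _ (nbhs (Mi x - \1_D x * M m x))).
      apply: cvgB; last exact: cvg_cst.
      have := MiP x; rewrite -(cvg_shiftn m).
      by under eq_fun do rewrite addnC.
    exact: exprn_continuous.
  under eq_integral do rewrite -gl.
  apply: le_trans (fatou P measurableT mg g0) _.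
  rewrite limn_einf_lim; apply: lime_le; first exact: is_cvg_einfs.
  apply: nearW => k; apply: (@le_trans _ _ (\int[P]_x g k x)%E).
    by apply: ereal_inf_lbound; exists k => /=.
  rewrite (EFin_Rintegral measurableT (g2 k).2) lee_fin; apply: le_trans (martingale_L2_tail mpi pi_refine M_fiber M2 MK M_mart (leq_addr k m)).
  apply: ge0_Rintegral_le; [exact: (g2 k).2| |move=> x].
    exact: (square_integrableB (M2 (m + k)%N) (M2 m)).2.
  rewrite exprMn ler_piMl ?sqr_ge0// expr_le1//; by case/andP: (indic01 R D x).
have f2 m : square_integrable P (f m).
  split=> //; apply/integrableP; split; first exact/measurable_EFinP/measurable_funX.
  under eq_integral do rewrite /= ger0_norm ?sqr_ge0//.
  by apply: (le_lt_trans (fatou_bound m)); exact: ltry.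
have DM2 m := square_integrable_indic mD (M2 m).
have Mi2 : square_integrable P Mi.
  have := square_integrableD (f2 0%N) (DM2 0%N).
  by rewrite /f; under eq_fun do rewrite subrK.
have iMi := square_integrable_integrable Mi2.
have DMint m A : measurable A -> (\int[P]_(x in A) (\1_D x * M m x) =
    \int[P]_(x in A) M m x)%R.
  move=> mA; congr fine; apply: ae_eq_integral => //.
  - by apply: measurable_funTS; exact/measurable_EFinP.
  - by apply: measurable_funTS; apply/measurable_EFinP; case: (M2 m).
  apply: negligibleS PD => x /= /not_implyP[Ax h] Dx; apply: h.
  by rewrite indicE mem_set// mul1r.
(* From level [n0] on, [A] is a union of atoms, so [M m] and [e] have the same integral over it; it
   remains to see that the integrals of [Mi] and [M m] over [A] differ arbitrarily little. *)
have keyG A : G A -> (\int[P]_(x in A) (Mi x)%:E = \int[P]_(x in A) (e x)%:E)%E.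
  move=> GA; have mA : measurable A by rewrite GE; exact: sub_gen_smallest.
  have iA f' (fi : P.-integrable setT (EFin \o f')) :=
    integrableS measurableT mA (@subsetT _ _) fi.
  rewrite (EFin_Rintegral mA iMi) (EFin_Rintegral mA ie); congr EFin.
  have [n0 sA] := Gpi GA.
  have Me m : (n0 <= m)%N -> \int[P]_(x in A) M m x = \int[P]_(x in A) e x.
    move=> nm; apply: partition_exp_saturated => //.
      exact: (square_integrable_integrable (M2 m)).
    by move=> x y xy; apply: sA; apply: refine_le xy.
  apply/eqP; rewrite -subr_eq0 -normr_le0; apply/ler_addgt0Pr => t t0; rewrite add0r.
  have [n1 hn1] := martingale_L2_small mpi pi_refine M_fiber M2 MK M_mart (exprn_gt0 2 t0).
  pose m := maxn n0 n1.
  have bm : b m <= t ^+ 2.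
    apply: le_trans (ltW hn1); rewrite /b lerB// -subr_ge0.
    rewrite -(martingale_increment mpi pi_refine M_fiber M2 M_mart (leq_maxr n0 n1)).
    by apply: Rintegral_ge0 => x _; exact: sqr_ge0.
  rewrite -(Me m (leq_maxl _ _)) -DMint//.
  rewrite -(RintegralB mA (iA _ iMi) (iA _ (square_integrable_integrable (DM2 m)))).
  have ifm := square_integrable_integrable (f2 m).
  apply: (le_trans (le_normr_Rintegral mA (iA _ ifm))).
  have inf : P.-integrable setT (EFin \o (fun x => `|f m x|)) by exact: integrable_abse ifm.
  have ih : P.-integrable setT (EFin \o (fun x => t / 2 + (2 * t)^-1 * f m x ^+ 2)).
    apply: EFin_integrableD; first exact: finite_measure_integrable_cst.
    exact/EFin_integrableZ/(f2 m).2.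
  (* The bound |f| <= t/2 + f^2/(2t) does the work of the Cauchy-Schwarz inequality: with the
     integral of f^2 at most t^2, the total is at most t. *)
  apply: (@le_trans _ _ (\int[P]_x (t / 2 + (2 * t)^-1 * f m x ^+ 2))).
    rewrite (Rintegral_indic P A); apply: ge0_Rintegral_le => // [|x].
      apply: dominated_integrable inf; first apply: measurable_funM.
      - exact: measurable_indic.
      - exact: measurableT_comp.
      by move=> x; rewrite normrM normr_id ler_piMl// ger0_norm; case/andP: (indic01 R A x).
    apply: (@le_trans _ _ `|f m x|).
      by rewrite ler_piMl//; case/andP: (indic01 R A x).
    have -> : f m x ^+ 2 = `|f m x| ^+ 2 by rewrite real_normK ?num_real.
    rewrite -subr_ge0 (_ : _ - _ = (2 * t)^-1 * (t - `|f m x|) ^+ 2).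
      by rewrite mulr_ge0 ?sqr_ge0// invr_ge0 mulr_ge0// ltW.
    by field; rewrite gt_eqF.
  rewrite (RintegralD measurableT (finite_measure_integrable_cst P (t / 2) measurableT)
    (EFin_integrableZ (2 * t)^-1 (f2 m).2)).
  rewrite (RintegralZl _ measurableT (f2 m).2) Rintegral_probability_cst.
  have : \int[P]_x (f m x ^+ 2) <= t ^+ 2.
    apply: le_trans bm; rewrite -lee_fin; apply: le_trans (fatou_bound m).
    by rewrite (EFin_Rintegral measurableT (f2 m).2).
  move=> h; rewrite -lerBrDl; apply: (@le_trans _ _ ((2 * t)^-1 * t ^+ 2)).
    by rewrite ler_wpM2l// invr_ge0 mulr_ge0// ltW.
  by rewrite le_eqVlt; apply/orP; left; apply/eqP; field; rewrite gt_eqF.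
(* A Dynkin class argument extends the equality from the generating pi-system to all events, which
   forces [Mi] and [e] to agree almost everywhere. *)
have key A : measurable A -> (\int[P]_(x in A) (Mi x)%:E = \int[P]_(x in A) (e x)%:E)%E.
  rewrite GE; apply: (@dynkin_induction _ _ _
    (fun A => \int[P]_(x in A) (Mi x)%:E = \int[P]_(x in A) (e x)%:E)%E GE GI) => //.
  - exact: keyG.
  - move=> S mS hS; have := keyG _ GT.
    have mSC : measurable (~` S) by exact: measurableC.
    have dS : [disjoint ~` S & S] by exact/disj_set2P/setICl.
    have me : measurable_fun setT e by exact/measurable_EFinP/(measurable_int _ ie).
    rewrite -(setvU S) !integral_setU_EFin ?setvU//.
    rewrite hS => /(congr1 (fun z => (z - \int[P]_(x in S) (e x)%:E)%E)).
    have fin : (\int[P]_(x in S) (e x)%:E)%E \is a fin_num.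
      by rewrite (EFin_Rintegral mS ie).
    by rewrite !addeK.
  - move=> F mF tF hF; rewrite !integral_bigcup//; first exact: eq_eseriesr.
      by apply: integrableS ie => //; exact: bigcupT_measurable.
    by apply: integrableS iMi => //; exact: bigcupT_measurable.
have aeM : ae_eq P setT (EFin \o Mi) (EFin \o e).
  apply: integral_ae_eq => //; first exact: measurable_int ie.
  by move=> E _ mE; exact: key.
apply: negligibleS (negligibleU PD aeM) => x /= nx.
apply: contrapT => /not_orP[] /contrapT Dx /contrapT h; apply: nx.
have [<-] := h Logic.I; have := MiP x; rewrite indicE mem_set//.
by under eq_fun do rewrite mul1r.
Qed.

End levy.

(** * A strong law for adapted square integrable sequences *)

Section strong_law.
Context d (T : measurableType d) (R : realType) (P : probability T R).
Variables (pi : nat -> T -> nat) (V : nat -> T -> R) (K : R).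
Hypothesis mpi : forall n, discrete_fun (pi n).
Hypothesis pi_refine : forall n x y, pi n.+1 x = pi n.+1 y -> pi n x = pi n y.
Hypothesis V_fiber : forall n x y, pi n.+1 x = pi n.+1 y -> V n x = V n y.
Hypothesis V2 : forall n, square_integrable P (V n).
Hypothesis VK : forall n, \int[P]_x (V n x ^+ 2) <= K.

Let D n x := V n x - partition_exp P (pi n) (V n) x.
Let M n x := \sum_(0 <= j < n) D j x / j.+1%:R.

Let iV n := square_integrable_integrable (V2 n).
Let E2 n := square_integrable_partition_exp (mpi n) (iV n) (V2 n).
Let D2 n : square_integrable P (D n) := square_integrableB (V2 n) (E2 n).

Let DK n : \int[P]_x (D n x ^+ 2) <= 4 * K.
Proof.
have i2 := EFin_integrableD (EFin_integrableZ 2 (V2 n).2) (EFin_integrableZ 2 (E2 n).2).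
apply: (@le_trans _ _ (\int[P]_x (2 * V n x ^+ 2 +
    2 * partition_exp P (pi n) (V n) x ^+ 2))).
  apply: ge0_Rintegral_le => // [|x]; first exact: (D2 n).2.
  rewrite /D; set a := V n x; set b := partition_exp _ _ _ _.
  by have := sqr_ge0 (a + b); nra.
rewrite (RintegralD measurableT (EFin_integrableZ 2 (V2 n).2) (EFin_integrableZ 2 (E2 n).2)).
rewrite (RintegralZl _ measurableT (V2 n).2) (RintegralZl _ measurableT (E2 n).2).
have := VK n; have := partition_exp_L2 (mpi n) (iV n) (V2 n); lra.
Qed.

Let D_fiber n x y : pi n.+1 x = pi n.+1 y -> D n x = D n y.
Proof.
by move=> xy; rewrite /D (V_fiber xy) (partition_exp_fiber _ _ (pi_refine xy)).
Qed.

Let D_mean n c : \int[P]_(x in [set x | pi n x = c]) D n x = 0.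
Proof.
rewrite /D (RintegralB (mpi n c) (EFin_integrableS (mpi n c) (iV n))).
  by rewrite partition_exp_integral ?subrr.
exact: EFin_integrableS (mpi n c) (square_integrable_integrable (E2 n)).
Qed.

Let MS n x : M n.+1 x = M n x + n.+1%:R^-1 * D n x.
Proof. by rewrite /M big_nat_recr//= [_ / _]mulrC. Qed.

Let M_fiber n x y : pi n x = pi n y -> M n x = M n y.
Proof.
elim: n => [|n IH] xy; first by rewrite /M !big_geq.
by rewrite !MS (IH (pi_refine xy)) (D_fiber xy).
Qed.

Let M2 n : square_integrable P (M n).
Proof.
elim: n => [|n IH].
  by rewrite /M; under eq_fun do rewrite big_geq//; exact: square_integrable_cst.
rewrite (_ : M n.+1 = fun x => M n x + n.+1%:R^-1 * D n x); last first.
  by apply/funext => x; rewrite MS.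
by apply: square_integrableD => //; exact: square_integrableZ.
Qed.

Let MD n : \int[P]_x (M n x * D n x) = 0.
Proof.
apply: (Rintegral_orth (mpi n)) => //.
- exact: M_fiber.
- exact: (square_integrable_integrable (D2 n)).
- exact: (square_integrable_mul (M2 n) (D2 n)).
Qed.

Let K0 : 0 <= K.
Proof. by apply: le_trans (VK 0); apply: Rintegral_ge0 => x _; exact: sqr_ge0. Qed.

(** Increments are orthogonal, and 1/(n+1)^2 <= 2/(n+1) - 2/(n+2) makes the bound telescope. *)
Let MK n : \int[P]_x (M n x ^+ 2) <= 4 * K * (3 - 2 / n.+1%:R).
Proof.
have K0' := K0.
elim: n => [|n IH].
  rewrite /M; under eq_Rintegral do rewrite big_geq// expr0n/=.
  by rewrite Rintegral_probability_cst divr1; lra.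
have iMD := square_integrable_mul (M2 n) (D2 n).
have i1 := EFin_integrableZ (2 * n.+1%:R^-1) iMD.
have i2 := EFin_integrableZ (n.+1%:R^-1 ^+ 2) (D2 n).2.
have -> : \int[P]_x (M n.+1 x ^+ 2) = \int[P]_x (M n x ^+ 2) +
    n.+1%:R^-1 ^+ 2 * \int[P]_x (D n x ^+ 2).
  under eq_Rintegral => x _.
    rewrite MS (_ : _ ^+ 2 = M n x ^+ 2 + (2 * n.+1%:R^-1 * (M n x * D n x) +
      n.+1%:R^-1 ^+ 2 * D n x ^+ 2)); last by ring.
    over.
  rewrite (RintegralD measurableT (M2 n).2 (EFin_integrableD i1 i2)).
  rewrite (RintegralD measurableT i1 i2) (RintegralZl _ measurableT iMD) MD mulr0 add0r.
  by rewrite (RintegralZl _ measurableT (D2 n).2).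
apply: (le_trans (lerD IH (ler_wpM2l (sqr_ge0 _) (DK n)))).
rewrite -subr_ge0 (_ : _ - _ = 4 * K * (n%:R * n.+1%:R^-1 ^+ 2 * n.+2%:R^-1)).
  by rewrite !mulr_ge0// ?exprn_ge0 ?invr_ge0.
have -> : n.+2%:R = n%:R + 2 :> R by rewrite -addn2 natrD.
have -> : n.+1%:R = n%:R + 1 :> R by rewrite -addn1 natrD.
by field; apply/andP; split; rewrite gt_eqF//; lra.
Qed.

Let M_mart n c : \int[P]_(x in [set x | pi n x = c]) M n.+1 x =
  \int[P]_(x in [set x | pi n x = c]) M n x.
Proof.
rewrite (_ : M n.+1 = fun x => M n x + n.+1%:R^-1 * D n x); last first.
  by apply/funext => x; rewrite MS.
have iD := square_integrable_integrable (D2 n).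
have mc := mpi n c.
rewrite (RintegralD mc (EFin_integrableS mc (square_integrable_integrable (M2 n)))
  (EFin_integrableS mc (EFin_integrableZ _ iD))).
by rewrite (RintegralZl _ mc (EFin_integrableS mc iD)) D_mean mulr0 addr0.
Qed.

(** The series of the centred terms divided by [j.+1] is an L2-bounded martingale, so it converges
    almost everywhere, and Kronecker's lemma turns this into averages. *)
Lemma partition_strong_law : {ae P, forall x,
  (fun n => n%:R^-1 * \sum_(0 <= j < n) (V j x - partition_exp P (pi j) (V j) x))
    @ \oo --> (0 : R)}.
Proof.
have MK' n : \int[P]_x (M n x ^+ 2) <= 4 * K * 3.
  apply: le_trans (MK n) _; rewrite ler_wpM2l ?mulr_ge0//.
  by rewrite gerBl// divr_ge0.
apply: filterS (martingale_cvg mpi pi_refine M_fiber M2 MK' M_mart) => x.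
exact: kronecker_cvg.
Qed.

End strong_law.

Section laws.
Context d d' (T : measurableType d) (Y : measurableType d') (R : realType).

Definition to_mfun (F : T -> Y) (mF : measurable_fun setT F) : {mfun T >-> Y} :=
  MeasurableFun.Pack (MeasurableFun.Class (isMeasurableFun.Build _ _ _ _ _ mF)).

Variable P : probability T R.

Lemma regression_exists (F : {mfun T >-> Y}) (Z : T -> R) :
  P.-integrable setT (EFin \o Z) ->
  exists e : Y -> R, [/\ measurable_fun setT e,
    (distribution P F).-integrable setT (EFin \o e),
    P.-integrable setT (EFin \o (e \o F)) &
    forall A, measurable A ->
      \int[distribution P F]_(y in A) e y = \int[P]_(x in F @^-1` A) Z x /\
      \int[P]_(x in F @^-1` A) e (F x) = \int[P]_(x in F @^-1` A) Z x].
Proof.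
move=> iZ; have mF : measurable_fun setT F by [].
have mFA A : measurable A -> measurable (F @^-1` A).
  by move=> mA; rewrite -[X in measurable X]setTI; exact: mF.
pose nu' : {charge set Y -> \bar R} := pushforward (induced_charge iZ) F.
pose nu := nu' mF.
have dom : nu `<< distribution P F.
  apply/null_content_dominatesP => A mA; rewrite /distribution /pushforward => PA0.
  apply: null_set_integral => //; first exact: mFA.
  by apply: measurable_funTS; exact: measurable_int iZ.
pose e' := Radon_Nikodym nu (distribution P F).
have ie' : (distribution P F).-integrable setT e' by exact: Radon_Nikodym_integrable.
have e'E : EFin \o (fine \o e') = e'.
  by apply/funext => y /=; rewrite fineK//; exact: Radon_Nikodym_fin_num.
pose e := fine \o e'.
have me : measurable_fun setT e.
  by apply/measurable_EFinP; rewrite e'E; exact: measurable_int ie'.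
have ie : (distribution P F).-integrable setT (EFin \o e) by rewrite e'E.
have ieF : P.-integrable setT (EFin \o (e \o F)).
  apply/integrableP; split.
    by apply/measurable_EFinP; exact: measurableT_comp.
  have /integrableP[_] := ie; apply: le_lt_trans.
  rewrite ge0_integral_pushforward ?preimage_setT//.
  by apply: measurableT_comp => //; exact/measurable_EFinP.
exists e; split=> // A mA.
have h : \int[distribution P F]_(y in A) e y = \int[P]_(x in F @^-1` A) Z x.
  congr fine; rewrite -[LHS]/(\int[distribution P F]_(y in A) (EFin \o e) y)%E e'E.
  by rewrite -Radon_Nikodym_integral.
split=> //; rewrite -h /Rintegral; congr fine.
rewrite integral_pushforward//.
  exact/measurable_EFinP.
exact: (EFin_integrableS (mFA _ mA) ieF).
Qed.

End laws.

(** * Regular sample paths and the limiting sequence *)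

Section regular_paths.
Context {R : realType}.
Implicit Types (x : int -> R) (y : nat -> R).

Definition future x : nat -> R := fun i => x i%:Z.
Definition shift_path (h : int) x : int -> R := fun i => x (i + h).

(* Besides the existence of all recurrence times, a regular path satisfies that
   x_{lambda_j - i} does not increase to a dyadic point outside its cells. *)
Definition regular_path x :=
  (forall n, good n (future x)) /\
  forall (i k : nat) (m : int), ~ exists J : nat, forall j : nat, (J <= j)%N ->
    m%:~R * 2 ^- k - 2 ^- j <= x ((lambda x j)%:Z - i%:Z) < m%:~R * 2 ^- k.

Variable x : int -> R.
Hypothesis rx : regular_path x.

Lemma lambda_future n : lambda x n = lam (future x) n.
Proof. exact: lambdaE. Qed.

Lemma lambda_le n m : (n <= m)%N -> (lambda x n <= lambda x m)%N.
Proof. by rewrite !lambda_future; exact: lam_le. Qed.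

Lemma lambda_ge n : (n <= lambda x n)%N.
Proof. by rewrite lambda_future; apply: lam_ge; case: rx. Qed.

Lemma lambda_ltS n : (lambda x n < lambda x n.+1)%N.
Proof. by rewrite !lambda_future; apply: lam_ltS; case: rx. Qed.

(** Each time lambda_{m+1} ends a copy, at the finer level m+1, of the block ending at lambda_m, so
    looking back [i] steps within that block finds the same cell of level [n]. *)
Lemma cell_stable n j i : (n <= j)%N -> (i <= lambda x n)%N ->
  qindex n (x ((lambda x j)%:Z - i%:Z)) = qindex n (x ((lambda x n)%:Z - i%:Z)).
Proof.
move=> /subnK <- iln; elim: (j - n)%N => [//|k <-]; rewrite addSn.
set m := (k + n)%N.
have im : (i <= lambda x m)%N by apply: (leq_trans iln); rewrite lambda_le// leq_addl.
have [g _] := rx.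
have [[_ h] _] := lam_step (g m.+1).
apply: (@qindex_le _ _ m.+1); first by rewrite ltnW// ltnS leq_addl.
have := h (lambda x m - i)%N; rewrite -!lambda_future leq_subr => /(_ isT).
rewrite /future addnBA// subnK; last exact: lambda_le.
by rewrite !subzn// (leq_trans im)// lambda_le.
Qed.

Lemma limit_past_cvg i :
  (fun j => x ((lambda x j)%:Z - i%:Z)) @ \oo --> limit_past x i.
Proof.
apply: cauchy_cvgn => e e0.
have [k ke] : exists k : nat, 2 ^- k <= e.
  exists (Num.truncn e^-1); rewrite -[leRHS]invrK lef_pV2 ?posrE ?exprn_gt0 ?invr_gt0//.
  apply: (@le_trans _ _ (Num.truncn e^-1).+1%:R); first by rewrite ltW// truncnS_gt.
  by rewrite -natrX ler_nat ltn_expl.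
exists (maxn k i) => j mj; rewrite (le_trans _ ke)// ltW//.
apply: qindex_dist; apply: (@qindex_le _ _ (maxn k i)); first exact: leq_maxl.
rewrite cell_stable// (leq_trans _ (lambda_ge _))//.
exact: leq_maxr.
Qed.

Lemma limit_past_qindex n i : (i <= lambda x n)%N ->
  qindex n (limit_past x i) = qindex n (x ((lambda x n)%:Z - i%:Z)).
Proof.
move=> iln; set c := qindex n (x _).
have inc j : (n <= j)%N -> cell n c (x ((lambda x j)%:Z - i%:Z)).
  by move=> nj; apply/cellP; exact: cell_stable.
have cv := limit_past_cvg (i := i).
have lo : c%:~R * 2 ^- n <= limit_past x i.
  apply: limr_ge; first exact: cvgP cv.
  by exists n => // j /= /inc /andP[].
have hi : limit_past x i <= (c + 1)%:~R * 2 ^- n.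
  apply: limr_le; first exact: cvgP cv.
  by exists n => // j /= /inc /andP[_ /ltW].
(* The limit lies in the closed cell. Were it the right endpoint, then for every [j >= n] the value
   at lambda_j - i would be below it by at most 2^-j, which the second clause of [regular_path]
   forbids. *)
apply/cellP; rewrite /cell/= lo/= lt_neqAle hi andbT; apply/eqP => lE.
have [_ /(_ i n (c + 1))] := rx; apply; exists n => j nj.
have /andP[_ ->] := inc j nj; rewrite andbT -lE lerBlDr.
have nl : (i <= lambda x j)%N by apply: (leq_trans iln); exact: lambda_le.
apply: limr_le; first exact: cvgP cv.
exists j => // m /= jm; rewrite -lerBlDl; apply: le_trans (ler_norm _) _.
by apply/ltW/qindex_dist; rewrite cell_stable.
Qed.

Lemma limit_past_agree n :
  qagree n (lambda x n) (past (shift_path (lambda x n) x)) (limit_past x).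
Proof.
move=> i il; rewrite limit_past_qindex// /past /shift_path addrC//.
Qed.

Lemma good_past_shift n : good n (past (shift_path (lambda x n) x)) /\
  lam (past (shift_path (lambda x n) x)) n = lambda x n.
Proof.
have [g _] := rx.
rewrite lambda_future; apply: (good_reverse (g n)) => i il.
by rewrite /past /shift_path /future addrC subzn.
Qed.

Lemma limit_past_lam n : good n (limit_past x) /\
  forall k, (k <= n)%N ->
    lam (limit_past x) k = lam (past (shift_path (lambda x n) x)) k.
Proof.
have [g1 g2] := good_past_shift n.
by apply: good_local => //; rewrite g2; exact: limit_past_agree.
Qed.

Lemma limit_past_lambda n : lam (limit_past x) n = lambda x n.
Proof.
have [_ ->//] := limit_past_lam n.
by have [] := good_past_shift n.
Qed.

Lemma limit_past_code n :
  past_code n (limit_past x) = past_code n (past (shift_path (lambda x n) x)).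
Proof.
have [_ h] := limit_past_lam n.
apply/codeP; split=> //; rewrite limit_past_lambda.
rewrite (maxn_idPl (lambda_ge n)); apply: qagree_sym; exact: limit_past_agree.
Qed.

(** Seen from time lambda_{j+1}, the time lambda_j + 1 lies lambda_{j+1} - lambda_j - 1 steps back.
    Evaluated at the limiting sequence this is therefore the [j]-th summand of the estimate. *)
Definition return_value (f : nat -> set R -> R) j y : R :=
  f j (quant j (y (lam y j.+1 - lam y j - 1)%N)).

Lemma estimate_limit_past f n : estimate f x n =
  n%:R^-1 * \sum_(0 <= j < n) return_value f j (limit_past x).
Proof.
rewrite /estimate; congr (_ * _); apply: eq_bigr => j _.
rewrite /return_value !limit_past_lambda; congr (f j _).
apply/quantP; apply/esym/(@qindex_le _ _ j.+1); first exact: leqnSn.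
have lj := lambda_ltS j.
rewrite limit_past_qindex; last by lia.
by rewrite /next_value; congr (qindex _ (x _)); lia.
Qed.

End regular_paths.

(** * Poincare recurrence and the law at the return times *)

Lemma trivIset_constant_null d (T : measurableType d) (R : realType)
    (P : probability T R) (F : nat -> set T) (p : \bar R) :
  (forall n, measurable (F n)) -> trivIset setT F ->
  (forall n, P (F n) = p) -> p = 0%E.
Proof.
move=> mF tF Fp.
have p0 : (0 <= p)%E by rewrite -(Fp 0%N).
have pfin : p \is a fin_num by rewrite -(Fp 0%N) fin_num_measure.
have mU : measurable (\bigcup_n F n) by exact: bigcupT_measurable.
have bound n : n%:R * fine p <= 1.
  rewrite -lee_fin; apply: le_trans (probability_le1 P mU).
  rewrite measure_semi_bigcup//.
  apply: le_trans (nneseries_lim_ge n _) => //.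
  rewrite (eq_bigr (fun=> p)); last by move=> i _; exact: Fp.
  by rewrite -{2}(fineK pfin) sumEFin lee_fin sumr_const_nat subn0 mulr_natl.
suff fp : fine p = 0 by rewrite -(fineK pfin) fp.
apply/eqP; rewrite eq_le fine_ge0// andbT.
rewrite leNgt; apply/negP => fp0.
have := bound (Num.truncn (fine p)^-1).+1; rewrite leNgt => /negP; apply.
by rewrite -ltr_pdivrMr// div1r truncnS_gt.
Qed.

Lemma negligible_exists d (T : measurableType d) (R : realType)
    (P : probability T R) (C : countType) (Q : C -> T -> Prop) :
  (forall c, P.-negligible [set w | Q c w]) ->
  P.-negligible [set w | exists c, Q c w].
Proof.
move=> nQ; apply: (@negligibleS _ _ _ _ (\bigcup_k [set w |
  if unpickle k is Some c then Q c w else False])); last first.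
  by apply: negligible_bigcup => k; case: unpickle => // ; exact: negligible_set0.
by move=> w /= [c Qc]; exists (pickle c) => //=; rewrite pickleK.
Qed.

Section path_maps.
Context {R : realType}.
Local Notation ipaths := (@paths R int).

Lemma measurable_past : measurable_fun setT (past : ipaths -> @paths R nat).
Proof. by apply: measurable_pathsP => // i; exact: measurable_coord. Qed.

Lemma measurable_shift_path h :
  measurable_fun setT (shift_path h : ipaths -> ipaths).
Proof. by apply: measurable_pathsP => // i; exact: measurable_coord. Qed.

Lemma discrete_lambda n : discrete_fun (fun x : ipaths => lambda x n).
Proof.
under [X in discrete_fun X]funext => x do rewrite lambdaE.
by apply: discrete_fun_lam => i; exact: measurable_coord.
Qed.

Definition return_path n (x : int -> R) : int -> R := shift_path (lambda x n) x.

Lemma measurable_return_path n :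
  measurable_fun setT (return_path n : ipaths -> ipaths).
Proof.
apply: (@measurable_discrete_bind _ _ _ _ _ _
  (fun l (x : ipaths) => shift_path l%:Z x : ipaths)).
  exact: discrete_lambda.
by move=> l; exact: measurable_shift_path.
Qed.

Lemma measurable_good_future n :
  measurable [set x : ipaths | good n (future x)].
Proof. by apply: measurable_good => i; exact: measurable_coord. Qed.

Lemma measurable_good_past n : measurable [set x : ipaths | good n (past x)].
Proof. by apply: measurable_good => i; exact: measurable_coord. Qed.

Lemma discrete_lam_past n : discrete_fun (fun x : ipaths => lam (past x) n).
Proof. by apply: discrete_fun_lam => i; exact: measurable_coord. Qed.

(** Both directions are [good_reverse], reversal of a block being an involution. This turns an event
    about the future into one about the past of a shifted path, where stationarity applies. *)
Lemma good_future_shift n l (x : int -> R) :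
  (good n (future x) /\ lambda x n = l) <->
  (good n (past (shift_path l%:Z x)) /\ lam (past (shift_path l%:Z x)) n = l).
Proof.
rewrite lambdaE -/(future x); split=> -[g lE].
  by rewrite -[X in _ = X]lE; apply: good_reverse => // i il; rewrite /past /shift_path /future; rewrite lE in il *; congr (x _); lia.
rewrite -[X in _ = X]lE; apply: good_reverse => // i il.
by rewrite /past /shift_path /future; rewrite lE in il *; congr (x _); lia.
Qed.

End path_maps.

Section stationary_process.
Context d (T : measurableType d) (R : realType) (P : probability T R).
Variable X : int -> {RV P >-> R}.

Notation sp := (sample_path X).

Lemma measurable_sample_path : measurable_fun setT (sp : T -> paths int).
Proof. by apply: measurable_pathsP => // i; exact: measurable_funPT. Qed.

Lemma measurable_path_event (A : set (paths int)) :
  measurable A -> measurable [set w | A (sp w)].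
Proof. by move=> mA; rewrite -[X in measurable X]setTI; exact: measurable_sample_path. Qed.

Lemma measurable_preimageT d1 d2 (T1 : measurableType d1) (T2 : measurableType d2)
  (F : T1 -> T2) (A : set T2) :
  measurable_fun setT F -> measurable A -> measurable [set x | A (F x)].
Proof. by move=> mF mA; rewrite -[X in measurable X]setTI; exact: mF. Qed.

Lemma measurable_returned n (A : set (paths int)) :
  measurable A -> measurable [set w | A (return_path n (sp w))].
Proof.
move=> mA; have := measurable_preimageT (measurable_return_path n) mA.
exact: measurable_path_event.
Qed.

Lemma measurable_shifted h (A : set (paths int)) :
  measurable A -> measurable [set w | A (shift_path h (sp w))].
Proof.
move=> mA; have := measurable_preimageT (measurable_shift_path h) mA.
exact: measurable_path_event.
Qed.

Hypothesis stX : stationary X.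

(* Poincare recurrence: the events "the block seen at time s never recurs" have
   the same probability and are disjoint *)
Lemma matches_ae n l :
  {ae P, forall w, exists t, matches n (future (sp w)) l t}.
Proof.
pose g s (x : int -> R) := mkseq (fun i => qindex n (x (s + i)%N)) l.+1.
pose A (c : seq int) : set (paths int) :=
  [set x | g 0%N x = c /\ forall t : nat, g t.+1 x <> c].
have mg s : discrete_fun (g s : paths int -> seq int).
  by apply: discrete_fun_map => i; apply: discrete_fun_qindex; exact: measurable_coord.
have mA c : measurable (A c).
  apply: measurable_conj; first exact: mg.
  by apply: measurable_forall => t; apply: measurable_not; exact: mg.
have mgs s s' w : g s' (shift_path s%:Z (sp w)) = g (s + s')%N (sp w).
  by apply/eq_map => i; rewrite /shift_path; congr (qindex _ (sp w _)); lia.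
have A0 c : P [set w | A c (sp w)] = 0%E.
  apply: (@trivIset_constant_null _ _ _ P
    (fun s => [set w | A c (shift_path s%:Z (sp w))])).
  - by move=> s; exact: measurable_shifted.
  - have disj s s' w : (s < s')%N -> A c (shift_path s%:Z (sp w)) ->
        A c (shift_path s'%:Z (sp w)) -> False.
      move=> ss [_ h] [+ _]; have := h (s' - s).-1; rewrite !mgs addn0.
      by rewrite (_ : (s + _)%N = s'); last by lia.
    apply/trivIsetP => s s' _ _ ss; apply/seteqP; split=> // w [h1 h2] /=.
    by move: ss; rewrite neq_ltn => /orP[lt|lt]; [exact: (disj _ _ _ lt h1 h2)|exact: (disj _ _ _ lt h2 h1)].
  - by move=> s; have := stX s%:Z (mA c).
apply: (@negligibleS _ _ _ _ [set w | exists c, A c (sp w)]); last first.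
  apply: negligible_exists => c.
  by apply/negligibleP; [exact: measurable_path_event|exact: A0].
move=> w /= nm; exists (g 0%N (sp w)); split=> // t gt.
apply: nm; exists t.+1; split=> // i il; rewrite /future.
have : nth 0 (g t.+1 (sp w)) i = nth 0 (g 0%N (sp w)) i by rewrite gt.
by rewrite !nth_mkseq ?ltnS// add0n.
Qed.

Lemma good_ae : {ae P, forall w, forall n, good n (future (sp w))}.
Proof.
have h1 n : {ae P, forall w, forall l, exists t, matches n (future (sp w)) l t}.
  by apply: ae_foralln => l; exact: matches_ae.
have : {ae P, forall w, forall n l, exists t, matches n (future (sp w)) l t}.
  exact: ae_foralln.
by apply: filterS => w h n k _; exact: h.
Qed.

Lemma probability_ae_eq (A B G : set T) : measurable A -> measurable B ->
  {ae P, forall w, G w} -> (forall w, G w -> A w <-> B w) -> P A = P B.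
Proof.
move=> mA mB [N [mN PN GN]] AB.
have PN0 (C : set T) : measurable C -> P (C `&` N) = 0%E.
  move=> mC; apply/eqP; rewrite -measure_le0 -PN; apply: le_measure; rewrite ?inE//.
  exact: measurableI.
have PD (C : set T) : measurable C -> P C = P (C `\` N).
  move=> mC; transitivity (P (C `\` N) + P (C `&` N))%E; first exact: measureDI.
  by rewrite PN0// adde0.
rewrite PD// [RHS]PD//; congr (P _).
by apply/seteqP; split=> w [Cw Nw]; split=> //; apply/AB => //;
  apply: contrapT => nG; apply: Nw; exact: GN.
Qed.

(* Split by the value l of lambda_n: by [good_reverse] the event lambda_n = l is
   an event about the past of the path shifted by l, and stationarity undoes the
   shift. *)
Lemma return_path_law n (A : set (paths int)) : measurable A ->
  P [set w | A (return_path n (sp w))] = P [set w | A (sp w)].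
Proof.
move=> mA.
(* The right-hand side still carries the restriction to good pasts. It is kept for arbitrary [C],
   because the whole space will be used to remove it. *)
have splitP (C : set (paths int)) : measurable C ->
    P [set w | C (return_path n (sp w))] =
    P [set w | good n (past (sp w)) /\ C (sp w)].
  move=> mC.
  pose E l : set (paths int) :=
    [set x | (good n (past x) /\ lam (past x) n = l) /\ C x].
  have mE l : measurable (E l).
    apply: measurable_conj => //; apply: measurable_conj.
      exact: measurable_good_past.
    exact: discrete_lam_past.
  rewrite (@probability_ae_eq _ [set w | good n (future (sp w)) /\
     C (return_path n (sp w))] _ _ _ good_ae); first last.
  - by move=> w g; split=> [|[]//] Cw; split=> //; exact: g.
  - apply: measurable_conj; first exact: measurable_path_event (measurable_good_future n).
    exact: measurable_returned.
  - exact: measurable_returned.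
  rewrite (_ : [set w | good n (future _) /\ _] =
    \bigcup_l [set w | E l (shift_path l%:Z (sp w))]); last first.
    apply/seteqP; split=> w /=.
      move=> [g Cw]; exists (lambda (sp w) n) => //; split; last exact: Cw.
      exact: (good_future_shift n _ (sp w)).1.
    move=> [l _ [/(good_future_shift n l (sp w)).2[g lE] Cw]]; split=> //.
    by rewrite /return_path lE.
  rewrite (_ : [set w | good n (past _) /\ _] = \bigcup_l [set w | E l (sp w)]); last first.
    apply/seteqP; split=> w /=; first by move=> [g Cw]; exists (lam (past (sp w)) n).
    by move=> [l _ [[]]].
  have mEs l : measurable [set w | E l (shift_path l%:Z (sp w))].
    exact: measurable_shifted.
  have mEl l : measurable [set w | E l (sp w)] by exact: measurable_path_event.
  rewrite !measure_semi_bigcup//; try exact: bigcupT_measurable.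
  - by apply: eq_eseriesr => l _; exact: (stX l%:Z (mE l)).
  - by apply/trivIsetP => i j _ _ ij; apply/seteqP; split=> // w [[[_ ii] _] [[_ jj] _]];
      by rewrite -ii -jj eqxx in ij.
  - apply/trivIsetP => i j _ _ ij; apply/seteqP; split=> // w.
    move=> [[/(good_future_shift n i (sp w)).2[_ ii] _]].
    move=> [/(good_future_shift n j (sp w)).2[_ jj] _].
    by rewrite -ii jj eqxx in ij.
rewrite splitP//.
have mgp : measurable [set w | good n (past (sp w))].
  exact: measurable_path_event (measurable_good_past n).
have mAs : measurable [set w | A (sp w)] by exact: measurable_path_event.
apply: (@probability_ae_eq _ _ [set w | good n (past (sp w))]) => //.
- exact: measurable_conj.
- exists (~` [set w | good n (past (sp w))]); split=> //; first exact: measurableC.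
  (* The case of the whole space: good pasts have probability 1. *)
  rewrite probability_setC//; have := splitP setT measurableT.
  rewrite (_ : [set w | setT _] = setT) ?probability_setT; last by apply/seteqP; split.
  rewrite (_ : [set w | _ /\ setT _] = [set w | good n (past (sp w))]); last first.
    by apply/seteqP; split=> w // [].
  by move=> <-; rewrite subee.
- by move=> w g; split=> [[]|].
Qed.

End stationary_process.

(** * The law of the limiting sequence *)

Section saturated_sets.
Context {R : realType}.
Local Notation npaths := (@paths R nat).

(* The events that depend on finitely many quantized coordinates form a
   pi-system generating the product sigma-algebra. *)
Definition saturated n (A : set (nat -> R)) :=
  forall x y, qagree n n x y -> A x -> A y.

Definition saturated_sets : set (set (nat -> R)) := [set A | exists n, saturated n A].

Lemma saturated_le n m A : (n <= m)%N -> saturated n A -> saturated m A.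
Proof. by move=> nm sA x y xy; apply: sA; exact: qagree_le xy. Qed.

Lemma saturated_setI : setI_closed saturated_sets.
Proof.
move=> A B [n sA] [m sB]; exists (maxn n m) => x y xy [Ax Bx]; split.
  exact: (saturated_le (leq_maxl n m) sA) Ax.
exact: (saturated_le (leq_maxr n m) sB) Bx.
Qed.

Lemma saturated_setT : saturated_sets setT.
Proof. by exists 0%N. Qed.

Lemma saturated_measurable (A : set npaths) : saturated_sets A -> measurable A.
Proof.
move=> [n sA]; pose g (x : npaths) := mkseq (fun i => qindex n (x i)) n.+1.
have mg : discrete_fun g.
  by apply: discrete_fun_map => i; apply: discrete_fun_qindex; exact: measurable_coord.
have gP x y : g x = g y -> qagree n n x y.
  move=> gxy i il; have : nth 0 (g x) i = nth 0 (g y) i by rewrite gxy.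
  by rewrite !nth_mkseq.
rewrite (_ : A = [set x | exists c, g x = c /\ exists2 y, A y & g y = c]).
  apply: measurable_exists => c; apply: measurable_conj; first exact: mg.
  exact: measurable_prop.
apply/seteqP; split=> x /=; first by move=> Ax; exists (g x); split=> //; exists x.
by move=> [c [xc [y Ay yc]]]; apply: sA Ay; apply: gP; rewrite yc xc.
Qed.

Lemma saturated_generates : @measurable _ npaths = <<s saturated_sets >>.
Proof.
apply/seteqP; split; last first.
  apply: smallest_sub; first exact: sigma_algebra_measurable.
  exact: saturated_measurable.
apply: smallest_sub; first exact: smallest_sigma_algebra.
move=> _ [i [B [mB ->]]].
pose S := g_sigma_algebraType saturated_sets.
have mc : measurable_fun setT (fun x : S => x i : R).
  (* A coordinate is the limit of its dyadic truncations. Level [n + i] rather than [n] ensures that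
     coordinate [i] is among those seen by a set saturated at that level. *)
  apply: (@measurable_fun_cvg _ _ _ _
    (fun n (x : S) => (qindex (n + i) (x i))%:~R * 2 ^- (n + i))).
    move=> n _ C mC; rewrite setTI; apply: sub_gen_smallest.
    exists (n + i)%N => x y xy /=; rewrite xy//; exact: leq_addl.
  move=> x _; apply/cvgrPdist_lt => e e0.
  near=> n; rewrite (@le_lt_trans _ _ (2 ^- n))//.
    have /cellP := erefl (qindex (n + i) (x i)).
    rewrite /cell/= intrD mulrDl mul1r => /andP[h1 h2].
    rewrite ger0_norm ?subr_ge0// lerBlDl (le_trans (ltW h2))// lerD2l.
    rewrite lef_pV2 ?posrE ?exprn_gt0// ler_eXn2l ?leq_addr// ltr1n//.
  near: n; have := @cvg_geometric R 1 2^-1; rewrite /geometric/=.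
  have h2 : `|2^-1| < 1 :> R by rewrite ger0_norm// invf_lt1 ?ltr1n.
  move=> /(_ h2)/cvgrPdist_lt/(_ _ e0); apply: filterS => n.
  by rewrite sub0r normrN mul1r ger0_norm ?exprn_ge0// exprVn.
have := mc measurableT B mB; rewrite setTI; exact.
Unshelve. all: by end_near. Qed.

End saturated_sets.

Section limit_past_law.
Context d (T : measurableType d) (R : realType) (P : probability T R).
Variable X : int -> {RV P >-> R}.
Hypothesis stX : stationary X.
Notation sp := (sample_path X).

(** By [return_path_law] the condition at time lambda_j has the probability that X_{-i} lies in an
    interval of length 2^-j with excluded right endpoint [r]. These intervals decrease to the empty
    set, so the probability tends to 0. *)
Lemma no_dyadic_increase (i k : nat) (m : int) :
  P.-negligible [set w | exists J : nat, forall j : nat, (J <= j)%N ->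
    m%:~R * 2 ^- k - 2 ^- j <= sp w ((lambda (sp w) j)%:Z - i%:Z) < m%:~R * 2 ^- k].
Proof.
apply: negligible_exists => J.
set r : R := m%:~R * 2 ^- k.
pose A j : set (@paths R int) := [set x | r - 2 ^- j <= x (- i%:Z) < r].
have mA j : measurable (A j).
  rewrite (_ : A j = [set x | `[r - 2 ^- j, r[%classic (x (- i%:Z))]).
    by rewrite -[X in measurable X]setTI; apply: measurable_coord.
  by apply/seteqP; split=> x /=; rewrite in_itv.
pose F j := [set w | A j (sp w)].
have mF j : measurable (F j) by exact: measurable_path_event.
have cF : P \o F @ \oo --> P (\bigcap_j F j).
  apply: nonincreasing_cvg_mu => //.
  - by rewrite ltey_eq fin_num_measure.
  - exact: bigcapT_measurable.
  - move=> a b ab; apply/subsetPset => w; rewrite /F/A/= => /andP[h ->]; rewrite andbT.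
    apply: le_trans h; rewrite lerB// lef_pV2 ?posrE ?exprn_gt0// ler_eXn2l// ltr1n//.
have F0 : \bigcap_j F j = set0.
  apply/seteqP; split=> // w h; have /andP[_ lt] := h 0%N Logic.I.
  have e0 : 0 < r - X (- i%:Z) w by rewrite subr_gt0.
  have [n _ hn] : \forall n \near \oo, 2 ^- n < r - X (- i%:Z) w.
    have := @cvg_geometric R 1 2^-1; rewrite /geometric/=.
    have h2 : `|2^-1| < 1 :> R by rewrite ger0_norm// invf_lt1 ?ltr1n.
    move=> /(_ h2)/cvgrPdist_lt/(_ _ e0); apply: filterS => n.
    by rewrite sub0r normrN mul1r ger0_norm ?exprn_ge0// exprVn.
  have := hn n (leqnn n); rewrite ltrBrDl -ltrBrDr => /= hX.
  by have /andP[+ _] := h n Logic.I; rewrite leNgt /sample_path hX.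
have mN j : measurable [set w | A j (return_path j (sp w))] by exact: measurable_returned.
exists (\bigcap_(j in [set j | (J <= j)%N]) [set w | A j (return_path j (sp w))]).
split.
- by apply: bigcap_measurable => //; exists J => /=.
- apply/eqP; rewrite eq_le measure_ge0 andbT.
  rewrite F0 measure0 in cF; rewrite -(cvg_lim _ cF)//; apply: lime_ge; first exact: cvgP cF.
  exists J => // j /= Jj; rewrite /F -(return_path_law stX j (mA j)).
  apply: le_measure; rewrite ?inE//; last exact: bigcap_inf.
  by apply: bigcap_measurable => //; exists J => /=.
- move=> w h j /= Jj.
  by have := h j Jj; rewrite /A /return_path /shift_path /= [- _ + _]addrC.
Qed.

Lemma regular_ae : {ae P, forall w, regular_path (sp w)}.
Proof.
have h : {ae P, forall w, forall ikm : nat * nat * int, ~ exists J : nat,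
    forall j : nat, (J <= j)%N ->
    ikm.2%:~R * 2 ^- ikm.1.2 - 2 ^- j <=
      sp w ((lambda (sp w) j)%:Z - ikm.1.1%:Z) < ikm.2%:~R * 2 ^- ikm.1.2}.
  apply: (@negligibleS _ _ _ _ [set w | exists ikm : nat * nat * int,
     exists J : nat, forall j : nat, (J <= j)%N ->
    ikm.2%:~R * 2 ^- ikm.1.2 - 2 ^- j <=
      sp w ((lambda (sp w) j)%:Z - ikm.1.1%:Z) < ikm.2%:~R * 2 ^- ikm.1.2]).
    by move=> w /= /existsNP[ikm /contrapT nc]; exists ikm.
  by apply: negligible_exists => -[[i k] m]; exact: no_dyadic_increase.
apply: filterS2 (good_ae stX) h => w h1 h2; split=> // i k m.
exact: (h2 (i, k, m)).
Qed.

(** [limit_past] is only controlled where the limits exist. Multiplying by the indicator of a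
    measurable set of regular paths gives a random variable equal to it almost surely. *)
Lemma limit_past_version : exists L : {mfun T >-> @paths R nat},
  {ae P, forall w, regular_path (sp w) /\ limit_past (sp w) = L w}.
Proof.
have [N [mN PN rN]] := regular_ae; pose G := ~` N.
have mG : measurable G by exact: measurableC.
have rG w : G w -> regular_path (sp w).
  by move=> Gw; apply: contrapT => nr; apply: Gw; exact: rN.
pose u w i j := \1_G w * sp w ((lambda (sp w) j)%:Z - i%:Z) : R.
have cu w i : u w i @ \oo --> limn (u w i).
  rewrite /u indicE; case: (boolP (w \in G)) => /= wG.
    under eq_fun do rewrite mul1r.
    exact: cvgP (limit_past_cvg (rG _ (set_mem wG)) (i := i)).
  by under eq_fun do rewrite mul0r; exact: is_cvg_cst.
have mL : measurable_fun setT (fun w => (fun i => limn (u w i)) : @paths R nat).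
  apply: measurable_pathsP => // i.
  apply: (@measurable_fun_cvg _ _ _ _ (fun j w => u w i j)) => [j|w _]; last exact: cu.
  apply: measurable_funM; first exact: measurable_indic.
  have mr := measurableT_comp (measurable_return_path j) (measurable_sample_path X).
  have := measurable_fun_coord (- i%:Z) mr.
  by rewrite /return_path /shift_path /comp; under eq_fun do rewrite addrC.
exists (to_mfun mL), N; split=> // w /= nw; apply: contrapT => Gw.
apply: nw; split; first exact: rG.
apply/funext => i; rewrite /limit_past /u indicE mem_set//.
by under [in RHS]eq_fun do rewrite mul1r.
Qed.

Definition past_rv : {mfun T >-> @paths R nat} :=
  to_mfun (measurableT_comp measurable_past (measurable_sample_path X)).

Definition return_past_rv n : {mfun T >-> @paths R nat} :=
  to_mfun (measurableT_comp measurable_past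
    (measurableT_comp (measurable_return_path n) (measurable_sample_path X))).

(** On a set saturated at level [n] the limiting sequence cannot be told from the past seen at
    lambda_n, and that past has the law of the past itself. *)
Lemma limit_past_law (L : {mfun T >-> @paths R nat}) :
  {ae P, forall w, regular_path (sp w) /\ limit_past (sp w) = L w} ->
  forall A, measurable A -> distribution P L A = distribution P past_rv A.
Proof.
move=> aeL A; rewrite saturated_generates.
apply: (@dynkin_induction _ _ _ (fun A => distribution P L A = distribution P past_rv A)
  saturated_generates (@saturated_setI R)).
- by rewrite !probability_setT.
- move=> {}A [n sA]; have mA : measurable A by apply: saturated_measurable; exists n.
  rewrite /distribution /pushforward.
  transitivity (P (return_past_rv n @^-1` A)).
    apply: (probability_ae_eq _ _ aeL).
    + exact: measurable_funPTI.
    + exact: measurable_funPTI.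
    move=> w [rw Lw]; have ag := limit_past_agree rw (n := n).
    have ag' := qagree_le (leqnn n) (lambda_ge rw n) ag.
    by split=> /=; rewrite -Lw; apply: sA; [exact: qagree_sym|exact: ag'].
  have := return_path_law stX n (measurable_preimageT measurable_past mA); exact.
- by move=> S mS hS; rewrite !probability_setC//; congr (_ - _)%E; exact: hS.
- move=> F mF tF hF; rewrite !measure_semi_bigcup//; try exact: bigcupT_measurable.
  by apply: eq_eseriesr => i _; exact: hF.
Qed.

Lemma limit_past_ae (Q : (nat -> R) -> Prop) :
  {ae distribution P past_rv, forall y, Q y} ->
  {ae P, forall w, Q (limit_past (sp w))}.
Proof.
move=> [N [mN PN QN]]; have [L aeL] := limit_past_version.
have : {ae P, forall w, ~ N (L w)}.
  exists (L @^-1` N); split; first exact: measurable_funPTI.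
    by have := limit_past_law aeL mN; rewrite PN.
  by move=> w /= /contrapT.
apply: filterS2 aeL => w [_ ->] nN; apply: contrapT => nQ; apply: nN; exact: QN.
Qed.

End limit_past_law.

Section integration_and_laws.
Context d d' (T : measurableType d) (Y : measurableType d') (R : realType).
Variable P : probability T R.
Implicit Types (F : {mfun T >-> Y}) (h : Y -> R).

Lemma integrable_distribution F h : measurable_fun setT h ->
  P.-integrable setT (EFin \o (fun w => h (F w))) ->
  (distribution P F).-integrable setT (EFin \o h).
Proof.
by move=> mh ih; apply: integrable_pushforward => //; exact/measurable_EFinP.
Qed.

Lemma Rintegral_distribution F h A : measurable A -> measurable_fun setT h ->
  P.-integrable setT (EFin \o (fun w => h (F w))) ->
  \int[distribution P F]_(y in A) h y = \int[P]_(w in F @^-1` A) h (F w).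
Proof.
move=> mA mh ih; congr fine; rewrite integral_pushforward//.
  exact/measurable_EFinP.
by apply: EFin_integrableS ih; exact: measurable_funPTI.
Qed.

Lemma square_integrable_distribution F h : measurable_fun setT h ->
  square_integrable P (fun w => h (F w)) -> square_integrable (distribution P F) h.
Proof.
by move=> mh [_ h2]; split=> //; apply: integrable_distribution => //; exact: measurable_funX.
Qed.

Lemma same_law_Rintegral (mu nu : probability Y R) h A :
  (forall B, measurable B -> mu B = nu B) -> measurable A ->
  \int[mu]_(y in A) h y = \int[nu]_(y in A) h y.
Proof.
by move=> mn mA; congr fine; apply: eq_measure_integral => B mB _; exact: mn.
Qed.

Lemma same_law_integrable (mu nu : probability Y R) h :
  (forall B, measurable B -> mu B = nu B) ->
  mu.-integrable setT (EFin \o h) -> nu.-integrable setT (EFin \o h).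
Proof.
move=> mn /integrableP[mh fh]; apply/integrableP; split=> //.
by rewrite (@eq_measure_integral _ _ _ setT mu)// => B mB _; apply/esym; exact: mn.
Qed.

Lemma ae_eq_Rintegral (g h : T -> R) : measurable_fun setT g ->
  measurable_fun setT h -> {ae P, forall w, g w = h w} ->
  \int[P]_w g w = \int[P]_w h w.
Proof.
move=> mg mh gh; congr fine; apply: ae_eq_integral => //; try exact/measurable_EFinP.
by apply: filterS gh => w -> _.
Qed.

Lemma ae_eq_EFin_integrable (g h : T -> R) : measurable_fun setT h ->
  {ae P, forall w, g w = h w} ->
  P.-integrable setT (EFin \o g) -> P.-integrable setT (EFin \o h).
Proof.
move=> mh gh /integrableP[mg fg]; apply/integrableP; split; first exact/measurable_EFinP.
apply: le_lt_trans fg; rewrite le_eqVlt; apply/orP; left; apply/eqP.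
apply: ae_eq_integral => //; try by apply: measurableT_comp => //; exact/measurable_EFinP.
by apply: filterS gh => w /= -> _.
Qed.

Lemma ae_eq_square_integrable (g h : T -> R) : measurable_fun setT h ->
  {ae P, forall w, g w = h w} -> square_integrable P g -> square_integrable P h.
Proof.
move=> mh gh [mg g2]; split=> //.
apply: ae_eq_EFin_integrable g2; first exact: measurable_funX.
by apply: filterS gh => w ->.
Qed.

End integration_and_laws.

Lemma cvg_cesaro0 (R : realType) (u : nat -> R) (l : R) : u @ \oo --> l ->
  (fun n => n%:R^-1 * \sum_(0 <= j < n) u j) @ \oo --> l.
Proof. by move=> ul; rewrite -(cvg_shiftS _); exact: cesaro ul. Qed.

Lemma cvg_geometric_half (R : realType) : (fun n => 2 ^- n : R) @ \oo --> (0 : R).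
Proof.
have := @cvg_geometric R 1 2^-1; rewrite /geometric/=.
have h2 : `|2^-1| < 1 :> R by rewrite ger0_norm// invf_lt1 ?ltr1n.
by move=> /(_ h2); under eq_fun do rewrite mul1r exprVn.
Qed.

(** * The estimates *)

Section intermittent_estimation.
Context d (T : measurableType d) (R : realType) (P : probability T R).
Variable X : int -> {RV P >-> R}.
Hypothesis stX : stationary X.
Notation sp := (sample_path X).
Notation past_rv := (past_rv X).
Notation mu := (distribution P past_rv).

Definition path_rv : {mfun T >-> @paths R int} := to_mfun (measurable_sample_path X).

Definition return_path_rv n : {mfun T >-> @paths R int} :=
  to_mfun (measurableT_comp (measurable_return_path n) (measurable_sample_path X)).

Lemma return_path_rv_law n (B : set (@paths R int)) : measurable B ->
  distribution P (return_path_rv n) B = distribution P path_rv B.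
Proof. exact: return_path_law. Qed.

Lemma shift_rv_law h (B : set (@paths R int)) : measurable B ->
  distribution P (to_mfun (measurableT_comp (measurable_shift_path h)
    (measurable_sample_path X))) B = distribution P path_rv B.
Proof. exact: stX. Qed.

Hypothesis EX2 : ('E_P[fun w => (`|X 0 w| ^+ 2)%R] < +oo)%E.

Lemma square_integrable_coord i : square_integrable P (X i).
Proof.
have X02 : square_integrable P (X 0).
  split=> //; apply/integrableP; split.
    by apply/measurable_EFinP; exact: measurable_funX.
  move: EX2; rewrite unlock; apply: le_lt_trans.
  by under eq_integral do rewrite /= normrX.
pose h (x : @paths R int) : R := x 0.
have h2 : square_integrable (distribution P path_rv) h.
  by apply: square_integrable_distribution => //; exact: measurable_coord.
split=> //.
have := same_law_integrable (fun B mB => esym (shift_rv_law i mB)) h2.2.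
move=> /integrableP[_ fin]; apply/integrableP; split.
  by apply/measurable_EFinP; exact: measurable_funX.
move: fin; rewrite ge0_integral_pushforward//=.
- by rewrite preimage_setT /h /comp/= /shift_path /sample_path add0r.
- exact: measurableT_comp (measurable_shift_path i) (measurable_sample_path X).
- apply/measurable_EFinP; apply: measurableT_comp => //.
  by apply: measurable_funX; exact: measurable_coord.
Qed.

Lemma integrable_coord i : P.-integrable setT (EFin \o X i).
Proof. exact/square_integrable_integrable/square_integrable_coord. Qed.

Lemma next_value_return n w : next_value (sp w) n = return_path n (sp w) 1.
Proof. by rewrite /next_value /return_path /shift_path intS. Qed.

Lemma measurable_next_value n : measurable_fun setT (fun w => next_value (sp w) n).
Proof.
under eq_fun do rewrite next_value_return.
exact: (measurable_fun_coord 1 (measurable_funPT (return_path_rv n))).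
Qed.

Lemma measurable_coord1 : measurable_fun setT (fun x : @paths R int => x 1).
Proof. exact: measurable_coord. Qed.

Lemma square_integrable_next_value n :
  square_integrable P (fun w => next_value (sp w) n).
Proof.
split; first exact: measurable_next_value.
have h2 := square_integrable_distribution (F := path_rv) measurable_coord1
  (square_integrable_coord 1).
have := same_law_integrable (fun B mB => esym (return_path_rv_law n mB)) h2.2.
move=> /integrableP[_ fin]; apply/integrableP; split.
  by apply/measurable_EFinP; apply: measurable_funX; exact: measurable_next_value.
move: fin; rewrite ge0_integral_pushforward//=.
- exact: measurableT_comp (measurable_return_path n) (measurable_sample_path X).
- apply/measurable_EFinP; apply: measurableT_comp => //.
  by apply: measurable_funX; exact: measurable_coord1.
Qed.

Lemma integrable_next_value n :
  P.-integrable setT (EFin \o (fun w => next_value (sp w) n)).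
Proof. exact/square_integrable_integrable/square_integrable_next_value. Qed.

Lemma Rintegral_next_value n (h : R -> R) (A : set (@paths R int)) : measurable A ->
  measurable_fun setT h ->
  P.-integrable setT (EFin \o (fun w => h (X 1 w))) ->
  P.-integrable setT (EFin \o (fun w => h (next_value (sp w) n))) ->
  \int[P]_(w in [set w | A (return_path n (sp w))]) h (next_value (sp w) n) =
  \int[P]_(w in [set w | A (sp w)]) h (X 1 w).
Proof.
move=> mA mh i1 i2.
have mh1 : measurable_fun setT (fun x : @paths R int => h (x 1)).
  exact: measurableT_comp mh measurable_coord1.
under eq_Rintegral do rewrite next_value_return.
rewrite -(Rintegral_distribution (F := return_path_rv n) (h := fun x => h (x 1)) mA mh1).
  rewrite -(Rintegral_distribution (F := path_rv) (h := fun x => h (x 1)) mA mh1)//.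
  by apply: same_law_Rintegral mA => B; exact: return_path_rv_law.
by move: i2; under eq_fun do rewrite next_value_return.
Qed.

Definition regression (e : (nat -> R) -> R) :=
  [/\ measurable_fun setT (e : @paths R nat -> R),
    P.-integrable setT (EFin \o (fun w => e (past (sp w)))) &
    forall A : set (@paths R nat), measurable A ->
      \int[P]_(w in [set w | A (past (sp w))]) e (past (sp w)) =
      \int[P]_(w in [set w | A (past (sp w))]) X 1 w].

Lemma cond_mean_regression e : is_cond_mean X e -> regression e.
Proof.
move=> [me [ie _ he]]; split=> //.
  by move=> _ B mB; rewrite setTI; exact: me.
move=> A mA; congr fine; apply: he; exists A => //.
by rewrite setTI.
Qed.

Lemma cond_mean_exists : exists e, is_cond_mean X e.
Proof.
have [e [me _ ie he]] := regression_exists past_rv (integrable_coord 1).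
exists e; split.
  by move=> B mB; have := me measurableT B mB; rewrite setTI.
split=> //.
- move=> B mB; exists (e @^-1` B); last by rewrite setTI.
  by have := me measurableT B mB; rewrite setTI.
- move=> _ [A mA <-]; rewrite setTI; have [_ h] := he A mA.
  have mA' : measurable (past_rv @^-1` A) by exact: measurable_funPTI.
  rewrite (EFin_Rintegral mA' ie) (EFin_Rintegral mA' (integrable_coord 1)).
  apply: (congr1 EFin); exact: h.
Qed.

(** The martingale results above take partitions labelled by natural numbers. *)
Definition atom n (y : nat -> R) : nat := pickle (past_code n y).

Lemma atomP n y z : atom n y = atom n z <-> past_code n y = past_code n z.
Proof.
split=> [|h]; last by rewrite /atom h.
exact: (pcan_inj (@pickleK _)).
Qed.

Lemma discrete_atom n : discrete_fun (atom n : @paths R nat -> nat).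
Proof.
apply: discrete_fun_comp; apply: discrete_fun_past_code => i.
exact: measurable_coord.
Qed.

Lemma atom_refine n y z : atom n.+1 y = atom n.+1 z -> atom n y = atom n z.
Proof. by move=> /atomP h; apply/atomP; exact: code_refine h. Qed.

Section regression_function.
Variable e : (nat -> R) -> R.
Hypothesis re : regression e.

Let me : measurable_fun setT (e : @paths R nat -> R). Proof. by case: re. Qed.

Lemma integrable_regression : mu.-integrable setT (EFin \o e).
Proof. by apply: integrable_distribution => //; case: re. Qed.

Lemma Rintegral_regression (A : set (@paths R nat)) : measurable A ->
  \int[mu]_(y in A) e y = \int[P]_(w in past_rv @^-1` A) X 1 w.
Proof.
by move=> mA; have [_ ie he] := re; rewrite Rintegral_distribution// -he.
Qed.

Definition atom_mean n := partition_exp mu (atom n) e.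

Lemma atom_mean_past n w : atom_mean n (past (sp w)) =
  partition_exp P (fun w => atom n (past (sp w))) (X 1) w.
Proof.
by rewrite /atom_mean /partition_exp Rintegral_regression//; exact: discrete_atom.
Qed.

Let discrete_atom_past n : discrete_fun (fun w => atom n (past (sp w))).
Proof.
move=> c; apply: (@measurable_path_event _ _ _ _ X [set x | atom n (past x) = c]).
exact: (measurable_preimageT measurable_past (discrete_atom n c)).
Qed.

Lemma measurable_atom_mean n : measurable_fun setT (atom_mean n : @paths R nat -> R).
Proof. exact: measurable_partition_exp (discrete_atom n). Qed.

Lemma square_integrable_atom_mean n : square_integrable mu (atom_mean n).
Proof.
apply: square_integrable_distribution; first exact: measurable_atom_mean.
under [X in square_integrable P X]eq_fun do rewrite atom_mean_past.
apply: square_integrable_partition_exp => //; first exact: integrable_coord.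
exact: square_integrable_coord.
Qed.

Lemma atom_mean_L2 n : \int[mu]_y (atom_mean n y ^+ 2) <= \int[P]_w (X 1 w ^+ 2).
Proof.
have m2 : square_integrable P (fun w => atom_mean n (past (sp w))).
  under [X in square_integrable P X]eq_fun do rewrite atom_mean_past.
  apply: square_integrable_partition_exp => //; first exact: integrable_coord.
  exact: square_integrable_coord.
rewrite (Rintegral_distribution (F := past_rv) (h := fun y => atom_mean n y ^+ 2))//.
- rewrite preimage_setT; under eq_Rintegral do rewrite atom_mean_past.
  apply: partition_exp_L2 => //; first exact: integrable_coord.
  exact: square_integrable_coord.
- by apply: measurable_funX; exact: measurable_atom_mean.
- exact: m2.2.
Qed.

(** Levy's theorem applies because the code of level [n] shows the first [n.+1] coordinates at that
    level, so every saturated set is a union of atoms of some level. *)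
Lemma atom_mean_cvg : {ae mu, forall y, atom_mean ^~ y @ \oo --> e y}.
Proof.
apply: (levy_upward discrete_atom atom_refine integrable_regression
  square_integrable_atom_mean atom_mean_L2 saturated_generates (@saturated_setI R)
  (saturated_setT (R := R))).
move=> A [n sA]; exists n => x y /atomP/codeP[_ xy]; apply: sA.
exact: qagree_le (leq_maxr _ _) xy.
Qed.

Variable f : nat -> set R -> R.
Hypothesis hf : is_selector f.

Let V := return_value f.

Lemma return_value_atom n x y : atom n.+1 x = atom n.+1 y -> V n x = V n y.
Proof.
move=> /atomP/codeP[hl xy]; rewrite /V /return_value -!hl//.
congr (f n _); apply/quantP/(@qindex_le _ _ n.+1) => //; apply: xy.
by rewrite leq_max (leq_trans (leq_subr _ _))// leq_subr.
Qed.

Lemma measurable_return_value n : measurable_fun setT (V n : @paths R nat -> R).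
Proof. exact: measurable_fiberwise (discrete_atom n.+1) (@return_value_atom n). Qed.

Let g n w := f n (quant n (next_value (sp w) n)).

Let measurable_fq n : measurable_fun setT (fun x : R => f n (quant n x)).
Proof.
apply: (@measurable_discrete_comp _ _ _ _ _ (qindex n) (fun i => f n (cell n i))).
by apply: discrete_fun_qindex; exact: measurable_id.
Qed.

Let mg n : measurable_fun setT (g n).
Proof. exact: measurableT_comp (measurable_fq n) (measurable_next_value n). Qed.

Let g_dist n w : `|g n w - next_value (sp w) n| <= 2 ^- n.
Proof. exact/ltW/selector_dist. Qed.

Let pow2_le1 n : 2 ^- n <= 1 :> R.
Proof. by rewrite invf_le1 ?exprn_gt0// exprn_ege1// ler1n. Qed.

Let g_bound n w : g n w ^+ 2 <= 2 * next_value (sp w) n ^+ 2 + 2.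
Proof.
have := le_trans (g_dist n w) (pow2_le1 n); rewrite ler_norml => /andP[h1 h2].
set a := next_value _ _ in h1 h2 *; set b := g n w in h1 h2 *.
have : (b - a) ^+ 2 <= 1 by nra.
by have := sqr_ge0 (a + a - b); nra.
Qed.

Let i_bound n : P.-integrable setT (EFin \o (fun w => 2 * next_value (sp w) n ^+ 2 + 2)).
Proof.
apply: EFin_integrableD; last exact: finite_measure_integrable_cst.
exact/EFin_integrableZ/(square_integrable_next_value n).2.
Qed.

Let g2 n : square_integrable P (g n).
Proof.
split=> //; apply: dominated_integrable (i_bound n); first exact: measurable_funX.
by move=> w; rewrite ger0_norm ?sqr_ge0.
Qed.

Let gK n : \int[P]_w (g n w ^+ 2) <= 2 * \int[P]_w (X 1 w ^+ 2) + 2.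
Proof.
apply: (@le_trans _ _ (\int[P]_w (2 * next_value (sp w) n ^+ 2 + 2))).
  by apply: ge0_Rintegral_le => //; exact: (g2 n).2.
have i2 := (square_integrable_next_value n).2.
rewrite (RintegralD measurableT (EFin_integrableZ 2 i2)
  (finite_measure_integrable_cst P 2 measurableT)).
rewrite (RintegralZl _ measurableT i2) Rintegral_probability_cst.
rewrite lerD2r ler_wpM2l// le_eqVlt; apply/orP; left; apply/eqP.
apply: (@Rintegral_next_value n (fun x => x ^+ 2) setT) => //.
exact: (square_integrable_coord 1).2.
Qed.

Lemma return_value_ae (L : {mfun T >-> @paths R nat}) n :
  {ae P, forall w, regular_path (sp w) /\ limit_past (sp w) = L w} ->
  {ae P, forall w, g n w = V n (L w)}.
Proof.
apply: filterS => w [rw <-]; rewrite /g /V /return_value !limit_past_lambda//.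
congr (f n _); apply/quantP; apply/esym/(@qindex_le _ _ n.+1) => //.
have lj := lambda_ltS rw n.
rewrite limit_past_qindex//; last by lia.
by rewrite /next_value; congr (qindex _ (sp w _)); lia.
Qed.

Lemma square_integrable_return_value n : square_integrable mu (V n).
Proof.
have [L aeL] := limit_past_version stX.
have mV := measurable_return_value n.
have VL2 : square_integrable P (fun w => V n (L w)).
  apply: ae_eq_square_integrable (return_value_ae n aeL) (g2 n).
  exact: measurableT_comp mV (measurable_funPT L).
have := square_integrable_distribution mV VL2 => -[_ iV]; split=> //.
by apply: same_law_integrable iV => B mB; exact: limit_past_law.
Qed.

Lemma return_value_L2 n :
  \int[mu]_y (V n y ^+ 2) <= 2 * \int[P]_w (X 1 w ^+ 2) + 2.
Proof.
have [L aeL] := limit_past_version stX.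
have mV := measurable_return_value n.
have mVL := measurableT_comp mV (measurable_funPT L).
have aeV := return_value_ae n aeL.
have VL2 := ae_eq_square_integrable mVL aeV (g2 n).
rewrite -(same_law_Rintegral _ (limit_past_law stX aeL))//.
rewrite (Rintegral_distribution measurableT (measurable_funX 2 mV) VL2.2).
rewrite preimage_setT (le_trans _ (gK n))// le_eqVlt; apply/orP; left; apply/eqP.
apply: ae_eq_Rintegral; [exact: measurable_funX mVL|exact: measurable_funX|].
by apply: filterS aeV => w ->.
Qed.

(** Both integrals over an atom move to the event that the past seen at lambda_n lies in it: that of
    [e] by the law of the returned path, that of [V n] because the limiting sequence and this past
    have the same code. There the integrands are X_{lambda_n+1} and its quantization, at distance at
    most 2^-n. *)
Lemma return_value_atom_mean n y :
  `|partition_exp mu (atom n) (V n) y - atom_mean n y| <= 2 ^- n.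
Proof.
have [L aeL] := limit_past_version stX.
have mV := measurable_return_value n.
have mVL := measurableT_comp mV (measurable_funPT L).
have aeV := return_value_ae n aeL.
have VL2 := ae_eq_square_integrable mVL aeV (g2 n).
rewrite /atom_mean /partition_exp; set C := [set z | _].
have mC : measurable (C : set (@paths R nat)) by exact: discrete_atom.
pose D := [set w | C (past (return_path n (sp w)))].
have mC' := measurable_preimageT measurable_past mC.
have mD : measurable D by exact: (measurable_returned X n mC').
have bE : \int[mu]_(z in C) e z = \int[P]_(w in D) next_value (sp w) n.
  rewrite Rintegral_regression//; apply/esym.
  apply: (@Rintegral_next_value n id _ mC') => //; first exact: integrable_coord.
  exact: integrable_next_value.
have aE : \int[mu]_(z in C) V n z = \int[P]_(w in D) g n w.
  rewrite -(same_law_Rintegral _ (limit_past_law stX aeL))//.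
  rewrite (Rintegral_distribution mC mV (square_integrable_integrable VL2)).
  rewrite (Rintegral_indic P (L @^-1` C)) (Rintegral_indic P D).
  apply: ae_eq_Rintegral.
  - by apply: measurable_funM => //; apply: measurable_indic; exact: measurable_funPTI.
  - by apply: measurable_funM => //; exact: measurable_indic.
  apply: filterS2 aeL aeV => w [rw Lw] ->; congr (_ * _).
  rewrite !indicE; congr (nat_of_bool _)%:R; apply/idP/idP; rewrite !inE /D /C /= -Lw;
    by rewrite /atom (limit_past_code rw n).
have PD : P D = mu C by exact: (return_path_law stX n mC').
rewrite -mulrBl normrM aE bE.
have iN := integrable_next_value n.
have ig := square_integrable_integrable (g2 n).
have ign := EFin_integrableB ig iN.
rewrite -(RintegralB mD (EFin_integrableS mD ig) (EFin_integrableS mD iN)).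
have : `|\int[P]_(w in D) (g n w - next_value (sp w) n)| <= 2 ^- n * fine (mu C).
  apply: le_trans (le_normr_Rintegral mD (EFin_integrableS mD ign)) _.
  rewrite -PD -Rintegral_cst//.
  apply: (le_Rintegral mD (EFin_integrableS mD (integrable_abse ign))
    (EFin_integrableS mD (finite_measure_integrable_cst P _ measurableT))) => w _.
  exact: g_dist.
move: (fine_ge0 (measure_ge0 mu C)); move: (fine (mu C)) => p p0 h.
(* On a null atom both means are 0 by the convention on division. *)
have [->|pn] := eqVneq p 0; first by rewrite invr0 normr0 mulr0.
have pp : 0 < p by rewrite lt_neqAle eq_sym pn.
by rewrite normfV (ger0_norm p0) ler_pdivrMr.
Qed.

(** The strong law replaces each summand by its conditional mean given the previous code; these
    means are within 2^-n of [atom_mean n], which tends to [e], and Cesaro averaging keeps the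
    limit. *)
Lemma return_value_mean_cvg : {ae mu, forall y,
  (fun n => n%:R^-1 * \sum_(0 <= j < n) V j y) @ \oo --> e y}.
Proof.
have slln := partition_strong_law discrete_atom atom_refine return_value_atom
  square_integrable_return_value return_value_L2.
apply: filterS2 slln atom_mean_cvg => y h1 h2.
pose E j := partition_exp mu (atom j) (V j) y.
have Ee : E @ \oo --> e y.
  have h3 : (fun n => E n - atom_mean n y) @ \oo --> (0 : R).
    apply/cvgrPdist_le => t t0; have /cvgrPdist_le/(_ _ t0) := @cvg_geometric_half R.
    apply: filterS => n; rewrite !sub0r !normrN ger0_norm ?invr_ge0 ?exprn_ge0//.
    exact: (le_trans (return_value_atom_mean n y)).
  have h5 : (fun n => (E n - atom_mean n y) + atom_mean n y) @ \oo --> 0 + e y.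
    exact: cvgD.
  rewrite add0r in h5; apply: cvg_trans h5; apply: near_eq_cvg.
  by apply: nearW => n; rewrite subrK.
have h4 : (fun n => n%:R^-1 * \sum_(0 <= j < n) (V j y - E j) +
    n%:R^-1 * \sum_(0 <= j < n) E j) @ \oo --> 0 + e y.
  by apply: cvgD => //; exact: cvg_cesaro0.
rewrite add0r in h4; apply: cvg_trans h4; apply: near_eq_cvg; apply: nearW => n.
rewrite -mulrDr -big_split/=; congr (_ * _); apply: eq_bigr => j _.
by rewrite subrK.
Qed.

Lemma estimate_cvg : {ae P, forall w,
  estimate f (sp w) n @[n --> \oo] --> e (limit_past (sp w)) /\
  atom_mean n (limit_past (sp w)) @[n --> \oo] --> e (limit_past (sp w))}.
Proof.
have h : {ae mu, forall y : @paths R nat,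
    (fun n => n%:R^-1 * \sum_(0 <= j < n) V j y) @ \oo --> e y /\
    atom_mean ^~ y @ \oo --> e y}.
  exact: (@filterS2 _ _ (ae_filter_ringOfSetsType mu) _ _ _ (fun y => @conj _ _)
    return_value_mean_cvg atom_mean_cvg).
apply: filterS2 (limit_past_ae stX h) (regular_ae stX) => w [h1 h2] rw.
by split=> //; under eq_fun do rewrite (estimate_limit_past rw).
Qed.

End regression_function.

End intermittent_estimation.

(** * Conditional expectations at the return times *)

Section conditional_expectations.
Context d (T : measurableType d) (R : realType) (P : probability T R).

Lemma cond_expP (G0 : set (set T)) (Z : T -> R) : <<s G0 >> `<=` measurable ->
  P.-integrable setT (EFin \o Z) -> is_cond_exp P <<s G0 >> Z (cond_exp P <<s G0 >> Z).
Proof.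
move=> Gm iZ.
suff [Y hY] : exists Y, is_cond_exp P <<s G0 >> Z Y.
  exact: (@xgetPex _ (cst 0) [set Y | is_cond_exp P <<s G0 >> Z Y] (ex_intro _ Y hY)).
pose S := g_sigma_algebraType G0.
have mid : measurable_fun setT (id : T -> S).
  by move=> _ A mA; rewrite setTI; exact: Gm.
have [Y [mY _ iY hY]] := regression_exists (to_mfun mid) iZ.
exists Y; split=> //.
  by move=> B mB; have := mY measurableT B mB; rewrite setTI.
move=> A GA; have [_ h] := hY A GA; have mA := Gm _ GA.
by rewrite (EFin_Rintegral mA iY) (EFin_Rintegral mA iZ); apply: (congr1 EFin); exact: h.
Qed.

Lemma ae_forall (C : countType) (Q : C -> T -> Prop) :
  (forall c, {ae P, forall w, Q c w}) -> {ae P, forall w, forall c, Q c w}.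
Proof.
move=> hQ; apply: (@negligibleS _ _ _ _ [set w | exists c, ~ Q c w]).
  by move=> w /= /existsNP.
exact: negligible_exists.
Qed.

Lemma probability1_ae (A : set T) : measurable A -> P A = 1%E -> {ae P, forall w, A w}.
Proof.
move=> mA PA; exists (~` A); split=> //; first exact: measurableC.
by rewrite probability_setC// PA subee.
Qed.

Lemma Rintegral_le0_null (E : set T) (h : T -> R) : measurable E ->
  P.-integrable setT (EFin \o h) -> (forall w, E w -> 0 < h w) ->
  \int[P]_(w in E) h w <= 0 -> P.-negligible E.
Proof.
move=> mE ih h0 le0.
have mh : measurable_fun E (EFin \o h).
  by apply: measurable_funTS; exact: measurable_int ih.
have : (\int[P]_(w in E) `|(EFin \o h) w| = 0)%E.
  apply/eqP; rewrite eq_le integral_ge0// andbT.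
  rewrite (eq_integral (EFin \o h)); last first.
    by move=> w; rewrite inE => Ew; rewrite /= ger0_norm// ltW// h0.
  by rewrite /comp (EFin_Rintegral mE ih) lee_fin.
move=> /(ae_eq_integral_abs P mE mh); apply: negligibleS => w Ew /= /(_ Ew)[hw].
by have := h0 _ Ew; rewrite hw ltxx.
Qed.

End conditional_expectations.

Section conditioning_at_returns.
Context d (T : measurableType d) (R : realType) (P : probability T R).
Variable X : int -> {RV P >-> R}.
Notation sp := (sample_path X).
Notation past_at n w := (past (return_path n (sp w))).

(** The generating family inside [vector_sigma], named so that the general measurability lemmas can
    be applied on the space it generates. *)
Definition returns_generator (V : Type) (E : set (set V)) n (Z : nat -> T -> V) :=
  [set A | exists (l i : nat) (B : set V),
     [/\ (i <= l)%N, E B & A = [set w | lambda (sp w) n = l /\ B (Z i w)]]].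

Notation quantized_sigma n := (vector_sigma setT (fun w => lambda (sp w) n)
  (fun i w => quant n (X i w))).
Notation full_sigma n := (vector_sigma (@measurable _ R) (fun w => lambda (sp w) n)
  (fun i w => X i w)).

Lemma discrete_lambda_path n : discrete_fun (fun w => lambda (sp w) n).
Proof.
by move=> l; exact: measurable_path_event (discrete_lambda n l).
Qed.

Lemma quantized_sigma_measurable n : quantized_sigma n `<=` measurable.
Proof.
apply: smallest_sub; first exact: sigma_algebra_measurable.
move=> _ [l [i [B [il _ ->]]]]; apply: measurable_conj; first exact: discrete_lambda_path.
apply: (@discrete_fun_pred _ _ _ (fun w => qindex n (X i w)) (fun c => B (cell n c))).
exact: discrete_fun_qindex.
Qed.

Lemma full_sigma_measurable n : full_sigma n `<=` measurable.
Proof.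
apply: smallest_sub; first exact: sigma_algebra_measurable.
move=> _ [l [i [B [il mB ->]]]]; apply: measurable_conj; first exact: discrete_lambda_path.
exact: measurable_funPTI.
Qed.

Lemma past_at_coord n w i : (i <= lambda (sp w) n)%N ->
  past_at n w (lambda (sp w) n - i)%N = X i w.
Proof.
move=> il; rewrite /past /return_path /shift_path -[RHS]/(sp w i).
by congr (sp w _); lia.
Qed.

(** The atom of the quantized block through [w0], written as an intersection over [i] of generators
    of the quantized sigma-algebra; these also belong to the exact one, because cells are Borel
    sets. *)
Definition block_event n w0 : set T := [set w | forall i : nat,
  (i <= lambda (sp w0) n)%N -> lambda (sp w) n = lambda (sp w0) n /\
    quant n (X i w) = quant n (X i w0)].

Lemma block_eventP n w w0 : regular_path (sp w) -> regular_path (sp w0) ->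
  block_event n w0 w <-> atom n (past_at n w) = atom n (past_at n w0).
Proof.
move=> rw rw0; rewrite atomP codeP.
have [g gl] := good_past_shift rw n; have [g0 gl0] := good_past_shift rw0 n.
rewrite /return_path !gl; split.
  move=> h; have [lE _] := h 0%N (leq0n _).
  have ag : qagree n (lambda (sp w) n) (past_at n w) (past_at n w0).
    move=> i il; have il' : (lambda (sp w) n - i <= lambda (sp w) n)%N by exact: leq_subr.
    have := h _ (leq_trans il' _); rewrite lE leqnn => /(_ isT)[_ /quantP].
    rewrite -(@past_at_coord n w); last by rewrite lE leq_subr.
    rewrite -(@past_at_coord n w0) ?leq_subr//.
    by rewrite lE subKn// -lE.
  rewrite (maxn_idPl (lambda_ge rw n)); split=> // k kn.
  have [|_ ->//] := @good_local _ n _ (past_at n w0) g.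
  by rewrite gl.
move=> [hl ag] i il; have lE : lambda (sp w) n = lambda (sp w0) n.
  by rewrite -gl -gl0; exact: hl.
split=> //; apply/quantP.
rewrite -(@past_at_coord n w) ?lE// -(@past_at_coord n w0)// -lE.
by apply: ag; rewrite leq_max leq_subr.
Qed.

Lemma block_event_quantized n w0 : quantized_sigma n (block_event n w0).
Proof.
pose G := returns_generator setT n (fun i w => quant n (X i w)).
apply: (@measurable_forall _ (g_sigma_algebraType G)) => i.
have [il|li] := leqP i (lambda (sp w0) n).
  apply: sub_gen_smallest; exists (lambda (sp w0) n), i, [set quant n (X i w0)].
  by split=> //; apply/seteqP; split=> w /= => [/(_ isT)|].
rewrite (_ : [set _ | _] = setT); first exact: measurableT.
by apply/seteqP; split.
Qed.

Lemma block_event_full n w0 : full_sigma n (block_event n w0).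
Proof.
pose G := returns_generator (@measurable _ R) n (fun i w => X i w).
apply: (@measurable_forall _ (g_sigma_algebraType G)) => i.
have [il|li] := leqP i (lambda (sp w0) n).
  apply: sub_gen_smallest; exists (lambda (sp w0) n), i, (quant n (X i w0)).
  split=> //; last first.
    apply/seteqP; split=> w /= => [/(_ isT)[-> h]|[-> h] _]; split=> //.
      by rewrite -h; exact: mem_quant.
    by apply/quantP; move: h => /cellP ->.
  have := @discrete_fun_qindex _ R R n id (@measurable_id _ _ setT) (qindex n (X i w0)).
  by congr measurable; apply/seteqP; split=> x /= /cellP.
rewrite (_ : [set _ | _] = setT); first exact: measurableT.
by apply/seteqP; split.
Qed.

Lemma quantized_sigma_saturated n (E : set T) : quantized_sigma n E ->
  forall w w', regular_path (sp w) -> regular_path (sp w') ->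
  atom n (past_at n w) = atom n (past_at n w') -> E w -> E w'.
Proof.
pose S : set (set T) := [set E | forall w w',
  regular_path (sp w) -> regular_path (sp w') ->
  atom n (past_at n w) = atom n (past_at n w') -> E w -> E w'].
suff : quantized_sigma n `<=` S by move=> h /h.
apply: smallest_sub.
  split=> [w w' _ _ _ //|A SA w w' rw rw' ww' [_ nA]|F SF w w' rw rw' ww' [k _ Fw]].
    by split=> // Aw'; apply: nA; exact: SA _ _ rw' rw (esym ww') Aw'.
  by exists k => //; exact: SF _ _ _ rw rw' ww' Fw.
move=> _ [l [i [B [il _ ->]]]] w w' rw rw' ww' [lE Bw].
have /(_ i)[] := (block_eventP n rw' rw).2 (esym ww'); first by rewrite lE.
by move=> lE' qE; split; [rewrite lE'|rewrite qE].
Qed.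

(** On regular paths lambda_n is recovered as [lam] of the past seen at that time, and X_i is its
    coordinate lambda_n - i; so the generators, and with them all events of the exact block, are
    events of this past. *)
Lemma full_sigma_past n (E : set T) : full_sigma n E ->
  exists2 E' : set (@paths R nat), measurable E' &
    forall w, regular_path (sp w) -> E w <-> E' (past_at n w).
Proof.
pose S : set (set T) := [set E | exists2 E' : set (@paths R nat), measurable E' &
    forall w, regular_path (sp w) -> E w <-> E' (past_at n w)].
suff : full_sigma n `<=` S by apply.
apply: smallest_sub.
  split=> [|A [A' mA' AA']|F SF].
  - by exists set0.
  - exists (~` A'); first exact: measurableC.
    by move=> w rw; rewrite setTD /= AA'.
  - have /choice[F' hF'] : forall k, exists E' : set (@paths R nat), measurable E' /\
        forall w, regular_path (sp w) -> F k w <-> E' (past_at n w).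
      by move=> k; have [E' ? ?] := SF k; exists E'.
    exists (\bigcup_k F' k); first by apply: bigcupT_measurable => k; case: (hF' k).
    move=> w rw; split=> -[k _ Fk]; exists k => //.
      by have [_ /(_ w rw)[h _]] := hF' k; exact: h.
    by have [_ /(_ w rw)[_ h]] := hF' k; exact: h.
move=> _ [l [i [B [il mB ->]]]].
exists [set y : @paths R nat | lam y n = l /\ B (y (l - i)%N)].
  apply: measurable_conj; first by apply: discrete_fun_lam => k; exact: measurable_coord.
  by rewrite -[X in measurable X]setTI; exact: measurable_coord.
move=> w rw /=; have [_] := good_past_shift rw n; rewrite -/(return_path n (sp w)) => ->.
have yE : lambda (sp w) n = l -> past_at n w (l - i)%N = X i w.
  by move=> lE; rewrite -lE past_at_coord// lE.
by split=> -[lE h]; split=> //; move: h; rewrite yE.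
Qed.

End conditioning_at_returns.

Section consistency.
Context d (T : measurableType d) (R : realType) (P : probability T R).
Variable X : int -> {RV P >-> R}.
Hypothesis stX : stationary X.
Hypothesis EX2 : ('E_P[fun w => (`|X 0 w| ^+ 2)%R] < +oo)%E.
Notation sp := (sample_path X).
Notation past_at n w := (past (return_path n (sp w))).
Notation mu := (distribution P (past_rv X)).

Lemma Rintegral_past_at n (A : set (@paths R nat)) : measurable A ->
  \int[P]_(w in [set w | A (past_at n w)]) next_value (sp w) n =
  \int[P]_(w in [set w | A (past (sp w))]) X 1 w.
Proof.
move=> mA; have mA' := measurable_preimageT measurable_past mA.
apply: (@Rintegral_next_value _ _ _ _ _ stX n id _ mA') => //.
  exact: integrable_coord.
exact: integrable_next_value.
Qed.

Lemma measurable_past_at n (A : set (@paths R nat)) : measurable A ->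
  measurable [set w | A (past_at n w)].
Proof.
by move=> mA; exact: (measurable_returned X n (measurable_preimageT measurable_past mA)).
Qed.

Lemma past_at_law n (A : set (@paths R nat)) : measurable A ->
  P [set w | A (past_at n w)] = P [set w | A (past (sp w))].
Proof.
by move=> mA; exact: (return_path_law stX n (measurable_preimageT measurable_past mA)).
Qed.

Lemma ae_eq_Rintegral_set (A C : set T) (g h : T -> R) : measurable A ->
  measurable C -> P.-integrable setT (EFin \o g) -> P.-integrable setT (EFin \o h) ->
  {ae P, forall w, (A w <-> C w) /\ (A w -> g w = h w)} ->
  \int[P]_(w in A) g w = \int[P]_(w in C) h w.
Proof.
move=> mA mC ig ih AC; rewrite (Rintegral_indic P A) (Rintegral_indic P C).
have m1 (B : set T) (k : T -> R) : measurable B -> P.-integrable setT (EFin \o k) ->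
    measurable_fun setT (fun w => \1_B w * k w).
  move=> mB ik; apply: measurable_funM; first exact: measurable_indic.
  exact/measurable_EFinP/(measurable_int _ ik).
apply: ae_eq_Rintegral; [exact: m1|exact: m1|].
apply: filterS AC => w [AC gh]; rewrite !indicE.
have [Aw|nA] := pselect (A w).
  by rewrite !mem_set ?gh//; exact/AC.
by rewrite !memNset ?mul0r// => /AC.
Qed.

Section regression_function.
Variable e : (nat -> R) -> R.
Hypothesis re : regression X e.

(** On an atom of positive probability any version is almost surely constant, so its value is a
    ratio of integrals over the atom. Stationarity moves this ratio to the law of the past, where it
    is [atom_mean] at the common code of the limiting sequence. *)
Lemma cond_exp_quantized_ae n :
  {ae P, forall w, cond_exp_quantized X n w = atom_mean X e n (limit_past (sp w))}.
Proof.
pose Y := cond_exp_quantized X n.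
have iZ := integrable_next_value stX EX2 n.
have [iY mY hY] : is_cond_exp P _ _ Y := cond_expP (@quantized_sigma_measurable _ _ _ _ X n) iZ.
pose C c := [set w | atom n (past_at n w) = c].
have mC c : measurable (C c).
  exact: (@measurable_past_at n [set y | atom n y = c] (discrete_atom n c)).
(* The atoms are countably many, so the null ones can be discarded together. *)
have Cpos : {ae P, forall w, P (C (atom n (past_at n w))) <> 0%E}.
  apply: (@negligibleS _ _ _ _ [set w | exists c, C c w /\ P (C c) = 0%E]).
    by move=> w /= /contrapT h; exists (atom n (past_at n w)).
  apply: negligible_exists => c; have [P0|P0] := pselect (P (C c) = 0%E).
    apply: (@negligibleS _ _ _ _ (C c)); first by move=> w [].
    exact/negligibleP.
  by apply: (@negligibleS _ _ _ _ set0); [move=> w []|exact: negligible_set0].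
apply: filterS2 Cpos (regular_ae stX) => w0 P0 r0.
set c := atom n (past_at n w0) in P0 *.
have sA := @block_event_quantized _ _ _ _ X n w0.
have mA := quantized_sigma_measurable sA.
have iY0 : P.-integrable setT (EFin \o cst (Y w0)) by exact: finite_measure_integrable_cst.
(* The level set of the value [Y w0] belongs to the quantized sigma-algebra, hence contains all
   regular paths of the atom. *)
have YC : \int[P]_(w in block_event X n w0) Y w = Y w0 * fine (P (C c)).
  rewrite -Rintegral_cst//; apply: ae_eq_Rintegral_set => //.
  apply: filterS (regular_ae stX) => w rw; have AC := block_eventP n rw r0.
  split=> // /AC ac.
  have := quantized_sigma_saturated (mY [set Y w0] (measurable_set1 _)) r0 rw (esym ac).
  exact.
have ZC : \int[P]_(w in block_event X n w0) next_value (sp w) n =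
    \int[P]_(w in C c) next_value (sp w) n.
  apply: ae_eq_Rintegral_set => //.
  by apply: filterS (regular_ae stX) => w rw; have AC := block_eventP n rw r0; split.
have YZ : \int[P]_(w in block_event X n w0) Y w =
    \int[P]_(w in block_event X n w0) next_value (sp w) n by congr fine; exact: hY.
have me : measurable ([set y | atom n y = c] : set (@paths R nat)).
  exact: discrete_atom.
rewrite /atom_mean /partition_exp.
have -> : atom n (limit_past (sp w0)) = c by rewrite /c /atom (limit_past_code r0 n).
rewrite (Rintegral_regression re me) -[X in fine X](past_at_law n me).
rewrite -(Rintegral_past_at n me) -/(C c).
move: YC; rewrite YZ ZC => ->; rewrite mulfK//.
apply/eqP => p0; apply: P0; rewrite -[LHS]fineK ?p0// fin_num_measure//.
Qed.

Lemma quantized_cvg (f : nat -> set R -> R) : is_selector f ->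
  {ae P, forall w,
    estimate f (sp w) n @[n --> \oo] --> e (limit_past (sp w)) /\
    cond_exp_quantized X n w @[n --> \oo] --> e (limit_past (sp w))}.
Proof.
move=> hf; have h := ae_forall cond_exp_quantized_ae.
apply: filterS2 (estimate_cvg stX EX2 re hf) h => w [h1 h2] h3.
by split=> //; under eq_fun do rewrite h3.
Qed.

End regression_function.

Lemma estimate_quantized_diff (f : nat -> set R -> R) : is_selector f ->
  {ae P, forall w, `|estimate f (sp w) n - cond_exp_quantized X n w|
    @[n --> \oo] --> (0 : R)}.
Proof.
move=> hf; have [e he] := cond_mean_exists stX EX2.
apply: filterS (quantized_cvg (cond_mean_regression he) hf) => w [h1 h2].
by apply/norm_cvg0P; rewrite -(subrr (e (limit_past (sp w)))); exact: cvgB.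
Qed.

End consistency.

(** * Almost sure continuity and the exact past *)

Section dstar_bound.
Context {R : realType}.

(** The first [n.+1] terms of the series add up to at most 2^-n by hypothesis, the remaining ones
    because each ratio is at most 1. *)
Lemma dstar_le (x y : nat -> R) n :
  (forall i, (i <= n)%N -> `|x i - y i| <= 2 ^- n) -> dstar x y <= 2 * 2 ^- n.
Proof.
move=> xy; pose t (i : nat) : R := `|x i - y i| / (1 + `|x i - y i|).
have t0 i : 0 <= t i by rewrite divr_ge0// addr_ge0.
have t1 i : t i <= 1 by rewrite ler_pdivrMr ?mul1r ?lerDr// ltr_wpDr.
have tn i : t i <= `|x i - y i|.
  by rewrite ler_pdivrMr ?ltr_wpDr// mulrDr mulr1 lerDl mulr_ge0.
pose a i := 2 ^- i.+1 * t i.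
have a0 i : 0 <= a i by rewrite mulr_ge0// invr_ge0 exprn_ge0.
have p0 i : 0 <= 2 ^- i :> R by rewrite invr_ge0 exprn_ge0.
have pS i : 2 ^- i = 2 * 2 ^- i.+1 :> R.
  by rewrite exprS invfM mulrA divff ?mul1r.
have seriesS N : series a N.+1 = series a N + a N by rewrite /series/= big_nat_recr.
have small N : (N <= n.+1)%N -> series a N <= 2 ^- n * (1 - 2 ^- N).
  elim: N => [|N IH] Nn.
    by rewrite /series/= big_geq// expr0 invr1 subrr mulr0.
  rewrite seriesS.
  apply: (@le_trans _ _ (2 ^- n * (1 - 2 ^- N) + 2 ^- N.+1 * 2 ^- n)).
    apply: lerD; first by apply: IH; exact: ltnW.
    by apply: ler_wpM2l => //; apply: le_trans (tn N) _; exact: xy.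
  by rewrite (pS N); have := p0 N.+1; have := p0 n; nra.
have large k : series a (n.+1 + k)%N <= 2 ^- n + (2 ^- n - 2 ^- (n + k)%N).
  elim: k => [|k IH].
    rewrite !addn0 subrr addr0; apply: le_trans (small _ (leqnn _)) _.
    by rewrite ler_piMr// gerBl.
  rewrite !addnS seriesS.
  have : a (n.+1 + k)%N <= 2 ^- (n + k).+2.
    by rewrite -[leRHS]mulr1 /a addSn; exact: ler_wpM2l.
  move: IH; rewrite (pS (n + k)%N) (pS (n + k).+1); have := p0 (n + k).+2.
  move: (2 ^- (n + k).+2) (2 ^- n) (series a _) (a _) => p q r b; lra.
have bound N : series a N <= 2 * 2 ^- n.
  apply: (@le_trans _ _ (series a (n.+1 + N)%N)).
    by apply: nondecreasing_series => //; exact: leq_addl.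
  apply: le_trans (large N) _; have := p0 (n + N)%N; lra.
rewrite /dstar; apply: limr_le; last exact: nearW.
apply: nondecreasing_is_cvgn; first by apply: nondecreasing_series.
by exists (2 * 2 ^- n) => _ [N _ <-].
Qed.

End dstar_bound.

Section almost_sure_continuity.
Context d (T : measurableType d) (R : realType) (P : probability T R).
Variable X : int -> {RV P >-> R}.
Hypothesis stX : stationary X.
Hypothesis EX2 : ('E_P[fun w => (`|X 0 w| ^+ 2)%R] < +oo)%E.
Notation sp := (sample_path X).
Notation past_at n w := (past (return_path n (sp w))).

Variables (e : (nat -> R) -> R) (B : set (nat -> R)).
Hypothesis re : regression X e.
Hypothesis PB : {ae P, forall w, B (past (sp w))}.

Let Y n := cond_exp_full X n.

(* A bound for e on the part of B in one atom of the quantized past passes to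
   the conditional expectation given the exact past. *)
Lemma cond_exp_full_bound n (c : nat) (s q : R) :
  (forall y, B y -> atom n y = c -> s * e y <= q) ->
  {ae P, forall w, atom n (past_at n w) = c -> s * Y n w <= q}.
Proof.
move=> he; have iZ := integrable_next_value stX EX2 n.
have [iY mY hY] : is_cond_exp P _ _ (Y n) := cond_expP (@full_sigma_measurable _ _ _ _ X n) iZ.
have [[w0 [r0 w0c]]|none] :=
    pselect (exists w0, regular_path (sp w0) /\ atom n (past_at n w0) = c); last first.
  by apply: filterS (regular_ae stX) => w rw wc; exfalso; apply: none; exists w.
have sBl := @block_event_full _ _ _ _ X n w0.
(* The part of the atom where the bound fails is an event of the exact block. The integral of [Y n]
   over it equals that of [e] over an event of the past inside the same atom, where the bound holds;
   hence it is null. Taking [s] of either sign gives upper and lower bounds. *)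
pose E0 := Y n @^-1` [set x | q < s * x].
have sE0 : vector_sigma measurable (fun w => lambda (sp w) n) (fun i w => X i w) E0.
  apply: mY; rewrite -[X in measurable X]setTI.
  by apply: measurable_fun_ltr => //; exact: measurable_funM.
pose E := E0 `&` block_event X n w0.
have sE : vector_sigma measurable (fun w => lambda (sp w) n) (fun i w => X i w) E.
  exact: (@measurableI _ (g_sigma_algebraType
    (returns_generator X (@measurable _ R) n (fun i w => X i w)))).
have mE := full_sigma_measurable sE.
have [E1 mE1 hE1] := full_sigma_past sE.
pose E2 : set (@paths R nat) := E1 `&` [set y | atom n y = c].
have mE2 : measurable E2 by apply: measurableI => //; exact: discrete_atom.
have EE2 w : regular_path (sp w) -> E w <-> E2 (past_at n w).
  move=> rw; split=> [Ew|[+ _]]; last by move/(hE1 w rw).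
  split; first exact/(hE1 w rw).
  by move: Ew => [_ /(block_eventP n rw r0) h]; rewrite /= h.
have aeE : {ae P, forall w, E w <-> E2 (past_at n w)}.
  by apply: filterS (regular_ae stX) => w rw; exact: EE2.
have mE2at := measurable_past_at X n mE2.
have mE2p : measurable [set w | E2 (past (sp w))].
  exact: measurable_path_event (measurable_preimageT measurable_past mE2).
have [_ ie he'] := re.
have YE : \int[P]_(w in E) Y n w = \int[P]_(w in [set w | E2 (past (sp w))]) e (past (sp w)).
  rewrite he'// -(Rintegral_past_at stX EX2 n mE2).
  transitivity (\int[P]_(w in E) next_value (sp w) n).
    by congr fine; exact: hY.
  by apply: ae_eq_Rintegral_set => //; apply: filterS aeE => w; split.
have PE : P E = P [set w | E2 (past (sp w))].
  rewrite -(past_at_law stX n mE2).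
  by apply: (probability_ae_eq mE mE2at aeE) => w.
have icst (k : R) : P.-integrable setT (EFin \o cst k) by exact: finite_measure_integrable_cst.
have leE : \int[P]_(w in E) (s * Y n w - q) <= 0.
  rewrite (RintegralB mE (EFin_integrableS mE (EFin_integrableZ s iY)) (EFin_integrableS mE (icst q))).
  rewrite (RintegralZl _ mE (EFin_integrableS mE iY)) YE.
  have -> : \int[P]_(w in E) q = \int[P]_(w in [set w | E2 (past (sp w))]) q.
    by rewrite !Rintegral_cst//; congr (_ * fine _); exact: PE.
  rewrite -(RintegralZl _ mE2p (EFin_integrableS mE2p ie)) subr_le0.
  rewrite -lee_fin -!EFin_Rintegral//; [|exact: icst|exact: EFin_integrableZ].
  have ie' := EFin_integrableZ s ie.
  have mie := measurable_int _ ie'.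
  (* The inequality for [e] is known only on [B]. The minimum with [q] equals [s * e] almost surely
     on the set and is at most [q] everywhere. *)
  apply: (@le_trans _ _ (\int[P]_(w in [set w | E2 (past (sp w))])
     (Num.min (s * e (past (sp w))) q)%:E)%E).
    rewrite le_eqVlt; apply/orP; left; apply/eqP; apply: ae_eq_integral => //.
    - by apply: measurable_funTS; exact: mie.
    - apply: measurable_funTS; apply/measurable_EFinP; apply: measurable_minr => //.
      exact/measurable_EFinP.
    - apply: filterS PB => w Bw [_ wc]; congr EFin; apply/esym/min_idPl.
      exact: he.
  apply: le_integral => //.
  - apply: EFin_integrableS => //; apply: (@dominated_integrable _ _ _ _ _
      (fun w => `|s * e (past (sp w))| + `|q|)).
    + by apply: measurable_minr => //; exact/measurable_EFinP.
    + by move=> w; rewrite /Num.min; case: ifP => _; rewrite ?lerDl ?lerDr.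
    + by apply: EFin_integrableD; [exact: integrable_abse ie'|exact: icst].
  - exact: EFin_integrableS mE2p (icst q).
  - by move=> w _; rewrite lee_fin ge_min lexx orbT.
have nullE : P.-negligible E.
  apply: (Rintegral_le0_null mE _ _ leE).
    exact: EFin_integrableB (EFin_integrableZ s iY) (icst q).
  by move=> w [h _]; rewrite subr_gt0.
have aenE : {ae P, forall w, ~ E w}.
  by apply: negligibleS nullE => w /= /contrapT.
apply: filterS2 aenE (regular_ae stX) => w nE rw wc.
rewrite leNgt; apply/negP => lt; apply: nE; split=> //.
by apply/(block_eventP n rw r0); rewrite wc w0c.
Qed.

Hypothesis mB : measurable (B : set (@paths R nat)).
Hypothesis eB : dstar_continuous_on B e.

Lemma cond_exp_full_cvg :
  {ae P, forall w, Y n w @[n --> \oo] --> e (limit_past (sp w))}.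
Proof.
(* The atom and the threshold will depend on [w]. Rational thresholds leave countably many
   statements, so one null set serves for all of them. *)
pose Q (k : nat * nat * rat * bool) w : Prop :=
  let: (n, c, q, b) := k in
  (forall y, B y -> atom n y = c -> (-1) ^+ b * e y <= ratr q) ->
  atom n (past_at n w) = c -> (-1) ^+ b * Y n w <= ratr q.
have hQ : {ae P, forall w, forall k, Q k w}.
  apply: ae_forall => -[[[n c] q] b]; rewrite /Q.
  have [h|h] := pselect (forall y, B y -> atom n y = c -> (-1) ^+ b * e y <= ratr q).
    by apply: filterS (cond_exp_full_bound h) => w hw _.
  by apply: aeW => w /h.
have limB : {ae P, forall w, B (limit_past (sp w))}.
  apply: (limit_past_ae stX); exists (~` B); split=> //; first exact: measurableC.
  by have := measure_negligible (measurableC (measurable_path_event X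
    (measurable_preimageT measurable_past mB))) PB.
apply: filterS3 hQ limB (regular_ae stX) => w hw Bw rw.
set x := limit_past (sp w) in Bw *.
apply/cvgrPdist_le => eps eps0.
have e2 : 0 < eps / 2 by rewrite divr_gt0.
(* The base point in [dstar_continuous_on] is a sequence indexed by [int], of which only the
   nonnegative part is read; hence the extension of [x] through the absolute value. *)
have [delta d0 hdelta] := @eB (fun z => x `|z|%N) Bw (eps / 2) e2.
have d2 : 0 < delta / 2 by rewrite divr_gt0.
have /cvgrPdist_lt/(_ _ d2) := @cvg_geometric_half R.
apply: filterS => n; rewrite sub0r normrN ger0_norm ?invr_ge0 ?exprn_ge0// => nd.
pose c := atom n (past_at n w).
have xc : atom n x = c by rewrite /c /atom (limit_past_code rw n).
have near_e y : B y -> atom n y = c -> `|e x - e y| < eps / 2.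
  move=> By yc; apply: hdelta => //.
  have /atomP/codeP[_ xy] : atom n x = atom n y by rewrite xc yc.
  have : dstar x y <= 2 * 2 ^- n.
    apply: dstar_le => i il; apply/ltW/qindex_dist/xy.
    by rewrite leq_max il orbT.
  by move: nd; move: (2 ^- n) => p; lra.
have [q1 hq1] : exists q : rat, e x + eps / 2 < ratr q < e x + eps.
  have [|q] := @rat_in_itvoo _ (e x + eps / 2) (e x + eps); first by lra.
  by rewrite in_itv/=; exists q.
have [q2 hq2] : exists q : rat, - e x + eps / 2 < ratr q < - e x + eps.
  have [|q] := @rat_in_itvoo _ (- e x + eps / 2) (- e x + eps); first by lra.
  by rewrite in_itv/=; exists q.
have h1 : Y n w <= ratr q1.
  have := hw (n, c, q1, false); rewrite /Q expr0 mul1r; apply => // y By yc.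
  rewrite mul1r; have := near_e y By yc; rewrite ltr_norml => /andP[? ?].
  by move: hq1 => /andP[? ?]; lra.
have h2 : - Y n w <= ratr q2.
  have := hw (n, c, q2, true); rewrite /Q expr1 mulN1r; apply => // y By yc.
  rewrite mulN1r; have := near_e y By yc; rewrite ltr_norml => /andP[? ?].
  by move: hq2 => /andP[? ?]; lra.
move: hq1 hq2 => /andP[? ?] /andP[? ?].
by rewrite ler_norml; apply/andP; split; lra.
Qed.

End almost_sure_continuity.

Section exact_past.
Context d (T : measurableType d) (R : realType) (P : probability T R).
Variable X : int -> {RV P >-> R}.

Lemma estimate_full_diff (f : nat -> set R -> R) : stationary X ->
  ('E_P[fun w => (`|X 0 w| ^+ 2)%R] < +oo)%E -> is_selector f ->
  almost_surely_continuous X ->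
  {ae P, forall w, `|estimate f (sample_path X w) n - cond_exp_full X n w|
    @[n --> \oo] --> (0 : R)}.
Proof.
move=> stX EX2 hf [e [B [he mB PB eB]]].
have re := cond_mean_regression he.
have mB' := measurable_path_event X (measurable_preimageT measurable_past mB).
have PB' := probability1_ae mB' PB.
have h := cond_exp_full_cvg stX EX2 re PB' mB eB.
apply: filterS2 (estimate_cvg stX EX2 re hf) h => w [h1 _] h2.
apply/norm_cvg0P; rewrite -(subrr (e (limit_past (sample_path X w)))).
exact: cvgB.
Qed.

End exact_past.

(** * An i.i.d. geometric sequence *)

Section coin_tossing.
Context {R : realType}.

Notation U := (uniform_prob (@ltr01 R)).

Definition bit (j : nat) (x : R) : bool := odd `|qindex j.+1 x|%N.

Lemma uniform_subunit (A : set R) : measurable A -> A `<=` [set x | 0 <= x <= 1] ->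
  U A = lebesgue_measure A.
Proof.
move=> mA A01; transitivity (\int[lebesgue_measure]_(x in A) (uniform_pdf 0 1 x)%:E)%E => //.
rewrite (eq_integral (cst 1%E)) ?integral_cst ?mul1e// => x; rewrite inE => /A01/= x01.
by rewrite /uniform_pdf x01 subr0 invr1.
Qed.

Lemma uniform_unit_ae : {ae U, forall x : R, 0 <= x < 1}.
Proof.
have E : [set x : R | 0 <= x < 1] = [set` `[0, 1[ ].
  by apply/seteqP; split=> x /=; rewrite in_itv.
apply: (@probability1_ae _ _ _ U [set x : R | 0 <= x < 1]).
  by rewrite E; exact: measurable_itv.
apply: (eq_trans (uniform_subunit _ _)).
- by rewrite E; exact: measurable_itv.
- by move=> x /= /andP[-> /ltW ->].
by rewrite E lebesgue_measure_itv/= lte_fin ltr01 oppr0 adde0.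
Qed.

Lemma measurable_cell k i : measurable (cell k i : set R).
Proof.
rewrite (_ : cell k i = [set` `[i%:~R * 2 ^- k, (i + 1)%:~R * 2 ^- k[ ]).
  exact: measurable_itv.
by apply/seteqP; split=> x /=; rewrite in_itv.
Qed.

Lemma uniform_cell N (m : nat) : (m < 2 ^ N)%N -> U (cell N m) = (2 ^- N)%:E.
Proof.
move=> mN; have p0 : 0 < 2 ^- N :> R by rewrite invr_gt0 exprn_gt0.
have hi x : cell N m x -> 0 <= x <= 1.
  rewrite /cell/= => /andP[h1 h2]; apply/andP; split.
    by apply: le_trans h1; rewrite mulr_ge0// ltW.
  apply: (le_trans (ltW h2)); rewrite ler_pdivrMr ?exprn_gt0// mul1r.
  by rewrite -PoszD addn1 -pmulrn -natrX ler_nat.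
apply: (eq_trans (uniform_subunit _ _)) => //; first exact: measurable_cell.
  by move=> x /hi.
have E : cell N m = [set` `[m%:~R * 2 ^- N, (m%:Z + 1)%:~R * 2 ^- N[ ] :> set R.
  by apply/seteqP; split=> x /=; rewrite in_itv.
rewrite E lebesgue_measure_itv.
rewrite /= lte_fin ltr_pM2r// ltr_int ltrDl ltr01.
by rewrite -EFinD -mulrBl intrD addrAC subrr add0r mul1r.
Qed.

Section allowed_digits.
Variable c : nat -> bool -> bool.

(** When [m] is the index of a cell of level [N], its lowest binary digit is digit [N.-1] of the
    points of the cell, so the recursion reads the digits from last to first. *)
Fixpoint digits_ok N (m : nat) : bool :=
  if N is N'.+1 then digits_ok N' m./2 && c N' (odd m) else true.

Lemma digits_okP N (x : R) : 0 <= x ->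
  digits_ok N `|qindex N x|%N <-> forall j, (j < N)%N -> c j (bit j x).
Proof.
move=> x0; elim: N => [|N IH]; first by split.
have -> : digits_ok N.+1 `|qindex N.+1 x|%N =
    digits_ok N `|qindex N x|%N && c N (bit N x).
  rewrite /= /bit; congr (digits_ok N _ && _).
  have : 0 <= qindex N.+1 x by rewrite floor_ge0 mulr_ge0// exprn_ge0.
  by rewrite (qindexS N x); case: (qindex N.+1 x) => // m _; rewrite divz_nat absz_nat divn2.
split=> [/andP[/IH h cN] j|h].
  by rewrite ltnS leq_eqVlt => /orP[/eqP ->//|]; exact: h.
by apply/andP; split; [apply/IH => j jN; apply: h; exact: ltnW|exact: h].
Qed.

Lemma sum_halves (F : nat -> nat) M :
  \sum_(m < M.*2) F m = (\sum_(k < M) (F k.*2 + F k.*2.+1))%N.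
Proof.
by elim: M => [|M IH]; rewrite ?big_ord0// doubleS !big_ord_recr/= IH addnA.
Qed.

Lemma digits_count N :
  (\sum_(m < 2 ^ N) digits_ok N m)%:R * 2 ^- N =
  \prod_(j < N) ((c j true + c j false)%:R / 2) :> R.
Proof.
elim: N => [|N IH]; first by rewrite big_ord1 big_ord0 expr0 invr1 mulr1.
rewrite big_ord_recr/= -IH expnS mul2n (sum_halves (fun m => digits_ok N.+1 m)).
under eq_bigr do rewrite /= doubleK odd_double/= uphalf_double -!mulnb -mulnDr.
rewrite -big_distrl/= natrM exprS invfM addnC; ring.
Qed.

(** Independence of the binary digits of a uniform number, by counting: a constraint on the first
    [N] digits selects cells of length 2^-N, and their number is a product over the digits. *)
Lemma bits_prob N : U [set x | forall j, (j < N)%N -> c j (bit j x)] =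
  (\prod_(j < N) ((c j true + c j false)%:R / 2))%:E.
Proof.
rewrite -digits_count.
have mE : measurable (\big[setU/set0]_(m < 2 ^ N | digits_ok N m) (cell N m : set R)).
  by apply: bigsetU_measurable => m _; exact: measurable_cell.
have tF : trivIset [set: 'I_(2 ^ N)] (fun m : 'I_(2 ^ N) => cell N m : set R).
  apply/trivIsetP => i j _ _ ij; apply/seteqP; split=> // x [/cellP xi /cellP xj].
  by move: ij; rewrite -val_eqE/= -eqz_nat -xi -xj eqxx.
transitivity (U (\big[setU/set0]_(m < 2 ^ N | digits_ok N m) (cell N m : set R))).
  have mA : measurable [set x : R | forall j, (j < N)%N -> c j (bit j x)].
    apply: (@measurable_forall _ _ _ (fun j (x : R) => (j < N)%N -> c j (bit j x))) => j.
    apply: measurable_imp; first exact: measurable_prop.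
    apply: (@discrete_fun_pred _ _ _ _ (fun i => c j (odd `|i|%N))).
    exact: discrete_fun_qindex.
  apply: (@probability_ae_eq _ _ _ U _ _ _ mA mE uniform_unit_ae).
  move=> x /andP[x0 x1]; 
  have -> : \big[setU/set0]_(m < 2 ^ N | digits_ok N m) (cell N m : set R) =
      \bigcup_(m in [set` (fun m : 'I_(2 ^ N) => digits_ok N m)]) cell N m.
    by rewrite bigcup_pred.
  split.
    move=> /(digits_okP N x0) h; have q0 : 0 <= qindex N x.
      by rewrite floor_ge0 mulr_ge0// exprn_ge0.
    have qN : (`|qindex N x| < 2 ^ N)%N.
      rewrite -ltz_nat gez0_abs// floor_lt_int.
      by rewrite -pmulrn natrX gtr_pMl// exprn_gt0.
    by exists (Ordinal qN) => //; apply/cellP; rewrite /= gez0_abs.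
  move=> [m /= okm /cellP xm].
  by apply/(digits_okP N x0); rewrite xm absz_nat.
rewrite measure_bigsetU_ord_cond//; last 2 first.
- by move=> m _; exact: measurable_cell.
- by apply: sub_trivIset tF.
rewrite (eq_bigr (fun=> (2 ^- N)%:E)); last by move=> m _; exact: uniform_cell.
rewrite sumEFin; congr EFin; rewrite big_mkcond/= natr_sum mulr_suml.
by apply: eq_bigr => m _; case: digits_ok; rewrite ?mul1r ?mul0r.
Qed.

End allowed_digits.

Lemma prod_mem_pow (s : seq nat) N (a : R) : uniq s -> (forall j, j \in s -> (j < N)%N) ->
  \prod_(j < N) (if nat_of_ord j \in s then a else 1) = a ^+ size s.
Proof.
move=> us sN; rewrite -(big_mkord xpredT (fun j => if j \in s then a else 1)).
rewrite -big_mkcond/= -big_filter.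
have ps : perm_eq [seq j <- index_iota 0 N | j \in s] s.
  apply: uniq_perm => //; first by rewrite filter_uniq// iota_uniq.
  by move=> j; rewrite mem_filter mem_index_iota /=; case: (boolP (j \in s)) => // /sN ->.
by rewrite (perm_big _ ps)/= big_const_seq count_predT iter_mulr mulr1.
Qed.

Lemma bits_cylinder (L : seq (nat * bool)) : uniq (unzip1 L) ->
  U [set x | forall p, p \in L -> bit p.1 x = p.2] = (2 ^- size L)%:E.
Proof.
(* Digits not listed in [L] admit both values and give a factor 1; each listed one gives 1/2. *)
move=> uL; pose c j b := all (fun p => (p.1 == j) ==> (p.2 == b)) L.
pose N := (\max_(j <- unzip1 L) j).+1.
have LN j : j \in unzip1 L -> (j < N)%N.
  by move=> jL; rewrite ltnS; exact: (@leq_bigmax_seq _ _ xpredT id).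
transitivity (U [set x | forall j, (j < N)%N -> c j (bit j x)]).
  congr (U _); apply/seteqP; split=> x /= h.
    by move=> j _; apply/allP => p /h <-; apply/implyP => /eqP ->.
  move=> p pL; have := h p.1 (LN _ (map_f fst pL)) => /allP/(_ p pL).
  by rewrite eqxx/= => /eqP.
rewrite bits_prob; congr EFin; rewrite -(size_map fst) -exprVn -(prod_mem_pow _ uL LN).
apply: eq_bigr => j _; case: ifPn => [|jL].
  move=> /mapP[p pL ->].
  have cE b : c p.1 b = (p.2 == b).
    apply/idP/idP => [/allP/(_ p pL)|/eqP <-]; first by rewrite eqxx.
    apply/allP => q qL; apply/implyP => /eqP qp.
    suff -> : q = p by [].
    have /(nthP (0%N, false))[i iL qi] := qL.
    have /(nthP (0%N, false))[k kL pk] := pL.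
    suff ik : i = k by rewrite -qi -pk ik.
    apply/eqP; rewrite -(nth_uniq 0%N _ _ uL) ?size_map//.
    by rewrite !(nth_map (0%N, false))// qi pk qp.
  by rewrite !cE; case: p.2; rewrite ?mul1r.
have cT b : c j b.
  apply/allP => p pL; apply/implyP => /eqP pj.
  by move: jL; rewrite -pj (map_f fst pL).
by rewrite !cT mulfV ?pnatr_eq0.
Qed.

End coin_tossing.

Definition nat_cylinders : set (set (int -> nat)) :=
  [set A | exists (i : int) (D : set nat), A = [set x | D (x i)]].

Definition nat_paths := g_sigma_algebraType nat_cylinders.

Lemma discrete_coord i : discrete_fun (fun x : nat_paths => x i).
Proof. by move=> k; apply: sub_gen_smallest; exists i, [set k]. Qed.

Lemma measurable_nat_pathsP d (T : measurableType d) (F : T -> nat_paths) :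
  (forall i, discrete_fun (fun w => F w i)) -> measurable_fun setT F.
Proof.
move=> mF; apply: (@measurability _ _ _ nat_paths setT F nat_cylinders) => //.
move=> _ [_ [i [D ->]] <-]; rewrite setTI.
exact: (@discrete_fun_pred _ _ _ (fun w => F w i)).
Qed.

Definition point_cylinder (J : seq int) (v : int -> nat) : set nat_paths :=
  [set x | forall i, i \in J -> x i = v i].

(** The empty set is included because two cylinders may prescribe different values at one index;
    with it the family is closed under intersection. *)
Definition point_cylinders : set (set nat_paths) :=
  [set A | A = set0 \/ exists J v, A = point_cylinder J v].

Lemma measurable_point_cylinder J v : measurable (point_cylinder J v).
Proof.
apply: (@measurable_forall _ _ _ (fun i (x : nat_paths) => i \in J -> x i = v i)) => i.
by apply: measurable_imp; [exact: measurable_prop|exact: discrete_coord].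
Qed.

Lemma point_cylinders_setI : setI_closed point_cylinders.
Proof.
move=> A B [->|[J [v ->]]]; first by rewrite set0I; left.
move=> [->|[K [u ->]]]; first by rewrite setI0; left.
have [->|/set0P[z [zJ zK]]] := eqVneq (point_cylinder J v `&` point_cylinder K u) set0.
  by left.
right; exists (J ++ K), z; apply/seteqP; split=> x /=.
  move=> [xJ xK] i; rewrite mem_cat => /orP[] iJ; first by rewrite xJ// zJ.
  by rewrite xK// zK.
move=> h; split=> i iJ; rewrite h ?mem_cat ?iJ ?orbT//; first exact: zJ.
exact: zK.
Qed.

Lemma point_cylinders_generate : @measurable _ nat_paths = <<s point_cylinders >>.
Proof.
apply/seteqP; split; apply: smallest_sub; try exact: sigma_algebra_measurable;
  try exact: smallest_sigma_algebra.
  move=> _ [i [D ->]].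
  apply: (@discrete_fun_pred _ (g_sigma_algebraType point_cylinders) _ (fun x => x i)).
  move=> k; apply: sub_gen_smallest; right; exists [:: i], (fun=> k).
  apply/seteqP; split=> x /=; first by move=> <- j; rewrite inE => /eqP ->.
  by apply; rewrite inE.
move=> _ [->|[J [v ->]]]; first exact: measurable0.
exact: measurable_point_cylinder.
Qed.

Section geometric_variables.
Context {R : realType}.

Notation U := (uniform_prob (@ltr01 R)).

(** [pickle] arranges the digits of one number into a row for each integer [i], and the value is the
    position of the first 1 in the row. Distinct rows share no digit, so the values are independent,
    with P(k) = 2^-(k+1). *)
Definition geo (x : R) (i : int) : nat := nat_min [set k | bit (pickle (i, k : nat)) x].

Lemma measurable_bit j b : measurable [set x : R | bit j x = b].
Proof.
apply: (@discrete_fun_pred _ _ _ (fun x : R => qindex j.+1 x) (fun q => odd `|q|%N = b)).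
exact: discrete_fun_qindex.
Qed.

Lemma measurable_geo : measurable_fun setT (geo : measurableTypeR R -> nat_paths).
Proof.
apply: measurable_nat_pathsP => i; apply: discrete_fun_nat_min => k.
exact: measurable_bit.
Qed.

Lemma bit_row_ae : {ae U, forall x, forall i : int, exists k, bit (pickle (i, k : nat)) x}.
Proof.
apply: ae_forall => i.
suff : (U : {measure set _ -> \bar R}).-negligible
    [set x : R | forall k, bit (pickle (i, k : nat)) x = false].
  by apply: negligibleS => x /= /forallNP h k; apply/negbTE/negP; exact: h.
have mF : measurable [set x : R | forall k, bit (pickle (i, k : nat)) x = false].
  by apply: measurable_forall => k; exact: measurable_bit.
exists [set x : R | forall k, bit (pickle (i, k : nat)) x = false]; split=> //.
apply: nonneg_small_eq0; first exact: measure_ge0.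
move=> e e0; have [n hn] : exists n, 2 ^- n <= e.
  have /cvgrPdist_le/(_ _ e0)[n _ /(_ n (leqnn n))] := @cvg_geometric_half R.
  by rewrite sub0r normrN ger0_norm ?invr_ge0 ?exprn_ge0// => hn; exists n.
pose L := [seq (pickle (i, k : nat), false) | k <- iota 0 n].
have uL : uniq (unzip1 L).
  rewrite /unzip1 /L -map_comp map_inj_uniq ?iota_uniq// => k k' /= /(pcan_inj pickleK).
  by move=> [].
have := bits_cylinder (R := R) uL; rewrite size_map size_iota => PL.
apply: (@le_trans _ _ (2 ^- n)%:E); last by rewrite lee_fin.
rewrite -PL; apply: le_measure; rewrite ?inE//; last first.
  by move=> x /= h p /mapP[k _ ->] /=.
apply: (@measurable_forall _ _ _ (fun p (x : R) => p \in L -> bit p.1 x = p.2)) => p.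
by apply: measurable_imp; [exact: measurable_prop|exact: measurable_bit].
Qed.

Definition geo_prob : probability nat_paths R :=
  distribution U (to_mfun measurable_geo).

Lemma geo_cylinder J v : uniq J ->
  geo_prob (point_cylinder J v) = (2 ^- (\sum_(i <- J) (v i).+1))%:E.
Proof.
move=> uJ.
(* The value [v i] in row [i] means [v i] zeros followed by a one, hence [(v i).+1] prescribed
   digits. *)
pose L := [seq (pickle (i, k : nat), k == v i) | i <- J, k <- iota 0 (v i).+1].
have sL : size L = (\sum_(i <- J) (v i).+1)%N.
  rewrite size_allpairs_dep sumnE big_map; apply: eq_bigr => i _.
  by rewrite size_iota.
have uL : uniq (unzip1 L).
  rewrite /unzip1 /L map_allpairs; apply: allpairs_uniq_dep => //.
    by move=> i _; exact: iota_uniq.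
  move=> [i k] [j l] _ _ /= /(pcan_inj pickleK) [-> ->] //.
rewrite -sL -(bits_cylinder uL).
have mL : measurable [set x : R | forall p, p \in L -> bit p.1 x = p.2].
  apply: (@measurable_forall _ _ _ (fun p (x : R) => p \in L -> bit p.1 x = p.2)) => p.
  by apply: measurable_imp; [exact: measurable_prop|exact: measurable_bit].
have mG := measurable_preimageT measurable_geo (measurable_point_cylinder J v).
apply: (@probability_ae_eq _ _ _ U _ _ _ mG mL bit_row_ae) => x rx.
split=> [h _ /allpairsPdep[i [k [iJ kv ->]]] /=|h i iJ].
  have [gb gmin] := nat_minP (rx i).
  have gv : nat_min [set k | bit (pickle (i, k : nat)) x] = v i := h i iJ.
  have [->|kv'] := eqVneq k (v i); first by rewrite -gv.
  apply/negbTE/negP => /gmin; rewrite gv => vk.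
  by move: kv; rewrite mem_iota/= add0n ltnS leq_eqVlt (negbTE kv')/= ltnNge vk.
have hL k : (k <= v i)%N -> bit (pickle (i, k : nat)) x = (k == v i).
  move=> kv; apply: (h (pickle (i, k : nat), k == v i)).
  by apply/allpairsPdep; exists i, k; split=> //; rewrite mem_iota/= add0n ltnS.
apply: nat_min_eq => [|k /= bk]; first by rewrite /= hL ?eqxx.
rewrite leqNgt; apply/negP => kv; have := hL k (ltnW kv).
by rewrite bk => /esym/eqP kE; rewrite kE ltnn in kv.
Qed.

End geometric_variables.

Section real_probability.
Context d (T : measurableType d) (R : realType) (P : probability T R).
Implicit Types A B D : set T.

Definition pr (A : set T) : R := fine (P A).

Lemma EFin_pr A : measurable A -> (pr A)%:E = P A.
Proof. by move=> mA; rewrite fineK// fin_num_measure. Qed.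

Lemma pr_ge0 A : 0 <= pr A.
Proof. by rewrite fine_ge0. Qed.

Lemma prT : pr setT = 1.
Proof. by rewrite /pr probability_setT. Qed.

Lemma pr0 : pr set0 = 0.
Proof. by rewrite /pr measure0. Qed.

Lemma le_pr A B : measurable A -> measurable B -> A `<=` B -> pr A <= pr B.
Proof.
move=> mA mB AB; rewrite -lee_fin !EFin_pr//.
by apply: le_measure => //; rewrite inE.
Qed.

Lemma prU A B : measurable A -> measurable B -> A `&` B = set0 ->
  pr (A `|` B) = pr A + pr B.
Proof.
move=> mA mB AB; apply: EFin_inj; rewrite EFinD !EFin_pr//; last exact: measurableU.
exact: measureU.
Qed.

Lemma prD A B : measurable A -> measurable B -> B `<=` A -> pr (A `\` B) = pr A - pr B.
Proof.
move=> mA mB BA; apply/eqP; rewrite eq_sym subr_eq addrC -prU//.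
- by rewrite setDUK.
- exact: measurableD.
- by apply/seteqP; split=> // x [? []].
Qed.

Lemma pr_nondecreasing (F : nat -> set T) : (forall n, measurable (F n)) ->
  nondecreasing_seq F -> pr (F n) @[n --> \oo] --> pr (\bigcup_n F n).
Proof.
move=> mF ndF; apply: fine_cvg; rewrite fineK ?fin_num_measure//.
  by apply: nondecreasing_cvg_mu => //; exact: bigcup_measurable.
exact: bigcup_measurable.
Qed.

End real_probability.

(** Closure under proper differences and increasing unions suits independence and mixing, which pass
    to limits of probabilities. *)
Lemma nondecreasing_induction d (T : measurableType d) (G : set (set T))
    (Q : set T -> Prop) :
  @measurable _ T = <<s G >> -> setI_closed G -> Q setT -> G `<=` Q ->
  (forall A B, measurable A -> measurable B -> B `<=` A -> Q A -> Q B -> Q (A `\` B)) ->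
  (forall F : nat -> set T, (forall n, measurable (F n)) -> nondecreasing_seq F ->
    (forall n, Q (F n)) -> Q (\bigcup_n F n)) ->
  forall A, measurable A -> Q A.
Proof.
move=> GE GI QT GQ QD QU A mA; rewrite GE in mA.
suff: <<s G >> `<=` [set A | measurable A /\ Q A] by move=> /(_ _ mA)[].
apply: lambda_system_subset => //.
  split=> //; [move=> B C CB [mB QB] [mC QC]|move=> F ndF mF].
    by split; [exact: measurableD|exact: QD].
  split; first by apply: bigcup_measurable => n _; exact: (mF n).1.
  by apply: QU => // n; [exact: (mF n).1|exact: (mF n).2].
by move=> B GB; split; [rewrite GE; exact: sub_gen_smallest|exact: GQ].
Qed.

Section induction_on_events.
Context d d' (T : measurableType d) (Y : measurableType d') (R : realType).
Variable P : probability T R.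
Variables (G : set (set Y)) (F : T -> Y).
Hypothesis GE : @measurable _ Y = <<s G >>.
Hypothesis GI : setI_closed G.
Hypothesis mF : measurable_fun setT F.

Let mpre A : measurable A -> measurable (F @^-1` A).
Proof. exact: measurable_preimageT. Qed.

Let nd_pre (A : nat -> set Y) : nondecreasing_seq A ->
  nondecreasing_seq (fun n => F @^-1` A n).
Proof. by move=> ndA n m /ndA/subsetPset h; apply/subsetPset => x /h. Qed.

Lemma independence_induction (D : set T) : measurable D ->
  (forall A, G A -> pr P (F @^-1` A `&` D) = pr P (F @^-1` A) * pr P D) ->
  forall A, measurable A -> pr P (F @^-1` A `&` D) = pr P (F @^-1` A) * pr P D.
Proof.
move=> mD iG; apply: (nondecreasing_induction GE GI) => //.
- by rewrite preimage_setT setTI prT mul1r.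
- move=> A B mA mB BA iA iB.
  have -> : F @^-1` (A `\` B) = F @^-1` A `\` F @^-1` B by [].
  rewrite [in RHS]prD; [|exact: mpre|exact: mpre|by move=> x /BA].
  rewrite mulrBl -iA -iB -prD.
  + congr (pr P _); apply/seteqP; split=> x /= [[a b] h]; split=> //; first by case.
    by split=> // ?; apply: h.
  + by apply: measurableI => //; exact: mpre.
  + by apply: measurableI => //; exact: mpre.
  + by move=> x [/BA ? ?].
- move=> A mA ndA iA; rewrite preimage_bigcup setI_bigcupl.
  have c1 : pr P (F @^-1` A n `&` D) @[n --> \oo] -->
      pr P (\bigcup_n (F @^-1` A n `&` D)).
    apply: pr_nondecreasing; first by move=> n; apply: measurableI => //; exact: mpre.
    by move=> n m /(nd_pre ndA)/subsetPset h; apply/subsetPset => x [/h ? ?].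
  have c2 : pr P (F @^-1` A n) * pr P D @[n --> \oo] -->
      pr P (\bigcup_n (F @^-1` A n)) * pr P D.
    apply: cvgMl; apply: pr_nondecreasing; last exact: nd_pre.
    by move=> n; exact: mpre.
  have iA' : (fun n => pr P (F @^-1` A n `&` D)) = (fun n => pr P (F @^-1` A n) * pr P D).
    by apply/funext => n; exact: iA.
  by rewrite iA' in c1; exact: (cvg_unique _ c1 c2).
Qed.

End induction_on_events.

(** * Independence, mixing and ergodicity *)

Section geometric_process.
Context {R : realType}.
Notation Q := (@geo_prob R).

Lemma point_cylinder_undup J v : point_cylinder J v = point_cylinder (undup J) v.
Proof.
by apply/seteqP; split=> x /= h i iJ; apply: h; move: iJ; rewrite mem_undup.
Qed.

Lemma pr_cylinder J v : uniq J ->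
  pr Q (point_cylinder J v) = 2 ^- (\sum_(i <- J) (v i).+1).
Proof. by move=> uJ; rewrite /pr (geo_cylinder _ uJ). Qed.

Definition shift_nat (h : int) (x : nat_paths) : nat_paths := fun i => x (i + h).

Lemma measurable_shift_nat h : measurable_fun setT (shift_nat h).
Proof. by apply: measurable_nat_pathsP => i; exact: discrete_coord. Qed.

Lemma shift_cylinder h J v : shift_nat h @^-1` point_cylinder J v =
  point_cylinder [seq i + h | i <- J] (fun i => v (i - h)).
Proof.
apply/seteqP; split=> x /= hx i; first by move=> /mapP[j jJ ->]; rewrite addrK; exact: hx.
by move=> iJ; have := hx _ (map_f (fun i => i + h) iJ); rewrite addrK.
Qed.

Lemma shift_cylinder_pr h J v : uniq J ->
  pr Q (shift_nat h @^-1` point_cylinder J v) = pr Q (point_cylinder J v).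
Proof.
move=> uJ; rewrite shift_cylinder !pr_cylinder// ?map_inj_uniq//; last exact: addIr.
by congr (2 ^- _); rewrite big_map; apply: eq_bigr => i _; rewrite addrK.
Qed.

Lemma geo_shift h A : measurable A -> Q (shift_nat h @^-1` A) = Q A.
Proof.
move=> mA; pose m := distribution Q (to_mfun (measurable_shift_nat h)).
rewrite -[LHS]/(m A).
apply: (measure_unique point_cylinders (fun=> setT)) => //.
- exact: point_cylinders_generate.
- exact: point_cylinders_setI.
- by move=> _; right; exists [::], (fun=> 0%N); apply/seteqP.
- by rewrite bigcup_const.
- move=> _ [->|[J [v ->]]]; first by rewrite !measure0.
  rewrite point_cylinder_undup.
  have mC := measurable_point_cylinder (undup J) v.
  have := congr1 EFin (shift_cylinder_pr h v (undup_uniq J)).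
  rewrite (EFin_pr Q mC) (EFin_pr Q (measurable_preimageT (measurable_shift_nat h) mC)).
  exact.
- move=> _; apply: (le_lt_trans (probability_le1 m measurableT)); exact: ltry.
Qed.

Definition cut (n : int) (x : nat_paths) : nat_paths :=
  fun i => if i < n then x i else 0%N.

Lemma measurable_cut n : measurable_fun setT (cut n).
Proof.
apply: measurable_nat_pathsP => i; rewrite /cut; case: (i < n).
  exact: discrete_coord.
by move=> k; apply: measurable_prop.
Qed.

Lemma measurable_value n k : measurable [set x : nat_paths | x n = k].
Proof. exact: discrete_coord. Qed.

Lemma value_cylinder n k : [set x : nat_paths | x n = k] = point_cylinder [:: n] (fun=> k).
Proof.
apply/seteqP; split=> x /=; first by move=> <- i; rewrite inE => /eqP ->.
by apply; rewrite inE.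
Qed.

Lemma pr_value n k : pr Q [set x : nat_paths | x n = k] = 2 ^- k.+1.
Proof. by rewrite value_cylinder pr_cylinder// big_seq1. Qed.

Lemma cut_indep n k A : measurable A ->
  pr Q (cut n @^-1` A `&` [set x | x n = k]) = pr Q (cut n @^-1` A) * 2 ^- k.+1.
Proof.
rewrite -(pr_value n k).
apply: (independence_induction point_cylinders_generate point_cylinders_setI
  (measurable_cut n) (measurable_value n k)).
move=> _ [->|[J [v ->]]]; first by rewrite preimage_set0 set0I pr0 mul0r.
rewrite point_cylinder_undup; set K := undup J.
(* [cut n] puts 0 from index [n] on: a nonzero value prescribed there makes the preimage empty, and
   the value 0 imposes nothing. *)
have [v0|v0] := pselect (forall i, i \in K -> n <= i -> v i = 0%N); last first.
  have -> : cut n @^-1` point_cylinder K v = set0.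
    apply/seteqP; split=> // x h; apply: v0 => i iK ni; rewrite -(h i iK)/= /cut.
    by rewrite ltNge ni.
  by rewrite set0I pr0 mul0r.
pose K' := [seq i <- K | i < n].
have uK' : uniq K' by rewrite filter_uniq// undup_uniq.
have -> : cut n @^-1` point_cylinder K v = point_cylinder K' v.
  apply/seteqP; split=> x /= h i.
    by rewrite mem_filter => /andP[iltn iK]; rewrite -(h i iK) /cut iltn.
  move=> iK; rewrite /cut; case: ltP => [iltn|/(v0 _ iK)//].
  by apply: h; rewrite mem_filter iltn.
pose w i := if i == n then k else v i.
have nK' : n \notin K' by rewrite mem_filter ltxx.
have wE i : i \in K' -> w i = v i.
  by rewrite /w mem_filter => /andP[iltn _]; rewrite lt_eqF.
have -> : point_cylinder K' v `&` [set x | x n = k] = point_cylinder (n :: K') w.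
  apply/seteqP; split=> x /=.
    move=> [h xn] i; rewrite inE => /orP[/eqP ->|iK]; first by rewrite /w eqxx.
    by rewrite wE// h.
  move=> h; split=> [i iK|]; last by rewrite (h _ (mem_head _ _)) /w eqxx.
  by rewrite -(wE _ iK) h// inE iK orbT.
rewrite pr_value !pr_cylinder ?cons_uniq ?nK'// big_cons exprD invfM {1}/w eqxx mulrC.
by congr (2 ^- _ * _); apply: eq_big_seq => i /wE ->.
Qed.

(** For cylinders the two sides are equal once the shift separates their index sets; the general
    case follows by approximating [A]. *)
Lemma geo_mixing K u A : measurable A ->
  pr Q (shift_nat h%:Z @^-1` A `&` point_cylinder K u) @[h --> \oo] -->
  pr Q A * pr Q (point_cylinder K u).
Proof.
pose C := point_cylinder K u; have mC : measurable C := measurable_point_cylinder K u.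
have mS h B : measurable B -> measurable (shift_nat h @^-1` B).
  by move=> mB; exact: measurable_preimageT (measurable_shift_nat h) mB.
move: A; apply: (nondecreasing_induction point_cylinders_generate point_cylinders_setI).
- by rewrite prT mul1r; under eq_fun do rewrite preimage_setT setTI; exact: cvg_cst.
- move=> _ [->|[J [v ->]]].
    rewrite pr0 mul0r; under eq_fun do rewrite preimage_set0 set0I pr0; exact: cvg_cst.
  rewrite (point_cylinder_undup J) (point_cylinder_undup K).
  set J' := undup J; set K' := undup K.
  apply: cvg_near_cst; near=> h.
  have JK i : i \in J' -> i + h%:Z \notin K'.
    move=> iJ; apply/negP => iK.
    have lM j : j \in J' ++ K' -> (`|j| <= \max_(j <- J' ++ K') `|j|)%N.
      by move=> jL; exact: (@leq_bigmax_seq _ _ xpredT).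
    have := lM i; have := lM (i + h%:Z); rewrite !mem_cat iJ iK orbT => /(_ isT) h1 /(_ isT) h2.
    (* A shift larger than twice every index in absolute value moves one index set off the other. *)
    have : (2 * \max_(j <- J' ++ K') `|j| < h)%N by near: h; exact: nbhs_infty_gt.
    by move: h1 h2; set M := (\max_(_ <- _) _)%N; lia.
  pose w i := if i \in K' then u i else v (i - h%:Z).
  have -> : shift_nat h%:Z @^-1` point_cylinder J' v `&` point_cylinder K' u =
      point_cylinder ([seq i + h%:Z | i <- J'] ++ K') w.
    rewrite shift_cylinder; apply/seteqP; split=> x /=.
      move=> [hJ hK] i; rewrite mem_cat /w; case: ifP => [iK _|_]; first exact: hK.
      by rewrite orbF; exact: hJ.
    move=> hx; split=> i iJ; rewrite hx ?mem_cat ?iJ ?orbT// /w ?iJ//.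
    by move: iJ => /mapP[j jJ ->]; rewrite (negbTE (JK _ jJ)).
  rewrite !pr_cylinder ?undup_uniq//.
    rewrite -invfM -exprD big_cat big_map/=; congr (2 ^- (_ + _)%N).
      by apply: eq_big_seq => i iJ; rewrite /w (negbTE (JK _ iJ)) addrK.
    by apply: eq_big_seq => i iK; rewrite /w iK.
  rewrite cat_uniq map_inj_uniq ?undup_uniq//=; last exact: addIr.
  rewrite andbT; apply/hasPn => i iK; apply/negP => /mapP[j jJ ij].
  by move: iK; rewrite ij (negbTE (JK _ jJ)).
- move=> A B mA mB BA cA cB; rewrite prD// mulrBl.
  under eq_fun => h.
    have -> : shift_nat h%:Z @^-1` (A `\` B) `&` C =
        (shift_nat h%:Z @^-1` A `&` C) `\` (shift_nat h%:Z @^-1` B `&` C).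
      apply/seteqP; split=> x /= [[a b] c]; split=> //; first by case.
      by split=> // ?; apply: c.
    rewrite prD; [|by apply: measurableI => //; exact: mS|
      by apply: measurableI => //; exact: mS|by move=> x [/BA]].
    over.
  exact: cvgB.
- move=> F mF ndF cF; apply/cvgrPdist_le => e e0.
  have e3 : 0 < e / 3 by rewrite divr_gt0.
  have mU : measurable (\bigcup_n F n) by exact: bigcup_measurable.
  have /cvgrPdist_le/(_ _ e3)[n _ /(_ n (leqnn n)) Fn] := pr_nondecreasing (P := Q) mF ndF.
  have le1 : 0 <= pr Q C <= 1 by rewrite pr_ge0 -(prT Q) le_pr.
  have /cvgrPdist_le/(_ _ e3) := cF n; apply: filterS => h hn.
  have s1 : F n `<=` \bigcup_n F n by move=> x ?; exists n.
  have mSC B : measurable B -> measurable (shift_nat h%:Z @^-1` B `&` C).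
    by move=> mB; apply: measurableI => //; exact: mS.
  (* Shift invariance makes this approximation error uniform in [h]. *)
  have sd : pr Q (shift_nat h%:Z @^-1` (\bigcup_n F n) `&` C) -
      pr Q (shift_nat h%:Z @^-1` F n `&` C) <= pr Q (\bigcup_n F n) - pr Q (F n).
    have prS B : measurable B -> pr Q B = pr Q (shift_nat h%:Z @^-1` B).
      by move=> mB; rewrite /pr (geo_shift _ mB).
    rewrite (prS _ mU) (prS _ (mF n)) -!prD//; try exact: mSC; try exact: mS.
    + apply: le_pr; [by apply: measurableD; exact: mSC|by apply: measurableD; exact: mS|].
      by move=> x /= [[a b] c]; split=> // ?; apply: c.
    + by move=> x /s1.
    + by move=> x [/s1].
  have sp : pr Q (shift_nat h%:Z @^-1` F n `&` C) <=
      pr Q (shift_nat h%:Z @^-1` (\bigcup_n F n) `&` C).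
    by apply: le_pr; [exact: mSC|exact: mSC|move=> x [/s1]].
  rewrite -/C in hn *.
  move: hn Fn; rewrite !ler_norml => /andP[h1 h2] /andP[h3 h4].
  move: le1 => /andP[c0 c1]; apply/andP; split; nra.
Unshelve. all: by end_near. Qed.

(** By mixing, an invariant event is independent of every cylinder, hence of itself, and its
    probability solves p = p^2. *)
Lemma geo_ergodic A : measurable A -> (forall x, A (shift_nat 1 x) <-> A x) ->
  Q A = 0%E \/ Q A = 1%E.
Proof.
move=> mA invA.
have invh (h : nat) : shift_nat h%:Z @^-1` A = A.
  apply/seteqP; suff h_inv x : A (shift_nat h%:Z x) <-> A x by split=> x; [move=> /h_inv|move=> ?; apply/h_inv].
  elim: h x => [|h IH] x.
    by have -> : shift_nat 0%:Z x = x by apply/funext => i; rewrite /shift_nat addr0.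
  have -> : shift_nat h.+1%:Z x = shift_nat 1 (shift_nat h%:Z x).
    by apply/funext => i; rewrite /shift_nat intS; congr (x _); ring.
  by rewrite invA.
have indA J v : pr Q (point_cylinder J v `&` A) = pr Q (point_cylinder J v) * pr Q A.
  have := geo_mixing (K := J) (u := v) mA; under eq_fun do rewrite invh.
  rewrite setIC [RHS]mulrC => h.
  by apply: (cvg_unique _ _ h) => //; exact: cvg_cst.
have : pr Q (A `&` A) = pr Q A * pr Q A.
  apply: (independence_induction (F := id) point_cylinders_generate point_cylinders_setI
     _ mA _ mA) => // _ [->|[J [v ->]]]; last exact: indA.
  by rewrite preimage_set0 set0I pr0 mul0r.
rewrite setIid => /eqP; rewrite -subr_eq0 -{1}[pr Q A]mulr1 -mulrBr mulf_eq0.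
move=> /orP[/eqP h|]; [left|rewrite subr_eq0 => /eqP h; right]; rewrite -EFin_pr//.
  by rewrite h.
by rewrite -h.
Qed.

End geometric_process.

Section conditional_expectation_uniqueness.
Context d (T : measurableType d) (R : realType) (P : probability T R).

(** The event where the inequality fails belongs to the sigma-algebra, so the two versions have the
    same integral over it. *)
Lemma is_cond_exp_le_ae (G0 : set (set T)) (Z Y Y' : T -> R) :
  <<s G0 >> `<=` measurable ->
  is_cond_exp P <<s G0 >> Z Y -> is_cond_exp P <<s G0 >> Z Y' ->
  {ae P, forall w, Y w <= Y' w}.
Proof.
move=> Gm [iY mY hY] [iY' mY' hY'].
pose TG := g_sigma_algebraType G0.
have sE : <<s G0 >> [set w | Y' w < Y w].
  have := @measurable_fun_ltr _ TG R setT Y' Y.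
  move=> h; rewrite -[X in <<s G0 >> X]setTI; apply: h => //.
    by move=> _ B mB; rewrite setTI; exact: mY'.
  by move=> _ B mB; rewrite setTI; exact: mY.
have mE := Gm _ sE; have iD := EFin_integrableB iY iY'.
suff : P.-negligible [set w | Y' w < Y w].
  by apply: negligibleS => w /= /negP; rewrite -ltNge.
apply: (Rintegral_le0_null mE iD); first by move=> w /=; rewrite subr_gt0.
rewrite (RintegralB mE (EFin_integrableS mE iY) (EFin_integrableS mE iY')).
by rewrite subr_le0 /Rintegral hY// hY'.
Qed.

Lemma is_cond_exp_ae (G0 : set (set T)) (Z Y Y' : T -> R) :
  <<s G0 >> `<=` measurable ->
  is_cond_exp P <<s G0 >> Z Y -> is_cond_exp P <<s G0 >> Z Y' ->
  {ae P, forall w, Y w = Y' w}.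
Proof.
move=> Gm hY hY'.
apply: filterS2 (is_cond_exp_le_ae Gm hY hY') (is_cond_exp_le_ae Gm hY' hY) => w h1 h2.
by apply/eqP; rewrite eq_le h1.
Qed.

End conditional_expectation_uniqueness.

Section exact_past.
Context d (T : measurableType d) (R : realType) (P : probability T R).
Variable X : int -> {RV P >-> R}.
Hypothesis stX : stationary X.
Hypothesis EX2 : ('E_P[fun w => (`|X 0 w| ^+ 2)%R] < +oo)%E.
Notation sp := (sample_path X).
Notation past_at n w := (past (return_path n (sp w))).
Notation full_sigma n := (vector_sigma (@measurable _ R) (fun w => lambda (sp w) n)
  (fun i w => X i w)).

(** By the law of the returned path [e] has the right integrals over all events of the past seen at
    lambda_n. In general [e] reads beyond the block; when it does not, as in the example, it gives
    the conditional expectation. *)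
Lemma cond_exp_full_regression (e : (nat -> R) -> R) n : regression X e ->
  (forall B : set R, measurable B -> full_sigma n [set w | B (e (past_at n w))]) ->
  {ae P, forall w, cond_exp_full X n w = e (past_at n w)}.
Proof.
move=> [me ie he] mfe; have iZ := integrable_next_value stX EX2 n.
have law : forall B, measurable B ->
    distribution P (return_past_rv X n) B = distribution P (past_rv X) B.
  exact: (past_at_law stX n).
have iep : (distribution P (past_rv X)).-integrable setT (EFin \o e).
  exact: integrable_distribution.
have iea : P.-integrable setT (EFin \o (fun w => e (past_at n w))).
  have h := same_law_integrable (fun B mB => esym (law B mB)) iep.
  move: h => /integrableP[_ fin]; apply/integrableP; split.
    apply/measurable_EFinP => _ B mB; rewrite setTI.
    exact: full_sigma_measurable (mfe B mB).
  move: fin; rewrite ge0_integral_pushforward//=.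
  - exact: (measurable_funPT (return_past_rv X n)).
  - by apply/measurable_EFinP; apply: measurableT_comp.
have int_at (A : set (@paths R nat)) : measurable A ->
    \int[P]_(w in [set w | A (past_at n w)]) e (past_at n w) =
    \int[P]_(w in [set w | A (past_at n w)]) next_value (sp w) n.
  move=> mA; rewrite (Rintegral_past_at stX EX2 n mA) -he//.
  rewrite -(Rintegral_distribution (F := return_past_rv X n) mA me iea).
  rewrite -(Rintegral_distribution (F := past_rv X) mA me ie).
  exact: same_law_Rintegral.
apply: (is_cond_exp_ae (@full_sigma_measurable _ _ _ _ X n)).
  exact: (cond_expP (@full_sigma_measurable _ _ _ _ X n) iZ).
split=> // A sA; have mA := full_sigma_measurable sA.
have [A' mA' hA'] := full_sigma_past sA.
have mA2 := measurable_past_at X n mA'.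
rewrite (EFin_Rintegral mA iea) (EFin_Rintegral mA iZ); congr EFin.
have aeA : {ae P, forall w, A w <-> A' (past_at n w)}.
  by apply: filterS (regular_ae stX) => w; exact: hA'.
transitivity (\int[P]_(w in [set w | A' (past_at n w)]) e (past_at n w)).
  by apply: ae_eq_Rintegral_set => //; apply: filterS aeA => w; split.
rewrite int_at//; apply/esym.
by apply: ae_eq_Rintegral_set => //; apply: filterS aeA => w; split.
Qed.

End exact_past.

(** * The Markov chain of part (3) *)

Section markov_example.
Context {R : realType}.
Notation Q := (@geo_prob R).

Definition jump (k : nat) : R := if k is 0%N then 0 else 2 ^- (2 ^ k.+1).

Definition state (a k : nat) : R := (a != 0%N)%:R / 2 + jump k.

Lemma jump_gt0 k : (0 < k)%N -> 0 < jump k.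
Proof. by case: k => // k _; rewrite /jump invr_gt0 exprn_gt0. Qed.

Lemma jump_ge0 k : 0 <= jump k.
Proof. by case: k => // k; rewrite ltW// jump_gt0. Qed.

Lemma jump_le k : jump k <= 16^-1.
Proof.
case: k => [|k]; first by rewrite /= invr_ge0.
rewrite /jump (_ : 16 = 2 ^+ (2 ^ 2)); last by rewrite -natrX.
by rewrite lef_pV2 ?posrE ?exprn_gt0// ler_eXn2l ?ltr1n// leq_exp2l.
Qed.

Lemma jump_inj : injective jump.
Proof.
move=> [|k] [|l] //.
- by move=> h; have := jump_gt0 (ltn0Sn l); rewrite -h ltxx.
- by move=> h; have := jump_gt0 (ltn0Sn k); rewrite h ltxx.
rewrite /jump => /invr_inj h; congr S; apply/eqP.
have /eqP : (2 ^ (2 ^ k.+2) = 2 ^ (2 ^ l.+2))%N.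
  by apply/eqP; rewrite -(eqr_nat R) !natrX; apply/eqP.
by rewrite !eqn_exp2l.
Qed.

(** Jumps are at most 1/16 and cannot bridge the gap 1/2, so a value of the chain reveals its second
    argument and whether the first is 0. *)
Lemma state_inj a k b l : state a k = state b l ->
  k = l /\ (a == 0%N) = (b == 0%N).
Proof.
rewrite /state => h; suff ab : (a == 0%N) = (b == 0%N).
  by split=> //; apply: jump_inj; move: h; rewrite ab => /addrI.
have := jump_ge0 k; have := jump_ge0 l; have := jump_le k; have := jump_le l.
move: h; case: (a == 0%N); case: (b == 0%N) => //= h; lra.
Qed.

Lemma state01 a k : 0 <= state a k <= 1.
Proof.
have := jump_ge0 k; have := jump_le k; rewrite /state.
case: (a == 0%N) => /= h1 h2; apply/andP; split; lra.
Qed.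

Lemma measurable_chain i :
  measurable_fun setT (fun x : nat_paths => state (x (i - 1)) (x i)).
Proof.
exact: (measurable_discrete_comp (fun p : nat * nat => state p.1 p.2)
  (discrete_fun_pair (discrete_coord (i - 1)) (discrete_coord i))).
Qed.

Definition chain (i : int) : {RV Q >-> R} := to_mfun (measurable_chain i).

Lemma chainE i x : chain i x = state (x (i - 1)) (x i).
Proof. by []. Qed.

Notation sp := (sample_path chain).

Definition states : set R := range (fun p : nat * nat => state p.1 p.2).

Lemma countable_states : countable states.
Proof. by apply: (sub_countable (card_image_le _ _)). Qed.

Lemma chain_shift h x : (fun i => chain (i + h) x) = sp (shift_nat h x).
Proof.
apply/funext => i; rewrite /sample_path !chainE /shift_nat.
by congr (state (x _) _); ring.
Qed.

Lemma chain_stationary : stationary chain.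
Proof.
move=> h A pA; rewrite -[RHS](geo_shift h (measurable_path_event chain pA)).
by congr (Q _); apply/seteqP; split=> x; rewrite /= chain_shift.
Qed.

Lemma chain_ergodic : ergodic chain.
Proof.
move=> A pA invA; apply: (geo_ergodic (measurable_path_event chain pA)) => x.
by rewrite /= -chain_shift -(invA (sp x)).
Qed.

(** One constant serves every event [H] of the past inside [chain n = s]: the value [s] determines
    Z_n, and Z_{n+1} is independent of [H]. Both conditional probabilities in the Markov property
    are instances. *)
Lemma chain_transition n (s t : R) : exists c : R, forall H : set nat_paths,
  measurable H -> (forall x, H x <-> H (cut (n + 1) x)) ->
  H `<=` [set x | chain n x = s] -> (0 < Q H)%E ->
  cond_prob Q [set x | chain (n + 1) x = t] H = c.
Proof.
have [[x0 x0s]|no] := pselect (exists x, chain n x = s); last first.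
  exists 0 => H _ _ Hs H0; exfalso; move: H0.
  suff -> : H = set0 by rewrite measure0 ltxx.
  by apply/seteqP; split=> // x Hx; apply: no; exists x; exact: Hs.
have xn x : chain n x = s -> chain (n + 1) x = state (x0 n) (x (n + 1)).
  move=> xs; have [xE _] := state_inj (etrans xs (esym x0s)).
  by rewrite chainE addrK xE.
have [[l lt]|no] := pselect (exists l, state (x0 n) l = t); last first.
  exists 0 => H _ _ Hs _; rewrite /cond_prob (_ : _ `&` _ = set0) ?measure0 ?mul0r//.
  apply/seteqP; split=> // x [/= xt /Hs /xn xE].
  by apply: no; exists (x (n + 1)); rewrite -xE.
exists (2 ^- l.+1) => H mH Hcut Hs H0.
have HE : H = cut (n + 1) @^-1` H by apply/seteqP; split=> x; [exact: (Hcut x).1|exact: (Hcut x).2].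
rewrite /cond_prob.
have -> : [set x | chain (n + 1) x = t] `&` H =
    cut (n + 1) @^-1` H `&` [set x | x (n + 1) = l].
  apply/seteqP; split=> x.
    move=> [xt Hx]; split; first exact: (Hcut x).1.
    by have := xn _ (Hs _ Hx); rewrite (xt : chain (n + 1) x = t) -lt => /state_inj[].
  move=> [Hx xl]; have {}Hx : H x := (Hcut x).2 Hx.
  by split=> //; rewrite -lt -xl; exact: (xn _ (Hs _ Hx)).
rewrite -/(pr Q _) -/(pr Q _) (cut_indep _ _ mH) -HE mulrAC mulfV ?mul1r//.
by rewrite gt_eqF// -lte_fin EFin_pr.
Qed.

Lemma chain_markov : markov_chain chain.
Proof.
move=> n k s t H H0; have [c hc] := chain_transition n (s 0%N) t.
have mH j : measurable [set w | forall i : nat, (i <= j)%N -> chain (n - i%:Z) w = s i].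
  apply: (@measurable_forall _ _ _
    (fun (i : nat) (w : nat_paths) => (i <= j)%N -> chain (n - i%:Z) w = s i)) => i.
  apply: measurable_imp; first exact: measurable_prop.
  by have := measurable_preimageT (measurable_chain (n - i%:Z)) (measurable_set1 (s i)).
have Hcut j x : (forall i : nat, (i <= j)%N -> chain (n - i%:Z) x = s i) <->
    (forall i : nat, (i <= j)%N -> chain (n - i%:Z) (cut (n + 1) x) = s i).
  have cE (i : nat) : chain (n - i%:Z) (cut (n + 1) x) = chain (n - i%:Z) x.
    rewrite !chainE /cut !ifT//; lia.
  by split=> h i ij; [rewrite cE|rewrite -cE]; exact: h.
rewrite (hc H) //; [|exact: mH|exact: Hcut|by move=> x /(_ 0%N isT); rewrite subr0].
have -> : [set w | chain n w = s 0%N] =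
    [set w | forall i : nat, (i <= 0)%N -> chain (n - i%:Z) w = s i].
  apply/seteqP; split=> w /= h; last by have := h 0%N isT; rewrite subr0.
  by move=> i; rewrite leqn0 => /eqP ->; rewrite subr0.
rewrite hc//; [exact: Hcut|by move=> x /(_ 0%N isT); rewrite subr0|].
apply: lt_le_trans H0 _; apply: le_measure; rewrite ?inE; [exact: mH|exact: mH|].
by move=> x h i; rewrite leqn0 => /eqP ->; exact: h.
Qed.

Lemma chain_square_integrable : ('E_Q[fun w => (`|chain 0 w| ^+ 2)%R] < +oo)%E.
Proof.
rewrite unlock; apply: (@le_lt_trans _ _ (\int[Q]_w (cst 1%E w))%E).
  apply: ge0_le_integral => //.
  - apply/measurable_EFinP; apply: measurable_funX; apply: measurableT_comp => //.
  - move=> x _; rewrite lee_fin exprn_ile1// chainE.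
    by have /andP[h1 h2] := state01 (x (0 - 1)) (x 0); rewrite ger0_norm.
apply: (le_lt_trans (y := 1%E)); last exact: ltry.
by rewrite integral_cst// mul1e; exact: probability_le1.
Qed.

End markov_example.

Lemma bounded_integrable d (T : measurableType d) (R : realType)
    (P : probability T R) (g : T -> R) (c : R) :
  measurable_fun setT g -> (forall x, `|g x| <= c) -> P.-integrable setT (EFin \o g).
Proof.
move=> mg gc; apply: (@dominated_integrable _ _ _ _ g (cst c)) => //.
exact: finite_measure_integrable_cst.
Qed.

Section markov_example_regression.
Context {R : realType}.
Notation Q := (@geo_prob R).
Notation chain := (@chain R).
Notation state := (@state R).
Notation jump := (@jump R).
Notation sp := (sample_path chain).

Definition jump_mean : R := \int[Q]_x jump (x 1).

Definition predictor (y : nat -> R) : R :=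
  (~~ ((y 0%N == 0) || (y 0%N == 2^-1)))%:R / 2 + jump_mean.

Lemma state_low a k : (state a k == 0) || (state a k == 2^-1) = (k == 0%N).
Proof.
have s00 : state 0 0 = 0 by rewrite /state/= mul0r addr0.
have s10 : state 1 0 = 2^-1 by rewrite /state/= mul1r addr0.
rewrite -[X in _ == X]s00 -[X in _ || (_ == X)]s10.
apply/orP/eqP => [[/eqP/state_inj[]|/eqP/state_inj[]]//|->].
by case: a => [|a]; [left|right]; rewrite /state /= ?eqxx.
Qed.

Lemma predictor_state (y : nat -> R) a k : y 0%N = state a k ->
  predictor y = (k != 0%N)%:R / 2 + jump_mean.
Proof. by rewrite /predictor => ->; rewrite state_low. Qed.

Lemma measurable_predictor : measurable_fun setT (predictor : @paths R nat -> R).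
Proof.
pose b (y : @paths R nat) := (y 0%N == 0) || (y 0%N == 2^-1).
have mb : discrete_fun b.
  have mt : measurable [set y | b y].
    rewrite (_ : [set _ | _] = [set y : @paths R nat | y 0%N = 0 \/ y 0%N = 2^-1]).
      by apply: measurable_disj;
        exact: measurable_preimageT (measurable_coord _) (measurable_set1 _).
    apply/seteqP; split=> y /=; rewrite /b; last by move=> [->|->]; rewrite eqxx ?orbT.
    by move=> /orP[/eqP ->|/eqP ->]; [left|right].
  case; first by rewrite (_ : [set _ | _] = [set y | b y]).
  rewrite (_ : [set _ | _] = ~` [set y | b y]); first exact: measurableC.
  by apply/seteqP; split=> y /= => [->//|/negP/negbTE].
exact: (measurable_discrete_comp (fun c : bool => (~~ c)%:R / 2 + jump_mean) mb).
Qed.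

Lemma measurable_jump i : measurable_fun setT (fun x : nat_paths => jump (x i)).
Proof. exact: (measurable_discrete_comp jump (discrete_coord i)). Qed.

Lemma integrable_jump i : Q.-integrable setT (EFin \o (fun x : nat_paths => jump (x i))).
Proof.
apply: (@bounded_integrable _ _ _ Q _ 16^-1); first exact: measurable_jump.
by move=> x; rewrite ger0_norm ?jump_ge0// jump_le.
Qed.

Lemma past_cut x : past (sp (cut 1 x)) = past (sp x).
Proof.
apply/funext => i; rewrite /past /sample_path !chainE /cut !ifT//; lia.
Qed.

(** The covariance of the next jump with an event of the past vanishes: conditioning on the value of
    Z_1 leaves the probability of that event unchanged. *)
Lemma jump_orth (A : set (@paths R nat)) : measurable A ->
  let D := [set x : nat_paths | A (past (sp x))] in
  \int[Q]_x (jump (x 1) * (\1_D x - pr Q D)) = 0.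
Proof.
move=> mA D.
have mD : measurable D.
  exact: measurable_path_event (measurable_preimageT measurable_past mA).
have mf : measurable_fun setT (fun x => \1_D x - pr Q D).
  by apply: measurable_funB => //; exact: measurable_indic.
have f1 x : `|\1_D x - pr Q D| <= 1.
  have := pr_ge0 Q D; have := @le_pr _ _ _ Q _ _ mD measurableT (@subsetT _ _).
  by rewrite prT ler_norml indicE; case: (x \in D) => /= h1 h2; apply/andP; split; lra.
apply: (Rintegral_orth (discrete_coord 1)).
- by move=> x y ->.
- exact: bounded_integrable mf f1.
- apply: (@bounded_integrable _ _ _ Q _ 16^-1).
    by apply: measurable_funM => //; exact: measurable_jump.
  move=> x; rewrite normrM -[leRHS]mulr1; apply: ler_pM => //.
  by rewrite ger0_norm ?jump_ge0// jump_le.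
move=> c; have mc := measurable_value 1 c.
have ii : Q.-integrable setT (EFin \o \1_D).
  apply: (@bounded_integrable _ _ _ Q _ 1); first exact: measurable_indic.
  by move=> x; rewrite indicE ger0_norm//; case: (x \in D).
have ic : Q.-integrable setT (EFin \o cst (pr Q D)) by exact: finite_measure_integrable_cst.
rewrite (RintegralB mc (EFin_integrableS mc ii) (EFin_integrableS mc ic)).
rewrite Rintegral_cst//; apply/eqP; rewrite subr_eq0; apply/eqP.
transitivity (pr Q (D `&` [set x | x 1 = c])).
  by rewrite /Rintegral integral_indic//.
have -> : D = cut 1 @^-1` D.
  by apply/seteqP; split=> x; rewrite /D/= past_cut.
by rewrite (cut_indep 1 c mD) -(pr_value (R := R) 1 c) /= .
Qed.

Lemma chain_regression : regression chain predictor.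
Proof.
have e_past x : predictor (past (sp x)) = (x 0 != 0%N)%:R / 2 + jump_mean.
  apply: (@predictor_state _ (x (0 - 1))).
  by rewrite /past /sample_path chainE oppr0.
have me : measurable_fun setT (fun x => predictor (past (sp x))).
  exact: measurableT_comp measurable_predictor
    (measurableT_comp measurable_past (measurable_sample_path chain)).
have ie : Q.-integrable setT (EFin \o (fun x => predictor (past (sp x)))).
  apply: (@bounded_integrable _ _ _ Q _ (1 + `|jump_mean|)) => // x.
  rewrite e_past; apply: (le_trans (ler_normD _ _)); rewrite lerD2r.
  by rewrite ger0_norm; case: (x 0 == 0%N) => /=; lra.
split=> //; first exact: measurable_predictor.
move=> A mA; set D := [set x : nat_paths | A (past (sp x))].
have mD : measurable D.
  exact: measurable_path_event (measurable_preimageT measurable_past mA).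
have i1 := integrable_coord (@chain_stationary R) (@chain_square_integrable R) 1.
apply/eqP; rewrite eq_sym -subr_eq0; apply/eqP.
rewrite -(RintegralB mD (EFin_integrableS mD i1) (EFin_integrableS mD ie)).
rewrite Rintegral_indic.
have ii : Q.-integrable setT (EFin \o \1_D).
  apply: (@bounded_integrable _ _ _ Q _ 1); first exact: measurable_indic.
  by move=> x; rewrite indicE ger0_norm//; case: (x \in D).
(* The indicators cancel in [chain 1] minus the predictor, leaving [jump (x 1) - jump_mean] on [D].
   The split isolates the covariance; the rest has mean 0. *)
transitivity (\int[Q]_x (jump (x 1) * (\1_D x - pr Q D) +
    (pr Q D * jump (x 1) - jump_mean * \1_D x))).
  apply: eq_Rintegral => x _; rewrite e_past.
  have -> : chain 1 x = (x 0 != 0%N)%:R / 2 + jump (x 1) by [].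
  ring.
have i0 : Q.-integrable setT (EFin \o (fun x => jump (x 1) * (\1_D x - pr Q D))).
  have iB : Q.-integrable setT (EFin \o (fun x => \1_D x * jump (x 1) - pr Q D * jump (x 1))).
    apply: EFin_integrableB; last exact/EFin_integrableZ/integrable_jump.
    apply: (@bounded_integrable _ _ _ Q _ 16^-1).
      by apply: measurable_funM; [exact: measurable_indic|exact: measurable_jump].
    move=> x; rewrite indicE; case: (x \in D) => /=; rewrite ?mul1r ?mul0r ?normr0//.
    by rewrite ger0_norm ?jump_ge0// jump_le.
  by apply: eq_integrable iB => // x _ /=; congr EFin; ring.
have ia := EFin_integrableZ (pr Q D) (integrable_jump 1).
have ib := EFin_integrableZ jump_mean ii.
rewrite (RintegralD measurableT i0 (EFin_integrableB ia ib)) jump_orth// add0r.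
rewrite (RintegralB measurableT ia ib) !RintegralZl//; last exact: integrable_jump.
rewrite -/jump_mean mulrC; apply/eqP; rewrite subr_eq0; apply/eqP; congr (_ * _).
by rewrite /Rintegral integral_indic// setIT.
Qed.

End markov_example_regression.

(** * Runs of zeros at the return times *)

Section markov_example_runs.
Context {R : realType}.
Notation Q := (@geo_prob R).
Notation chain := (@chain R).
Notation state := (@state R).
Notation jump := (@jump R).
Notation sp := (sample_path chain).
Notation fut x := (future (sp x)).

(* [low n k] says that a chain value with second coordinate k lies in the same
   cell of level n as one with second coordinate 0. *)
Definition low (n k : nat) : bool := (k == 0%N) || (n < 2 ^ k.+1)%N.

Lemma jump_low n k : (jump k < 2 ^- n) = low n k.
Proof.
case: k => [|k]; first by rewrite /low/= invr_gt0 exprn_gt0.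
by rewrite /low /= ltf_pV2 ?posrE ?exprn_gt0// ltr_eXn2l ?ltr1n.
Qed.

Lemma qindex_state0 n (y : R) b : (0 < n)%N ->
  qindex n y = qindex n (state b 0) <-> state b 0 <= y < state b 0 + 2 ^- n.
Proof.
case: n => // n _.
have sE : (qindex n.+1 (state b 0))%:~R * 2 ^- n.+1 = state b 0.
  have -> : qindex n.+1 (state b 0) = ((b != 0%N) * 2 ^ n)%N.
    rewrite /qindex /state/= addr0 (_ : _ * _ = ((b != 0%N) * 2 ^ n)%N%:R).
      by rewrite pmulrn intrKfloor.
    by rewrite natrM natrX exprS mulrA divfK.
  rewrite -pmulrn natrM natrX exprS invfM mulrACA /state/= addr0.
  by rewrite mulfV ?mulr1// expf_neq0// pnatr_eq0.
by rewrite -cellP /cell/= intrD mulrDl sE mul1r.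
Qed.

Lemma qindex_low n a k : (0 < n)%N -> low n k ->
  qindex n (state a k) = qindex n (state a 0).
Proof.
move=> n0; rewrite -jump_low => jn; apply/qindex_state0 => //.
by rewrite /state /= addr0 lerDl jump_ge0 ltrD2l.
Qed.

Lemma low_qindex n a b k : (0 < n)%N ->
  qindex n (state a k) = qindex n (state b 0) -> low n k.
Proof.
move=> n0 /qindex_state0 => /(_ n0) /andP[h1 h2]; rewrite -jump_low.
have n2 : 2 ^- n <= 2^-1 :> R.
  by rewrite lef_pV2 ?posrE ?exprn_gt0// -[leLHS]expr1 ler_eXn2l ?ltr1n.
have := jump_ge0 (R := R) k; have := jump_le (R := R) k.
move: h1 h2; rewrite /state/=.
by case: (a == 0%N); case: (b == 0%N) => /= h1 h2 j1 j2; lra.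
Qed.

Definition zero_run N M (x : nat_paths) :=
  forall j, (N <= j < M)%N -> x (lam (fut x) j) = 0%N.

Lemma futE (x : nat_paths) (i : nat) : fut x i = state (x (i%:Z - 1)) (x i).
Proof. by []. Qed.

(** The block ending at lambda_M copies, at level [M], the one ending at lambda_{M-1}, whose last
    value has second coordinate 0. *)
Lemma zero_run_low N M x : (N < M)%N -> good M (fut x) -> zero_run N M x ->
  low M (x (lam (fut x) M)).
Proof.
case: M => // M NM gM zM; have [[_ h] _] := lam_step gM.
have := h _ (leqnn _); rewrite subnK; last exact: lam_le.
rewrite !futE (zM M) ?ltnSn ?andbT//; exact: low_qindex.
Qed.

Definition run_event N M l : set nat_paths :=
  [set x | [/\ good M (fut x), lam (fut x) M = l & zero_run N M x]].

Lemma lam_lt n m (u : nat -> R) : good m u -> (n < m)%N -> (lam u n < lam u m)%N.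
Proof.
move=> g nm; apply: leq_trans (lam_le u nm); apply: lam_ltS.
exact: goodW g.
Qed.

(** All low values at [l] lie in one cell of level [M] and leave the quantized block unchanged, and
    the run concerns times before [l] only. So the event depends on coordinate [l] just through
    being low, which brings in independence. *)
Lemma run_event_local N M l (x y : nat_paths) : (0 < M)%N ->
  (forall i : int, i < l%:Z -> x i = y i) -> low M (x l) -> low M (y l) ->
  run_event N M l x -> run_event N M l y.
Proof.
move=> M0 xy lx ly [gx lM zx].
have q : qagree M (lam (fut x) M) (fut x) (fut y).
  move=> i; rewrite lM leq_eqVlt => /orP[/eqP ->|il].
    rewrite !futE (xy (l%:Z - 1)); last by lia.
    by rewrite (qindex_low _ M0 lx) (qindex_low _ M0 ly).
  by rewrite !futE !xy //; lia.
have [gy ly'] := good_local gx q.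
split=> //; first by rewrite ly'.
move=> j /andP[Nj jM]; rewrite ly' ?(ltnW jM)// -xy; first by apply: zx; rewrite Nj.
by rewrite ltz_nat -lM; exact: lam_lt gx jM.
Qed.

Lemma run_event_cut N M l x : (N < M)%N ->
  run_event N M l x <-> run_event N M l (cut l x) /\ low M (x l).
Proof.
move=> NM; have M0 : (0 < M)%N by exact: leq_ltn_trans NM.
have cx i : i < l%:Z -> x i = cut l x i by rewrite /cut => ->.
have lc : low M (cut l x l) by rewrite /cut ltxx.
split=> [rx|[rx lx]].
  have lx : low M (x l) by case: rx => gx <- zx; exact: zero_run_low zx.
  by split=> //; exact: run_event_local rx.
by apply: run_event_local rx => // i il; rewrite -cx.
Qed.

Lemma measurable_fut i : measurable_fun setT (fun x : nat_paths => fut x i).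
Proof. exact: measurable_chain. Qed.

Lemma measurable_zero_run N M : measurable [set x : nat_paths | zero_run N M x].
Proof.
apply: measurable_forall => j; apply: measurable_imp; first exact: measurable_prop.
apply: (@discrete_fun_dep _ _ _ _ (fun (l : nat) (x : nat_paths) => x l = 0%N)).
  exact: (@discrete_fun_lam _ _ _ (fun i x => fut x i) measurable_fut).
by move=> l; exact: discrete_coord.
Qed.

Lemma measurable_run_event N M l : measurable (run_event N M l).
Proof.
rewrite (_ : run_event N M l = [set x | good M (fut x) /\
    (lam (fut x) M = l /\ zero_run N M x)]).
  apply: measurable_conj; first exact: (@measurable_good _ _ _ (fun i x => fut x i) measurable_fut).
  apply: measurable_conj; last exact: measurable_zero_run.
  exact: (@discrete_fun_lam _ _ _ (fun i x => fut x i) measurable_fut).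
by apply/seteqP; split=> x; [move=> [a b c]|move=> [a [b c]]].
Qed.

Lemma run_event_decay N M l : (N < M)%N -> (1 < M)%N ->
  M.+1%:R * pr Q (run_event N M l `&` [set x | x l = 0%N]) <=
  M%:R * pr Q (run_event N M l).
Proof.
move=> NM M1; set V := run_event N M l; have mV : measurable V := measurable_run_event N M l.
(* [M < 2 ^ k.+1] makes [k] low, and [2 ^ k <= M] makes its mass 2^-(k+1) at least 1/(2M). So 0, of
   mass 1/2, has conditional probability at most M/(M+1) among the low values. *)
pose k := trunc_log 2 M; have /andP[kM Mk] := trunc_log_bounds (isT : (1 < 2)%N) (ltnW M1).
have k0 : (0 < k)%N by rewrite trunc_log_gt0.
have mVk j : measurable (cut l @^-1` V `&` [set x | x l = j]).
  by apply: measurableI; [exact: measurable_preimageT (measurable_cut l) mV|exact: measurable_value].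
have -> : V `&` [set x | x l = 0%N] = cut l @^-1` V `&` [set x | x l = 0%N].
  apply/seteqP; split=> x [Vx x0]; split=> //; first by case/(run_event_cut l x NM): Vx.
  by apply/(run_event_cut l x NM); split=> //; rewrite x0.
have VU : pr Q (cut l @^-1` V `&` [set x | x l = 0%N]) +
    pr Q (cut l @^-1` V `&` [set x | x l = k]) <= pr Q V.
  rewrite -prU//; last first.
    apply/seteqP; split=> // x [[_ x0] [_ xk]]; move: k0.
    by rewrite -xk x0.
  apply: le_pr => //; first exact: measurableU.
  move=> x [] [Vx xk]; apply/(run_event_cut l x NM); split=> //; rewrite xk//.
  by rewrite /low Mk orbT.
move: VU; rewrite !(cut_indep _ _ mV); set q := pr Q (cut l @^-1` V) => VU.
have q0 : 0 <= q by exact: pr_ge0.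
have hk : 2^-1 <= M%:R * 2 ^- k.+1 :> R.
  rewrite exprS invfM mulrCA ler_pMr ?invr_gt0// ler_pdivlMr ?exprn_gt0// mul1r.
  by rewrite -natrX ler_nat.
apply: (@le_trans _ _ (M%:R * (q * 2 ^- 1 + q * 2 ^- k.+1))); last exact: ler_wpM2l.
rewrite expr1 -natr1; nra.
Qed.

End markov_example_runs.

Lemma measure_fibers d (T : measurableType d) (R : realType) (P : probability T R)
    (L : T -> nat) (A : set T) : discrete_fun L -> measurable A ->
  P A = (\sum_(l <oo) P (A `&` [set x | L x = l]))%E.
Proof.
move=> mL mA; rewrite -measure_semi_bigcup.
- by congr (P _); apply/seteqP; split=> x; [exists (L x)|case=> l _ []].
- by move=> l; exact: measurableI.
- by apply/trivIsetP => i j _ _ ij; apply/seteqP; split=> // x [[_ /= xi] [_ /= xj]];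
    move: ij; rewrite -xi -xj eqxx.
- by apply: bigcup_measurable => l _; exact: measurableI.
Qed.

Lemma measurable_estimate d (T : measurableType d) (R : realType) (P : probability T R)
    (X : int -> {RV P >-> R}) (f : nat -> set R -> R) n :
  measurable_fun setT (fun w => estimate f (sample_path X w) n).
Proof.
apply: measurable_funM => //; apply: measurable_sum => j.
apply: (measurable_discrete_comp (fun c => f j (cell j c))
  (discrete_fun_qindex j (measurable_next_value X j))).
Qed.

Section markov_example_failure.
Context {R : realType}.
Notation Q := (@geo_prob R).
Notation chain := (@chain R).
Notation state := (@state R).
Notation sp := (sample_path chain).
Notation fut x := (future (sp x)).

Lemma zero_run_decay N M : (N < M)%N -> (1 < M)%N ->
  M.+1%:R * pr Q [set x | zero_run (R := R) N M.+1 x] <=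
  M%:R * pr Q [set x | zero_run (R := R) N M x].
Proof.
move=> NM M1.
have mL : discrete_fun (fun x : nat_paths => lam (fut x) M).
  exact: (@discrete_fun_lam _ _ _ (fun i x => fut x i) measurable_fut).
have mZ K := @measurable_zero_run R N K.
rewrite -lee_fin !EFinM !EFin_pr// (measure_fibers _ mL (mZ M)) (measure_fibers _ mL (mZ M.+1)).
rewrite -!nneseriesZl//; apply: lee_nneseries => // l _.
  by rewrite mule_ge0// lee_fin.
have gQ := good_ae (@chain_stationary R).
have mV := @measurable_run_event R N M l.
have mV0 := measurableI _ _ mV (measurable_value l 0).
have -> : Q ([set x | zero_run (R := R) N M x] `&` [set x | lam (fut x) M = l]) =
    Q (run_event (R := R) N M l).
  apply: (probability_ae_eq _ mV gQ) => [|x gx]; first exact: measurableI.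
  by split=> [[? ?]|[? ? ?]].
have -> : Q ([set x | zero_run (R := R) N M.+1 x] `&` [set x | lam (fut x) M = l]) =
    Q (run_event (R := R) N M l `&` [set x | x l = 0%N]).
  apply: (probability_ae_eq _ mV0 gQ) => [|x gx]; first exact: measurableI.
  split=> [[/= zx lM]|[[_ lM zx] /= xl]].
    split; last by rewrite /= -lM; apply: zx; rewrite ltnW// ltnSn.
    by split=> // j /andP[Nj jM]; apply: zx; rewrite Nj ltnW.
  split=> // j /andP[Nj]; rewrite ltnS leq_eqVlt => /orP[/eqP ->|jM]; first by rewrite lM.
  by apply: zx; rewrite Nj.
by rewrite -!EFin_pr// -!EFinM lee_fin; exact: run_event_decay.
Qed.

Lemma zero_runs_end_ae : {ae Q, forall x, forall N : nat,
  exists j, (N <= j)%N /\ x (lam (fut x) j) <> 0%N}.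
Proof.
(* From [M0] on, [zero_run_decay] makes [M] times the probability of a run up to [M] nonincreasing,
   so this probability is at most [M0 / M]. *)
apply: ae_forall => N; pose M0 := (maxn N 1).+1.
pose Z := [set x : nat_paths | forall M, zero_run (R := R) N M x].
have mZ : measurable Z.
  by apply: measurable_forall => M; exact: measurable_zero_run.
suff : Q.-negligible Z.
  apply: negligibleS => x /= h M j /andP[Nj _]; apply: contrapT => xj.
  by apply: h; exists j.
exists Z; split=> //; apply: nonneg_small_eq0; first exact: measure_ge0.
have bound k : (M0 + k)%N%:R * pr Q [set x | zero_run (R := R) N (M0 + k) x] <= M0%:R.
  elim: k => [|k IH].
    rewrite addn0 ler_piMr// -(prT Q); apply: le_pr => //.
    exact: measurable_zero_run.
  rewrite addnS; apply: le_trans (zero_run_decay _ _) IH; rewrite /M0; lia.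
move=> e e0; pose k := Num.bound (M0%:R / e).
have kP : M0%:R / e < (M0 + k)%:R.
  apply: (lt_le_trans (archi_boundP _)); first by rewrite divr_ge0// ltW.
  by rewrite ler_nat leq_addl.
have M0k : 0 < (M0 + k)%N%:R :> R by rewrite ltr0n addSn.
rewrite -EFin_pr// lee_fin.
apply: (@le_trans _ _ (pr Q [set x | zero_run (R := R) N (M0 + k) x])).
  by apply: le_pr => //; [exact: measurable_zero_run|move=> x; apply].
rewrite -(ler_pM2l M0k).
apply: le_trans (bound k) _; rewrite -ler_pdivrMr//; exact: ltW.
Qed.

Lemma chain_cond_exp n : {ae Q, forall x, cond_exp_full chain n x =
  (x (lam (fut x) n) != 0%N)%:R / 2 + jump_mean}.
Proof.
have pE x : predictor (past (return_path n (sp x))) =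
    (x (lam (fut x) n) != 0%N)%:R / 2 + @jump_mean R.
  rewrite -lambdaE; set l := lambda _ n.
  apply: (@predictor_state R _ (x (l%:Z - 1))).
  have := past_at_coord (X := chain) (leqnn (lambda (sp x) n)).
  by rewrite subnn => ->.
have h : {ae Q, forall x, cond_exp_full chain n x = predictor (past (return_path n (sp x)))}.
  apply: cond_exp_full_regression; [exact: chain_stationary|
    exact: chain_square_integrable|exact: chain_regression|].
  move=> B mB.
  (* The predictor reads only coordinate 0, here the last entry of the block, so it can be evaluated
     on constant sequences. *)
  pose B' := [set r : R | B (predictor (fun=> r))].
  have mB' : measurable B'.
    have mp : measurable_fun setT (fun r : R => predictor (fun=> r)).
      apply: (measurableT_comp measurable_predictor).
      by apply: measurable_pathsP.
    exact: measurable_preimageT mp mB.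
  pose G := returns_generator chain (@measurable _ R) n (fun i w => chain i w).
  have -> : [set w | B (predictor (past (return_path n (sp w))))] =
      [set w | exists l : nat, lambda (sp w) n = l /\ B' (chain l w)].
    have E x : B' (chain (lambda (sp x) n) x) = B (predictor (past (return_path n (sp x)))).
      have := past_at_coord (X := chain) (leqnn (lambda (sp x) n)).
      by rewrite subnn /B' /= /predictor => <-.
    apply/seteqP; split=> x.
      by move=> Bx; exists (lambda (sp x) n); rewrite E.
    by move=> [l [<-]]; rewrite E.
  apply: (@measurable_exists _ (g_sigma_algebraType G)) => l.
  by apply: sub_gen_smallest; exists l, l, B'.
by apply: filterS h => x ->; exact: pE.
Qed.

Lemma estimate_full_failure (f : nat -> set R -> R) : is_selector f ->
  (0 < Q [set w | 0 < limn_esup (fun n =>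
    `|estimate f (sp w) n - cond_exp_full chain n w|%:E)])%E.
Proof.
move=> hf; set F := [set w | _].
have iZ n := integrable_next_value (@chain_stationary R) (@chain_square_integrable R) n.
have mY n : measurable_fun setT (cond_exp_full chain n).
  have [_ mY _] := cond_expP (@full_sigma_measurable _ _ _ _ chain n) (iZ n).
  by move=> _ B mB; rewrite setTI; apply: full_sigma_measurable (mY B mB).
have mF : measurable F.
  have mu : measurable_fun setT (fun w => limn_esup (fun n =>
      `|estimate f (sp w) n - cond_exp_full chain n w|%:E)).
    apply: measurable_fun_limn_esup => n; apply/measurable_EFinP.
    apply: measurableT_comp => //; apply: measurable_funB; last exact: mY.
    exact: measurable_estimate.
  rewrite -[X in measurable X]setTI; exact: emeasurable_fun_o_infty.
have [L aeL] := limit_past_version (@chain_stationary R).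
pose S := [set y : @paths R nat | (y 0%N == 0) || (y 0%N == 2^-1)].
have mS : measurable S.
  rewrite (_ : S = [set y : @paths R nat | y 0%N = 0 \/ y 0%N = 2^-1]).
    by apply: measurable_disj;
      exact: measurable_preimageT (measurable_coord _) (measurable_set1 _).
  apply/seteqP; split=> y; rewrite /S/=; last by move=> [->|->]; rewrite eqxx ?orbT.
  by move=> /orP[/eqP ->|/eqP ->]; [left|right].
have QS : Q (L @^-1` S) = (2^-1)%:E.
  rewrite -[2^-1]expr1 -(pr_value (R := R) 0 0) EFin_pr; last exact: measurable_value.
  rewrite -[LHS]/(distribution Q L S) (limit_past_law (@chain_stationary R) aeL mS).
  congr (Q _); apply/seteqP; split=> x; rewrite /S /= /past /sample_path oppr0 chainE state_low.
    by move=> /eqP.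
  by move=> ->.
have mSL : measurable (L @^-1` S) by exact: measurable_funPTI.
have sub : {ae Q, forall w, S (L w) -> F w}.
  have h1 := estimate_cvg (@chain_stationary R) (@chain_square_integrable R)
    (@chain_regression R) hf.
  have h2 : {ae Q, forall x, forall n, cond_exp_full chain n x =
    (x (lam (fut x) n) != 0%N)%:R / 2 + jump_mean} by apply: ae_forall => n; exact: chain_cond_exp.
  apply: filterS3 (filterI h1 h2) zero_runs_end_ae aeL => w [[c _] h] io [rw Lw] SL.
  have {}c : estimate f (sp w) n @[n --> \oo] --> (@jump_mean R).
    move: c; rewrite /predictor Lw; move: SL; rewrite /S /= => ->.
    by rewrite mul0r add0r.
  (* On [S] the estimates tend to [jump_mean], while infinitely often the conditional expectation is
     [jump_mean + 1/2]; once the estimates are within 1/4 of their limit, the difference is at least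
     1/4 at those times. *)
  have h4 : 0 < 4^-1 :> R by rewrite invr_gt0.
  have /cvgrPdist_le/(_ _ h4)[N _ hN] := c.
  rewrite /F /= limn_esup_lim; apply: (@lt_le_trans _ _ (4^-1)%:E); first by rewrite lte_fin.
  apply: lime_ge; first exact: is_cvg_esups.
  apply: nearW => n; have [j [nj xj]] := io (maxn n N).
  apply: (@le_trans _ _ (`|estimate f (sp w) j - cond_exp_full chain j w|%:E)).
    have hj := hN j (leq_trans (leq_maxr _ _) nj).
    rewrite lee_fin h (introN eqP xj) mul1r ler_normr; apply/orP; right.
    by move: hj; rewrite ler_norml => /andP[? ?]; lra.
  apply: ereal_sup_ubound; exists j => //=; exact: leq_trans (leq_maxl _ _) nj.
apply: (@lt_le_trans _ _ (Q (L @^-1` S))); first by rewrite QS lte_fin invr_gt0.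
have -> : Q (L @^-1` S) = Q (L @^-1` S `&` F).
  apply: (probability_ae_eq mSL _ sub) => [|w h]; first exact: measurableI.
  by split=> [Sw|[]//]; split=> //; exact: h.
by apply: le_measure; rewrite ?inE//; exact: measurableI.
Qed.

End markov_example_failure.

Theorem mainTheorem1 (R : realType) (f : nat -> set R -> R)
    (hf : is_selector f) :
  (forall (d : measure_display) (T : measurableType d) (P : probability T R)
      (X : int -> {RV P >-> R}),
    stationary X ->
    ('E_P[fun w => (`|X 0 w| ^+ 2)%R] < +oo)%E ->
    [/\ (forall e : (nat -> R) -> R, is_cond_mean X e ->
          {ae P, forall w,
            estimate f (sample_path X w) n @[n --> \oo]
              --> e (limit_past (sample_path X w)) /\
            cond_exp_quantized X n w @[n --> \oo]
              --> e (limit_past (sample_path X w))}),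
        {ae P, forall w,
          `|estimate f (sample_path X w) n - cond_exp_quantized X n w|
            @[n --> \oo] --> (0 : R)} &
        (almost_surely_continuous X ->
          {ae P, forall w,
            `|estimate f (sample_path X w) n - cond_exp_full X n w|
              @[n --> \oo] --> (0 : R)})]) /\
  (exists (d : measure_display) (T : measurableType d) (P : probability T R)
      (X : int -> {RV P >-> R}) (S : set R),
    [/\ countable S, S `<=` [set x | 0 <= x <= 1] & forall i w, S (X i w)] /\
    [/\ stationary X, ergodic X, markov_chain X &
        (0 < P [set w | 0 < limn_esup (fun n =>
          `|estimate f (sample_path X w) n - cond_exp_full X n w|%:E)])%E]).
Proof.
split=> [d T P X stX EX2|].
  split.
  - by move=> e he; exact: (quantized_cvg stX EX2 (cond_mean_regression he) hf).
  - exact: estimate_quantized_diff.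
  - exact: estimate_full_diff.
exists _, nat_paths, (geo_prob (R := R)), (@chain R), states; split; split.
- exact: countable_states.
- by move=> _ [[a k] _ <-]; exact: state01.
- by move=> i x; exists (x (i - 1), x i).
- exact: chain_stationary.
- exact: chain_ergodic.
- exact: chain_markov.
- exact: estimate_full_failure.
Qed.
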